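(* Let $G$ be a non-elementary group which is hyperbolic relative to a collection of proper subgroups $\{H_\lambda\}_{\lambda\in\Lambda}$, and let $E_G(G)$ denote the maximal finite normal subgroup of $G$. If $E_G(G)=\{1\}$, then $G$ satisfies property $\mathrm{P}_{nai}$; that is, for every finite subset $F\subseteq G\setminus\{1\}$ there exists an element $g_0\in G$ of infinite order such that for each $f\in F$ the subgroup $\langle f,g_0\rangle$ of $G$ generated by $f$ and $g_0$ is canonically isomorphic to the free product $\langle f\rangle*\langle g_0\rangle$.
   Context: Canonically isomorphic: for subgroups $A,B\le G$, the subgroup $\langle A,B\rangle$ is canonically isomorphic to $A*B$ if the homomorphism $A*B\to G$ induced by the inclusions $A\hookrightarrow G$, $B\hookrightarrow G$ is injective. Elementary: a group is elementary if it has a cyclic subgroup of finite index (in particular finite groups are elementary); otherwise it is non-elementary. Relative hyperbolicity (Osin's definition): Let $G$ be a group, $\{H_\lambda\}_{\lambda\in\Lambda}$ a collection of subgroups of $G$ (called peripheral subgroups) and $X\subseteq G$ a subset, which for convenience is assumed to satisfy $X^{-1}=X$. $X$ is a relative generating set of $G$ with respect to $\{H_\lambda\}_{\lambda\in\Lambda}$ if $G$ is generated by $X\cup\bigcup_{\lambda}H_\lambda$. Then $G$ is a quotient of $\mathcal F=(\ast_{\lambda\in\Lambda}H_\lambda)*F(X)$, where $F(X)$ is the free group with basis $X$. If $\mathcal R\subseteq \mathcal F$ is such that the kernel of the natural epimorphism $\mathcal F\to G$ is the normal closure of $\mathcal R$ in $\mathcal F$, one says $G$ has the relative presentation $\langle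 X,\{H_\lambda\}_{\lambda\in\Lambda}\mid R=1,\ R\in\mathcal R\rangle$; it is finite if $X$ and $\mathcal R$ are finite. Put $\mathcal H=\bigsqcup_{\lambda\in\Lambda}(H_\lambda\setminus\{1\})$. A finite relative presentation satisfies a linear relative isoperimetric inequality if there is $C>0$ such that every word $w$ in the alphabet $X\cup\mathcal H$ representing $1$ in $G$ can be written, with equality in $\mathcal F$, as $w=\prod_{i=1}^k f_i^{-1}R_i^{\pm1}f_i$ with $R_i\in\mathcal R$, $f_i\in \mathcal F$ and $k\le C\|w\|$, where $\|w\|$ is the length of the word $w$. The group $G$ is hyperbolic relative to $\{H_\lambda\}_{\lambda\in\Lambda}$ if it admits a finite relative presentation satisfying a linear relative isoperimetric inequality. The collection consists of proper subgroups if $H_\lambda\ne G$ for all $\lambda\in\Lambda$. Maximal finite normal subgroup: every non-elementary group $G$ that is hyperbolic relative to a collection of proper subgroups has a finite normal subgroup containing all finite normal subgroups of $G$ (a known fact); it is denoted $E_G(G)$. *)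

(* Defs.v *)
From HB Require Import structures.
From mathcomp Require Import all_boot.
From mathcomp Require Import boolp classical_sets cardinality.

Set Implicit Arguments.
Unset Strict Implicit.
Unset Printing Implicit Defensive.

Local Open Scope classical_set_scope.
Local Open Scope quotient_scope.
Local Open Scope group_scope.

Record subgroup (G : groupType) := Subgroup {
  subgroup_set :> set G;
  subgroup_closed : group_closed [in subgroup_set]
}.

Definition subgroup_type (G : groupType) (H : subgroup G) : Type :=
  {x : G | x \in subgroup_set H}.

HB.instance Definition _ (G : groupType) (H : subgroup G) :=
  [isSub of subgroup_type H for @sval G (fun x => x \in subgroup_set H)].
HB.instance Definition _ (G : groupType) (H : subgroup G) :=
  [Choice of subgroup_type H by <:].
HB.instance Definition _ (G : groupType) (H : subgroup G) :=
  SubChoice_isSubGroup.Build G _ (subgroup_type H) (subgroup_closed H).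

Definition subgroup_incl (G : groupType) (H : subgroup G) :
  {multiplicative subgroup_type H -> G} := val.

Section Subgroups.
Variable G : groupType.
Implicit Types (S : set G) (H N : subgroup G).

Lemma subgroup1 H : subgroup_set H 1.
Proof. by have [+ _] := subgroup_closed H; rewrite inE. Qed.

Lemma subgroup_div H x y :
  subgroup_set H x -> subgroup_set H y -> subgroup_set H (x / y).
Proof.
move=> Hx Hy; have [_ /(_ x y)] := subgroup_closed H.
by rewrite !inE; apply.
Qed.

Definition gen_set S : set G := [set x | forall H, S `<=` H -> subgroup_set H x].

Lemma gen_subproof S : group_closed [in gen_set S].
Proof.
split=> [|x y]; rewrite !inE; first by move=> H _; apply: subgroup1.
by move=> Sx Sy H SH; apply: subgroup_div; [apply: Sx | apply: Sy].
Qed.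

Definition gen S : subgroup G := Subgroup (gen_subproof S).

Definition normal_subgroup N : Prop :=
  forall x y : G, subgroup_set N x -> subgroup_set N (x ^ y).

Definition normal_closure S : set G :=
  [set x | forall N, normal_subgroup N -> S `<=` N -> subgroup_set N x].

Definition cyclic_subgroup H : Prop :=
  exists g : G, (H : set G) = gen [set g].

Definition finite_index H : Prop :=
  finite_set (range (fun x : G => [set x * h | h in H])).

Definition max_finite_normal_subgroup N : Prop :=
  [/\ normal_subgroup N, finite_set N &
      forall M, normal_subgroup M -> finite_set M -> M `<=` N].

Definition infinite_order (g : G) : Prop :=
  forall n : nat, (0 < n)%N -> g ^+ n <> 1.

End Subgroups.

Definition elementary (G : groupType) : Prop :=
  exists C : subgroup G, cyclic_subgroup C /\ finite_index C.

(** The letter [(s, true)] stands for the generator [s] and [(s, false)] for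
    its formal inverse. *)
Definition gword (S : Type) : Type := seq (S * bool).
HB.instance Definition _ (S : Type) := gen_eqMixin (gword S).
HB.instance Definition _ (S : Type) := gen_choiceMixin (gword S).

Definition inv_letter (S : Type) (l : S * bool) : S * bool := (l.1, ~~ l.2).
Definition inv_gword (S : Type) (w : gword S) : gword S :=
  rev (map (@inv_letter S) w).

Section Presentation.
Variables (S : Type) (R : set (gword S)).
Implicit Types u v w : gword S.

Inductive pres_eq : gword S -> gword S -> Prop :=
| Pres_refl w : pres_eq w w
| Pres_sym v w : pres_eq v w -> pres_eq w v
| Pres_trans u v w : pres_eq u v -> pres_eq v w -> pres_eq u w
| Pres_cancel u v l : pres_eq (u ++ l :: inv_letter l :: v) (u ++ v)
| Pres_relator u v r : R r -> pres_eq (u ++ r ++ v) (u ++ v).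

Definition pres_rel : rel (gword S) := fun v w => `[< pres_eq v w >].

Lemma pres_rel_equiv : equiv_class_of pres_rel.
Proof.
split=> [w | v w | v u w].
- by apply/asboolP; apply: Pres_refl.
- by apply: asbool_equiv_eq; split; apply: Pres_sym.
- by move=> /asboolP uv /asboolP vw; apply/asboolP; apply: Pres_trans vw.
Qed.

Canonical pres_equiv : equiv_rel (gword S) :=
  EquivRelPack pres_rel_equiv.

Definition presented : Type := {eq_quot pres_equiv}.
HB.instance Definition _ := Choice.on presented.
HB.instance Definition _ := EqQuotient.on presented.

Definition pres_class w : presented := \pi_presented w.

Lemma pres_classP v w : pres_class v = pres_class w <-> pres_eq v w.
Proof.
split=> [/eqmodP/asboolP // | vw]; exact/eqmodP/asboolP.
Qed.

Lemma pres_classK (x : presented) : pres_class (repr x) = x.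
Proof. exact: reprK. Qed.

Lemma pres_eq_cat v v' w w' :
  pres_eq v v' -> pres_eq w w' -> pres_eq (v ++ w) (v' ++ w').
Proof.
have catl u x y : pres_eq x y -> pres_eq (u ++ x) (u ++ y).
  elim=> {x y} [x|x y _|x y z _ + _|x y l|x y r Rr].
  - exact: Pres_refl.
  - exact: Pres_sym.
  - exact: Pres_trans.
  - by rewrite !catA; apply: Pres_cancel.
  - by rewrite [u ++ (x ++ _)]catA [u ++ (x ++ _)]catA; apply: Pres_relator.
have catr u x y : pres_eq x y -> pres_eq (x ++ u) (y ++ u).
  elim=> {x y} [x|x y _|x y z _ + _|x y l|x y r Rr].
  - exact: Pres_refl.
  - exact: Pres_sym.
  - exact: Pres_trans.
  - by rewrite -!catA; apply: Pres_cancel.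
  - by rewrite -!catA; apply: Pres_relator.
by move=> vv' ww'; apply: Pres_trans (catl _ _ _ ww'); apply: catr.
Qed.

Lemma inv_letterK : involutive (@inv_letter S).
Proof. by case=> s b; rewrite /inv_letter /= negbK. Qed.

Lemma inv_gwordK : involutive (@inv_gword S).
Proof. by move=> w; rewrite /inv_gword map_rev revK mapK//; apply: inv_letterK. Qed.

Lemma pres_eq_catV w : pres_eq (w ++ inv_gword w) [::].
Proof.
elim: w => [|l w IH]; first exact: Pres_refl.
rewrite /inv_gword /= rev_cons -cats1.
have -> : l :: w ++ rev [seq inv_letter i | i <- w] ++ [:: inv_letter l]
          = [:: l] ++ (w ++ inv_gword w) ++ [:: inv_letter l] by rewrite /= -catA.
apply: (Pres_trans (v := [:: l] ++ [::] ++ [:: inv_letter l])).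
  by apply: pres_eq_cat; [apply: Pres_refl | apply: pres_eq_cat; [|apply: Pres_refl]].
exact: (Pres_cancel [::] [::] l).
Qed.

Lemma pres_eq_catVl w : pres_eq (inv_gword w ++ w) [::].
Proof. by have := pres_eq_catV (inv_gword w); rewrite inv_gwordK. Qed.

Lemma pres_eq_inv v w : pres_eq v w -> pres_eq (inv_gword v) (inv_gword w).
Proof.
move=> vw; apply: (Pres_trans (v := inv_gword v ++ (w ++ inv_gword w))).
  apply: Pres_sym; rewrite -[X in pres_eq _ X]cats0.
  by apply: pres_eq_cat; [apply: Pres_refl | apply: pres_eq_catV].
rewrite catA -[X in pres_eq _ X]cat0s; apply: pres_eq_cat; last exact: Pres_refl.
apply: Pres_trans (pres_eq_catVl v).
by apply: pres_eq_cat; [apply: Pres_refl | apply: Pres_sym].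
Qed.

Definition pres_mul (x y : presented) : presented :=
  pres_class (repr x ++ repr y).
Definition pres_one : presented := pres_class [::].
Definition pres_inv (x : presented) : presented :=
  pres_class (inv_gword (repr x)).

Lemma pres_repr w : pres_eq (repr (pres_class w)) w.
Proof. by apply/pres_classP; rewrite pres_classK. Qed.

Lemma pres_mulE v w :
  pres_mul (pres_class v) (pres_class w) = pres_class (v ++ w).
Proof. by apply/pres_classP; apply: pres_eq_cat; apply: pres_repr. Qed.

Lemma pres_invE w : pres_inv (pres_class w) = pres_class (inv_gword w).
Proof. by apply/pres_classP; apply: pres_eq_inv; apply: pres_repr. Qed.

Lemma pres_mulA : associative pres_mul.
Proof.
move=> x y z; rewrite -(pres_classK x) -(pres_classK y) -(pres_classK z).
by rewrite !pres_mulE catA.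
Qed.

Lemma pres_mul1 : left_id pres_one pres_mul.
Proof. by move=> x; rewrite -(pres_classK x) pres_mulE. Qed.

Lemma pres_mulr1 : right_id pres_one pres_mul.
Proof. by move=> x; rewrite -(pres_classK x) pres_mulE cats0. Qed.

Lemma pres_mulV : left_inverse pres_one pres_inv pres_mul.
Proof.
move=> x; rewrite -(pres_classK x) pres_invE pres_mulE.
exact/pres_classP/pres_eq_catVl.
Qed.

Lemma pres_mulrV : right_inverse pres_one pres_inv pres_mul.
Proof.
move=> x; rewrite -(pres_classK x) pres_invE pres_mulE.
exact/pres_classP/pres_eq_catV.
Qed.

HB.instance Definition _ := isGroup.Build presented
  pres_mulA pres_mul1 pres_mulr1 pres_mulV pres_mulrV.

Definition pres_gen (s : S) : presented := pres_class [:: (s, true)].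

Section Lift.
Variables (G : groupType) (f : S -> G).

Definition eval_letter (l : S * bool) : G := if l.2 then f l.1 else (f l.1)^-1.
Definition eval_gword (w : gword S) : G := \prod_(l <- w) eval_letter l.

Definition pres_lift (x : presented) : G := eval_gword (repr x).

Hypothesis fR : forall r, R r -> eval_gword r = 1.

Lemma eval_gword_cat v w : eval_gword (v ++ w) = eval_gword v * eval_gword w.
Proof. by rewrite /eval_gword big_cat. Qed.

Lemma eval_gword_eq v w : pres_eq v w -> eval_gword v = eval_gword w.
Proof.
elim=> {v w} [w|v w _ vw|u v w _ uv _ vw|u v l|u v r /fR Rr].
- by [].
- by rewrite vw.
- by rewrite uv.
- rewrite !eval_gword_cat; congr (_ * _); rewrite /eval_gword !big_cons.
  by case: l => x []; rewrite /eval_letter /= ?mulVKg ?mulKg.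
- by rewrite !eval_gword_cat Rr mul1g.
Qed.

Lemma pres_lift_class w : pres_lift (pres_class w) = eval_gword w.
Proof. exact/eval_gword_eq/pres_repr. Qed.

Lemma pres_liftM : {morph pres_lift : x y / x * y}.
Proof.
move=> x y; rewrite -(pres_classK x) -(pres_classK y).
by rewrite [_ * _]pres_mulE !pres_lift_class eval_gword_cat.
Qed.

Lemma pres_lift_gen s : pres_lift (pres_gen s) = f s.
Proof. by rewrite pres_lift_class /eval_gword big_seq1. Qed.

End Lift.
End Presentation.

Definition free_group (S : Type) : groupType := @presented S set0.

Section FreeGroup.
Variables (S : Type) (G : groupType) (f : S -> G).

Definition free_lift_fun : free_group S -> G := pres_lift f.

Lemma free_liftM : {morph free_lift_fun : x y / x * y}.
Proof. exact: pres_liftM. Qed.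

HB.instance Definition _ := isMultiplicative.Build _ _ free_lift_fun free_liftM.

Definition free_lift : {multiplicative free_group S -> G} := free_lift_fun.

End FreeGroup.

(** The free product of [A i], [i : I]: the generators are the disjoint union
    of the [A i], the relators their multiplication tables. *)
Definition freeprod_relators (I : Type) (A : I -> groupType) :
    set (gword {i : I & A i}) :=
  [set r | exists i (a b : A i),
     r = [:: (existT _ i a, true); (existT _ i b, true);
             (existT _ i (a * b), false)]].

Definition freeprod (I : Type) (A : I -> groupType) : groupType :=
  presented (freeprod_relators (A := A)).

Definition freeprod_incl (I : Type) (A : I -> groupType) (i : I) (a : A i) :
  freeprod A := pres_gen _ (existT _ i a).

Section FreeProduct.
Variables (I : Type) (A : I -> groupType) (G : groupType).
Variable f : forall i, {multiplicative A i -> G}.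

Definition freeprod_lift_fun : freeprod A -> G :=
  pres_lift (fun s : {i : I & A i} => f (projT1 s) (projT2 s)).

Lemma freeprod_relatorsP r : freeprod_relators r ->
  eval_gword (fun s : {i : I & A i} => f (projT1 s) (projT2 s)) r = 1.
Proof.
move=> [i [a [b ->]]]; rewrite /eval_gword !big_cons big_nil /eval_letter /=.
by rewrite gmulfM mulg1 mulgA mulgV.
Qed.

Lemma freeprod_liftM : {morph freeprod_lift_fun : x y / x * y}.
Proof. exact/pres_liftM/freeprod_relatorsP. Qed.

HB.instance Definition _ :=
  isMultiplicative.Build _ _ freeprod_lift_fun freeprod_liftM.

Definition freeprod_lift : {multiplicative freeprod A -> G} :=
  freeprod_lift_fun.

Lemma freeprod_lift_incl i (a : A i) : freeprod_lift (freeprod_incl a) = f i a.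
Proof. exact/pres_lift_gen/freeprod_relatorsP. Qed.

End FreeProduct.

Definition pair_family (A B : groupType) (b : bool) : groupType :=
  if b then A else B.

Definition freeprod2 (A B : groupType) : groupType := freeprod (pair_family A B).

Definition freeprod2_inl (A B : groupType) (a : A) : freeprod2 A B :=
  @freeprod_incl bool (pair_family A B) true a.
Definition freeprod2_inr (A B : groupType) (b : B) : freeprod2 A B :=
  @freeprod_incl bool (pair_family A B) false b.

Definition freeprod2_lift (A B G : groupType)
    (f : {multiplicative A -> G}) (g : {multiplicative B -> G}) :
  {multiplicative freeprod2 A B -> G} :=
  @freeprod_lift bool (pair_family A B) G
    (fun b => if b return {multiplicative pair_family A B b -> G} then f else g).

Lemma freeprod2_liftE (A B G : groupType)
    (f : {multiplicative A -> G}) (g : {multiplicative B -> G}) :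
  (forall a, freeprod2_lift f g (freeprod2_inl B a) = f a) /\
  (forall b, freeprod2_lift f g (freeprod2_inr A b) = g b).
Proof. by split=> x; apply: freeprod_lift_incl. Qed.

Definition canonically_free_product (G : groupType) (A B : subgroup G) : Prop :=
  injective (freeprod2_lift (subgroup_incl A) (subgroup_incl B)).

Definition property_Pnai (G : groupType) : Prop :=
  forall F : set G, finite_set F -> ~ F 1 ->
    exists g0 : G, infinite_order g0 /\
      forall f, F f -> canonically_free_product (gen [set f]) (gen [set g0]).

Section RelativePresentation.
Variables (G : groupType) (Lambda : Type) (H : Lambda -> subgroup G).
Variable X : set G.

Definition relative_generating : Prop :=
  (gen (X `|` \bigcup_l H l) : set G) = setT.

Definition rel_free : groupType :=
  freeprod2 (freeprod (fun l => subgroup_type (H l))) (free_group (set_type X)).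

Definition rel_epi : {multiplicative rel_free -> G} :=
  freeprod2_lift (freeprod_lift (fun l => subgroup_incl (H l)))
                 (free_lift (fun x : set_type X => val x)).

Definition relative_presentation (R : set rel_free) : Prop :=
  relative_generating /\ [set w | rel_epi w = 1] = normal_closure R.

(** The alphabet is a disjoint union: an element of [G] lying in [X] and in some
    peripheral subgroups gives one letter for each.  There are no letters for
    formal inverses: [X] is symmetric in [relatively_hyperbolic], so [x^-1] is
    itself a letter, and a basis element of [free_group (set_type X)]
    independent of [x]. *)
Definition rel_letter : Type :=
  (set_type X + {l : Lambda & {h : subgroup_type (H l) | h != 1}})%type.

Definition rel_letter_val (a : rel_letter) : rel_free :=
  match a with
  | inl x => freeprod2_inr _ (pres_gen _ x)
  | inr (existT l h) =>
      freeprod2_inl _ (freeprod_incl (A := fun l => subgroup_type (H l)) (val h))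
  end.

Definition rel_word_val (w : seq rel_letter) : rel_free :=
  \prod_(a <- w) rel_letter_val a.

(** A real constant can always be replaced by a larger natural one. *)
Definition linear_isoperimetric (R : set rel_free) : Prop :=
  exists C : nat, (0 < C)%N /\
    forall w : seq rel_letter, rel_epi (rel_word_val w) = 1 ->
      exists (k : nat) (f r : 'I_k -> rel_free) (e : 'I_k -> bool),
        [/\ forall i, R (r i),
            rel_word_val w =
              \prod_(i < k) ((f i)^-1 * (if e i then r i else (r i)^-1) * f i) &
            (k <= C * size w)%N].

End RelativePresentation.

Definition relatively_hyperbolic (G : groupType) (Lambda : Type)
    (H : Lambda -> subgroup G) : Prop :=
  exists (X : set G) (R : set (rel_free H X)),
    [/\ [set x^-1 | x in X] = X, finite_set X, finite_set R,
        relative_presentation R & linear_isoperimetric R].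

(* Main.v *)
From HB Require Import structures.
Require Import Defs.
From mathcomp Require Import all_boot all_order all_algebra.
From mathcomp Require Import boolp classical_sets cardinality.
From mathcomp Require Import zify.

(** Filling a closed word by relators bounds the integral over it of every
    additive cost that is bounded on relators and exact along peripheral cosets.
    The cost [u dv], for Lipschitz [u] and [v], turns the linear isoperimetric
    inequality into a linear bound on the area enclosed by the image of a loop
    under [(u, v)], whereas a fat geodesic triangle contains a loop of length
    [O(R)] enclosing area of order [R^2]; so the word metric on the generators
    together with the peripheral elements is hyperbolic.  A cost supported on a
    single peripheral coset gives Osin's bound on isolated components, hence
    acylindricity and unboundedness of that metric.

    In an acylindrical hyperbolic metric, if the axis of a loxodromic [g] and its
    translate by [h] overlap for long then [h] commensurates [g].  Since the core
    of the commensurator of [g] is finite, hence trivial, replacing [g] by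
    suitable words [g^n c g^m c^-1] yields a loxodromic element whose commensurator
    contains no nontrivial power of any given [f].  As [f] commutes with its
    powers, the powers of [f] diverge uniformly from the axis of [g], and [f] plays
    ping-pong with a large power of [g]. *)

Set Implicit Arguments.
Unset Strict Implicit.
Unset Printing Implicit Defensive.

Local Open Scope classical_set_scope.
Local Open Scope group_scope.

(** * Costs on the relative free group *)

(** Peripheral subgroups may be infinite although each of their cosets has diameter at most one, so
    balls of the metric are infinite and counting points is useless. All finiteness stems from the
    finitely many peripheral letters of the relators: products of boundedly many of them form a
    finite set, even for infinite [Lambda]. Acylindricity is drawn from this and then carries the
    pigeonhole arguments about commensurators. A cost becomes a homomorphism to a group of pairs
    (function, element), where conjugating a relator merely shifts the base point; bounds on
    relators must therefore be uniform in that point although [u] is unbounded. This works for area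
    because the integral of [u dv] over a loop ignores additive constants in [u]. The metric part
    uses integer lengths and the four-point inequality; an axis is the sequence of powers of an
    element with quasi-additive length. The two exponents of [g^n c g^m c^-1] must differ in size:
    an element reversing the axis of this word would carry a corner into the interior of the longer
    straight segment of the inverse, which [c] does not allow. *)

Lemma morph_mulg1 (A B : groupType) (f : A -> B) :
  {morph f : a b / a * b} -> f 1 = 1.
Proof. by move=> fM; apply: (@mulgI _ (f 1)); rewrite -fM !mulg1. Qed.

Lemma morph_mulgV (A B : groupType) (f : A -> B) :
  {morph f : a b / a * b} -> forall a, f a^-1 = (f a)^-1.
Proof.
move=> fM a; apply: (@mulgI _ (f a)).
by rewrite -fM !mulgV (morph_mulg1 fM).
Qed.

Lemma multiplicative1 (A B : groupType) (f : {multiplicative A -> B}) : f 1 = 1.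
Proof. exact/morph_mulg1/gmulfM. Qed.

Lemma multiplicativeV (A B : groupType) (f : {multiplicative A -> B}) a :
  f a^-1 = (f a)^-1.
Proof. exact/morph_mulgV/gmulfM. Qed.

Section Presented.
Variables (S : Type) (R : set (gword S)).

Lemma presented_ind (P : presented R -> Prop) :
  P 1 -> (forall s, P (pres_gen R s)) ->
  (forall x y, P x -> P y -> P (x * y)) -> (forall x, P x -> P x^-1) ->
  forall x, P x.
Proof.
move=> P1 Pg PM PV x; rewrite -(pres_classK x).
elim: (repr x) => [|[s b] w IH]; first exact: P1.
have -> : pres_class R ((s, b) :: w) = pres_class R [:: (s, b)] * pres_class R w.
  by rewrite [RHS]pres_mulE.
apply: PM => //; case: b; first exact: Pg.
have -> : pres_class R [:: (s, false)] = (pres_gen R s)^-1.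
  by rewrite /pres_gen [RHS]pres_invE.
exact/PV/Pg.
Qed.

End Presented.

Lemma freeprod_inclM (I : Type) (A : I -> groupType) (i : I) :
  {morph (@freeprod_incl I A i) : a b / a * b}.
Proof.
move=> a b; apply/esym; rewrite [LHS]pres_mulE; apply/pres_classP => /=.
apply: (Pres_trans (v := [:: (existT _ i a, true); (existT _ i b, true);
   (existT _ i (a * b), false); (existT _ i (a * b), true)])).
  apply: Pres_sym.
  exact: (Pres_cancel _ [:: (existT _ i a, true); (existT _ i b, true)] [::]
    (existT _ i (a * b), false)).
apply: (@Pres_relator _ _ [::] [:: (existT _ i (a * b), true)]
  [:: (existT _ i a, true); (existT _ i b, true); (existT _ i (a * b), false)]).
by exists i, a, b.
Qed.

Lemma freeprod2_inlM (A B : groupType) :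
  {morph (@freeprod2_inl A B) : a b / a * b}.
Proof. exact: (@freeprod_inclM bool (pair_family A B) true). Qed.

Lemma freeprod2_inrM (A B : groupType) :
  {morph (@freeprod2_inr A B) : a b / a * b}.
Proof. exact: (@freeprod_inclM bool (pair_family A B) false). Qed.

(** The semidirect product of the integer-valued functions on [G] by [G]. *)
Definition twisted (G : groupType) : Type := ((G -> int) * G)%type.
HB.instance Definition _ (G : groupType) := gen_eqMixin (twisted G).
HB.instance Definition _ (G : groupType) := gen_choiceMixin (twisted G).

Section Twisted.
Variable G : groupType.
Implicit Types a b c : twisted G.

Definition tw_one : twisted G := (fun=> 0%R, 1).
Definition tw_mul a b : twisted G := (fun y => (a.1 y + b.1 (y * a.2)%g)%R, a.2 * b.2).
Definition tw_inv a : twisted G := (fun y => (- a.1 (y * a.2^-1)%g)%R, a.2^-1).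

Lemma tw_mulA : associative tw_mul.
Proof.
move=> a b c; rewrite /tw_mul /= mulgA; congr pair; apply/funext => y.
by rewrite mulgA GRing.addrA.
Qed.

Lemma tw_mul1 : left_id tw_one tw_mul.
Proof. by case=> a g; rewrite /tw_mul /= mul1g; congr pair; apply/funext => y;
  rewrite mulg1 GRing.add0r. Qed.

Lemma tw_mulr1 : right_id tw_one tw_mul.
Proof. by case=> a g; rewrite /tw_mul /= mulg1; congr pair; apply/funext => y;
  rewrite GRing.addr0. Qed.

Lemma tw_mulV : left_inverse tw_one tw_inv tw_mul.
Proof. by case=> a g; rewrite /tw_mul /= mulVg; congr pair; apply/funext => y;
  rewrite GRing.addNr. Qed.

Lemma tw_mulrV : right_inverse tw_one tw_inv tw_mul.
Proof. by case=> a g; rewrite /tw_mul /= mulgV; congr pair; apply/funext => y;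
  rewrite mulgK GRing.addrN. Qed.

HB.instance Definition _ := isGroup.Build (twisted G)
  tw_mulA tw_mul1 tw_mulr1 tw_mulV tw_mulrV.

End Twisted.

Section Cost.
Variables (G : groupType) (Lambda : Type) (H : Lambda -> subgroup G) (X : set G).

(** Additivity inside a peripheral coset is what respects the multiplication tables of the
    peripheral subgroups; edges labelled [None] come from a free basis and may carry any cost. *)
Definition cocycle (cost : option Lambda -> G -> G -> int) : Prop :=
  forall l x y z, subgroup_set (H l) (x^-1 * y) -> subgroup_set (H l) (y^-1 * z) ->
    (cost (Some l) x y + cost (Some l) y z = cost (Some l) x z)%R.

Variables (cost : option Lambda -> G -> G -> int) (cc : cocycle cost).

Definition cost_sub l (h : subgroup_type (H l)) : twisted G :=
  (fun y => cost (Some l) y (y * val h), val h).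

Lemma subgroup_valP l (h : subgroup_type (H l)) : subgroup_set (H l) (val h).
Proof. by have := valP h; rewrite inE. Qed.

Lemma cost_subM l : {morph (@cost_sub l) : a b / a * b}.
Proof.
move=> a b; congr pair; apply/funext => y /=; rewrite mulgA (cc (l := l))//.
  by rewrite mulKg; apply: subgroup_valP.
by rewrite mulKg; apply: subgroup_valP.
Qed.

Definition cost_sub_hom l : {multiplicative subgroup_type (H l) -> twisted G} :=
  HB.pack (@cost_sub l) (isMultiplicative.Build _ _ (@cost_sub l) (@cost_subM l)).

Definition cost_basis (x : set_type X) : twisted G :=
  (fun y => cost None y (y * val x), val x).

(** At [y], the first component of an image is the cost of reading the element as a walk that starts
    at [y]; the second component is the displacement of that walk. *)
Definition cost_hom : {multiplicative rel_free H X -> twisted G} :=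
  freeprod2_lift (freeprod_lift cost_sub_hom) (free_lift cost_basis).

Local Notation epi := (rel_epi H X).

Definition rel_free_sub l (h : subgroup_type (H l)) : rel_free H X :=
  freeprod2_inl _ (freeprod_incl (A := fun l => subgroup_type (H l)) h).

Definition rel_free_basis (x : set_type X) : rel_free H X :=
  freeprod2_inr _ (pres_gen _ x).

Lemma rel_free_ind (P : rel_free H X -> Prop) :
  P 1 -> (forall l h, P (@rel_free_sub l h)) -> (forall x, P (rel_free_basis x)) ->
  (forall x y, P x -> P y -> P (x * y)) -> (forall x, P x -> P x^-1) ->
  forall x, P x.
Proof.
move=> P1 Ps Pb PM PV; apply: presented_ind => // -[[] /= a].
- pose inl := @freeprod2_inl (freeprod (fun l => subgroup_type (H l))) (free_group (set_type X)).
  have inlM : {morph inl : x y / x * y} := @freeprod2_inlM _ _.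
  elim/presented_ind: a => [|[l h]|x y Px Py|x Px].
  + by rewrite -[pres_gen _ _]/(inl 1) (morph_mulg1 inlM).
  + exact: (Ps l h).
  + by rewrite -[pres_gen _ _]/(inl (x * y)) inlM; apply: PM.
  + by rewrite -[pres_gen _ _]/(inl x^-1) (morph_mulgV inlM); apply: PV.
- pose inr := @freeprod2_inr (freeprod (fun l => subgroup_type (H l))) (free_group (set_type X)).
  have inrM : {morph inr : x y / x * y} := @freeprod2_inrM _ _.
  elim/presented_ind: a => [|x|x y Px Py|x Px].
  + by rewrite -[pres_gen _ _]/(inr 1) (morph_mulg1 inrM).
  + exact: (Pb x).
  + by rewrite -[pres_gen _ _]/(inr (x * y)) inrM; apply: PM.
  + by rewrite -[pres_gen _ _]/(inr x^-1) (morph_mulgV inrM); apply: PV.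
Qed.

Lemma cost_hom_sub l (h : subgroup_type (H l)) :
  cost_hom (rel_free_sub h) = cost_sub h.
Proof.
have [E _] := freeprod2_liftE (freeprod_lift cost_sub_hom) (free_lift cost_basis).
rewrite /cost_hom E; exact: (@freeprod_lift_incl _ _ _ cost_sub_hom l h).
Qed.

Lemma cost_hom_basis x : cost_hom (rel_free_basis x) = cost_basis x.
Proof.
have [_ E] := freeprod2_liftE (freeprod_lift cost_sub_hom) (free_lift cost_basis).
by rewrite /cost_hom E /free_lift /= /free_lift_fun pres_lift_gen.
Qed.

Lemma rel_epi_sub l (h : subgroup_type (H l)) :
  epi (rel_free_sub h) = val h.
Proof.
have [E _] := freeprod2_liftE (freeprod_lift (fun l => subgroup_incl (H l)))
  (free_lift (fun x : set_type X => val x)).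
rewrite /rel_epi E; exact: (@freeprod_lift_incl _ _ _ (fun l => subgroup_incl (H l)) l h).
Qed.

Lemma rel_epi_basis x : epi (rel_free_basis x) = val x.
Proof.
have [_ E] := freeprod2_liftE (freeprod_lift (fun l => subgroup_incl (H l)))
  (free_lift (fun x : set_type X => val x)).
by rewrite /rel_epi E /free_lift /= /free_lift_fun pres_lift_gen.
Qed.

Lemma cost_hom2 z : (cost_hom z).2 = epi z.
Proof.
elim/rel_free_ind: z => [|l h|x|x y Ex Ey|x Ex].
- by rewrite !multiplicative1.
- by rewrite cost_hom_sub rel_epi_sub.
- by rewrite cost_hom_basis rel_epi_basis.
- by rewrite !gmulfM -Ex -Ey.
- by rewrite !multiplicativeV -Ex.
Qed.

Lemma cost_hom1 y : (cost_hom 1).1 y = 0%R.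
Proof. by rewrite multiplicative1. Qed.

Lemma cost_homM z z' y :
  (cost_hom (z * z')).1 y = ((cost_hom z).1 y + (cost_hom z').1 (y * epi z)%g)%R.
Proof. by rewrite gmulfM -cost_hom2. Qed.

Lemma cost_homV z y : (cost_hom z^-1).1 y = (- (cost_hom z).1 (y * (epi z)^-1)%g)%R.
Proof. by rewrite multiplicativeV -cost_hom2. Qed.

(** The two legs of the conjugate cancel because the loop [r] returns to its starting point; only
    that point moves. This is why bounds on relators have to be uniform in [y]. *)
Lemma cost_hom_conj f r y : epi r = 1 ->
  (cost_hom (f^-1 * r * f)).1 y = (cost_hom r).1 (y * (epi f)^-1).
Proof.
move=> r1; rewrite !cost_homM cost_homV !gmulfM !multiplicativeV r1 mulg1.
by lia.
Qed.

End Cost.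

(** * Labelled walks *)

Lemma leqD_abs (a b : int) : (`|(a + b)%R| <= `|a| + `|b|)%N.
Proof. by lia. Qed.

(** [join] stands for a common upper bound: a sum of numbers, or a union of finite supports paired
    with a sum. *)
Lemma finite_set_bound (T : choiceType) (N : Type) (n0 : N) (join : N -> N -> N)
    (A : set T) (P : T -> N -> Prop) :
  finite_set A -> (forall a, A a -> exists n, P a n) ->
  (forall a m n, P a m \/ P a n -> P a (join m n)) ->
  exists n, forall a, A a -> P a n.
Proof.
move=> /finite_seqP[s ->] PA Pjoin.
elim: s PA => [|a s IH] PA; first by exists n0.
have [|n nP] := IH; first by move=> b /= bs; apply: PA => /=; rewrite inE bs orbT.
have [|m mP] := PA a; first by rewrite /= mem_head.
exists (join m n) => b /=; rewrite inE => /orP[/eqP-> | bs].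
  by apply: Pjoin; left.
by apply: Pjoin; right; apply: nP.
Qed.

Section Walks.
Variables (G : groupType) (Lambda : Type) (H : Lambda -> subgroup G) (X : set G).
Implicit Types (x y z g : G) (p q : seq (option Lambda * G)).

(** The label is kept because one element may lie in [X] and in several peripheral subgroups, and
    costs depend on which of them is used. *)
Definition edge (l : option Lambda) x y : Prop :=
  if l is Some i then subgroup_set (H i) (x^-1 * y) else X (x^-1 * y).

Fixpoint walk x p : Prop :=
  if p is (l, y) :: q then edge l x y /\ walk y q else True.

Definition walk_end x p : G := last x (unzip2 p).

Fixpoint walk_cost (cost : option Lambda -> G -> G -> int) x p : int :=
  if p is (l, y) :: q then (cost l x y + walk_cost cost y q)%R else 0%R.

Definition walk_from_to x y p : Prop := walk x p /\ walk_end x p = y.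

Lemma walk_cat x p q : walk x (p ++ q) <-> walk x p /\ walk (walk_end x p) q.
Proof.
elim: p x => [|[l y] p IH] x /=; first by split=> [|[]].
by rewrite IH; split=> [[? []]|[[]]].
Qed.

Lemma walk_end_cat x p q : walk_end x (p ++ q) = walk_end (walk_end x p) q.
Proof. by rewrite /walk_end /unzip2 map_cat last_cat. Qed.

Lemma walk_cost_cat cost x p q :
  walk_cost cost x (p ++ q) =
  (walk_cost cost x p + walk_cost cost (walk_end x p) q)%R.
Proof.
elim: p x => [|[l y] p IH] x /=; first by rewrite GRing.add0r.
by rewrite IH GRing.addrA.
Qed.

Lemma walk_from_to_cat x y z p q :
  walk_from_to x y p -> walk_from_to y z q -> walk_from_to x z (p ++ q).
Proof.
move=> [wp ep] [wq eq]; split; last by rewrite walk_end_cat ep.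
by apply/walk_cat; rewrite ep.
Qed.

Definition translate g p : seq (option Lambda * G) := [seq (a.1, g * a.2) | a <- p].

Lemma edge_translate g l x y : edge l (g * x) (g * y) = edge l x y.
Proof. by rewrite /edge invgM -!mulgA mulKg. Qed.

Lemma walk_end_translate g x p : walk_end (g * x) (translate g p) = g * walk_end x p.
Proof. by elim: p x => //= -[l y] p IH x; apply: IH. Qed.

Lemma walk_translate g x p : walk x p -> walk (g * x) (translate g p).
Proof.
by elim: p x => //= -[l y] p IH x [lxy wp]; rewrite edge_translate; split; last exact: IH.
Qed.

Lemma walk_from_to_translate g x y p :
  walk_from_to x y p -> walk_from_to (g * x) (g * y) (translate g p).
Proof. by move=> [wp ep]; split; [exact: walk_translate | rewrite walk_end_translate ep]. Qed.

Fixpoint walk_rev x p : seq (option Lambda * G) :=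
  if p is (l, y) :: q then rcons (walk_rev y q) (l, x) else [::].

Lemma size_walk_rev x p : size (walk_rev x p) = size p.
Proof. by elim: p x => //= -[l y] p IH x; rewrite size_rcons IH. Qed.

Definition symmetric_set : Prop := [set x^-1 | x in X] = X.
Hypothesis Xsym : symmetric_set.

Lemma symX x : X x -> X x^-1.
Proof. by move=> Xx; rewrite -Xsym; exists x. Qed.

Lemma edge_sym l x y : edge l x y -> edge l y x.
Proof.
case: l => [i|] /= xy.
  have := subgroup_div (subgroup1 (H i)) xy.
  by rewrite div1g invgM invgK.
by have := symX xy; rewrite invgM invgK.
Qed.

Lemma walk_from_to_rev x y p :
  walk_from_to x y p -> walk_from_to y x (walk_rev x p).
Proof.
move=> [wp <-]; elim: p x wp => //= -[l z] p IH x [lxz wp].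
rewrite -cats1; apply: walk_from_to_cat (IH _ wp) _.
by split=> //=; split=> //; apply: edge_sym.
Qed.

Lemma walk_cost0 cost l x : cocycle H cost -> cost (Some l) x x = 0%R.
Proof.
move=> cc; have := cc l x x x; rewrite mulVg => /(_ (subgroup1 _) (subgroup1 _)).
by lia.
Qed.

Lemma rel_word_val_cons (a : rel_letter H X) w :
  rel_word_val (a :: w) = rel_letter_val a * rel_word_val w.
Proof. by rewrite /rel_word_val big_cons. Qed.

Lemma walk_word cost (cc : cocycle H cost) x p : walk x p ->
  exists w : seq (rel_letter H X),
    [/\ (size w <= size p)%N, rel_epi H X (rel_word_val w) = x^-1 * walk_end x p &
        (cost_hom X cc (rel_word_val w)).1 x = walk_cost cost x p].
Proof.
elim: p x => [|[l y] p IH] x /=.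
  move=> _; exists [::]; split=> //=.
  - by rewrite /rel_word_val big_nil multiplicative1 mulVg.
  - by rewrite /rel_word_val big_nil cost_hom1.
move=> [lxy /IH[w [sw ew cw]]].
case: l lxy => [l|] xy.
- have [xy1|xyN1] := eqVneq (x^-1 * y) 1.
    have <- : x = y by apply/eqP; rewrite eq_sym -(inj_eq (@mulgI _ x^-1)) mulVg xy1.
    exists w; have yx : y = x by apply: (@mulgI _ x^-1); rewrite xy1 mulVg.
    split; first exact: leqW.
    - by rewrite ew /walk_end /= yx.
    - by rewrite walk_cost0 // GRing.add0r -yx cw.
  pose h : subgroup_type (H l) := exist _ (x^-1 * y) (mem_set xy).
  have hN1 : h != 1 by apply: contra xyN1 => /eqP/(congr1 val)/= ->.
  exists (inr (existT _ l (exist _ h hN1)) :: w); split=> //=.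
  - rewrite rel_word_val_cons gmulfM ew /= -[freeprod2_inl _ _]/(rel_free_sub X h).
    by rewrite rel_epi_sub /= /walk_end /= -mulgA mulVKg.
  - rewrite rel_word_val_cons cost_homM /= -[freeprod2_inl _ _]/(rel_free_sub X h).
    by rewrite rel_epi_sub cost_hom_sub /= mulVKg cw.
- pose b : set_type X := exist _ (x^-1 * y) (mem_set xy).
  exists (inl b :: w); split=> //=.
  - rewrite rel_word_val_cons gmulfM ew /= -[freeprod2_inr _ _]/(rel_free_basis H b).
    by rewrite rel_epi_basis /= /walk_end /= -mulgA mulVKg.
  - rewrite rel_word_val_cons cost_homM /= -[freeprod2_inr _ _]/(rel_free_basis H b).
    by rewrite rel_epi_basis cost_hom_basis /= mulVKg cw.
Qed.

Lemma cost_hom_prod cost (cc : cocycle H cost) K k (F : 'I_k -> rel_free H X) :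
  (forall i, rel_epi H X (F i) = 1 /\
     forall y, (`|(cost_hom X cc (F i)).1 y| <= K)%N) ->
  rel_epi H X (\prod_(i < k) F i) = 1 /\
  forall y, (`|(cost_hom X cc (\prod_(i < k) F i)%g).1 y| <= k * K)%N.
Proof.
elim: k F => [|k IH] F FP.
  by rewrite big_ord0 multiplicative1; split=> // y; rewrite cost_hom1.
rewrite big_ord_recl; have [e0 c0] := FP ord0.
have [e1 c1] := IH (fun i => F (lift ord0 i)) (fun i => FP _).
split=> [|y]; first by rewrite gmulfM e0 e1 mulg1.
rewrite cost_homM e0 mulg1 mulSn; apply: leq_trans (leq_add (c0 y) (c1 y)).
exact: leqD_abs.
Qed.

Variable R : set (rel_free H X).
Hypothesis presR : relative_presentation R.

Lemma rel_epi_relator r : R r -> rel_epi H X r = 1.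
Proof.
move=> Rr; have [_ E] := presR.
have : [set w | rel_epi H X w = 1] r by rewrite E => N _; apply.
by [].
Qed.

Lemma closed_walk_cost C : (forall w : seq (rel_letter H X), rel_epi H X (rel_word_val w) = 1 ->
      exists (k : nat) (f r : 'I_k -> rel_free H X) (e : 'I_k -> bool),
        [/\ forall i, R (r i),
            rel_word_val w =
              \prod_(i < k) ((f i)^-1 * (if e i then r i else (r i)^-1) * f i) &
            (k <= C * size w)%N]) ->
  forall cost K, cocycle H cost ->
    (forall (cc : cocycle H cost) r y, R r -> (`|(cost_hom X cc r).1 y| <= K)%N) ->
  forall x p, walk_from_to x x p -> (`|walk_cost cost x p| <= C * K * size p)%N.
Proof.
move=> iso cost K cc KR x p [wp ep].
have [w [sw ew <-]] := walk_word cc wp.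
rewrite ep mulVg in ew; have [k [f [r [e [Rr -> kC]]]]] := iso w ew.
have [|_ /(_ x) le] := @cost_hom_prod cost cc K k
    (fun i => (f i)^-1 * (if e i then r i else (r i)^-1) * f i).
  move=> i; have ri1 := rel_epi_relator (Rr i).
  have ri1' : rel_epi H X (if e i then r i else (r i)^-1) = 1.
    by case: (e i) => //; rewrite multiplicativeV ri1 invg1.
  split=> [|y]; first by rewrite !gmulfM multiplicativeV ri1' mulg1 mulVg.
  rewrite cost_hom_conj//; case: (e i); first exact: KR.
  by rewrite cost_homV abszN; apply: KR.
apply: (leq_trans le); rewrite mulnAC leq_mul2r; apply/orP; right.
by apply: leq_trans kC _; rewrite leq_mul2l sw orbT.
Qed.

End Walks.

(** * The relative word metric *)

(** [len_geodesic] supplies discrete geodesics, so that the purely metric sections can forget the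
    generators. *)
Record length_function (G : groupType) (len : G -> nat) : Prop := LengthFunction {
  len_eq1 : forall g, len g = 0%N <-> g = 1;
  lenV : forall g, len g^-1 = len g;
  lenM : forall g h, (len (g * h)%g <= len g + len h)%N;
  len_geodesic : forall g k, (k <= len g)%N ->
    exists2 h, len h = k & len (h^-1 * g) = (len g - k)%N
}.

Definition dist (G : groupType) (len : G -> nat) (x y : G) : nat := len (x^-1 * y).

Section Metric.
Variables (G : groupType) (len : G -> nat) (L : length_function len).
Local Notation D := (dist len).

Lemma dist_eq0 x y : D x y = 0%N -> x = y.
Proof. by move=> /(len_eq1 L); move/(congr1 (fun z => x * z)); rewrite mulVKg mulg1. Qed.

Lemma distxx x : D x x = 0%N.
Proof. by apply/(len_eq1 L); rewrite mulVg. Qed.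

Lemma distC x y : D x y = D y x.
Proof. by rewrite /dist -(lenV L) invgM invgK. Qed.

Lemma dist_tri x y z : (D x z <= D x y + D y z)%N.
Proof. by have := lenM L (x^-1 * y) (y^-1 * z); rewrite mulgA mulgK. Qed.

Lemma dist_mul g x y : D (g * x) (g * y) = D x y.
Proof. by rewrite /dist invgM -!mulgA mulKg. Qed.

Lemma dist1 x : D 1 x = len x.
Proof. by rewrite /dist invg1 mul1g. Qed.

End Metric.

Section WordLength.
Variables (G : groupType) (Lambda : Type) (H : Lambda -> subgroup G) (X : set G).
Hypothesis Xsym : symmetric_set X.
Hypothesis genX : relative_generating H X.
Local Notation walk_from_to := (walk_from_to H X).

Lemma walk_exists g : exists p, walk_from_to 1 g p.
Proof.
pose S := [set g | exists p, walk_from_to 1 g p].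
have SC : group_closed [in S].
  split=> [|x y]; rewrite !inE; first by exists [::].
  move=> [p xp] [q yq]; exists (p ++ translate (x * y^-1) (walk_rev 1 q)).
  apply: walk_from_to_cat xp _.
  have := walk_from_to_translate (x * y^-1) (walk_from_to_rev Xsym yq).
  by rewrite mulgVK mulg1.
have : subgroup_set (gen (X `|` \bigcup_l H l)) g by rewrite genX.
move=> /(_ (Subgroup SC)); apply=> x /= [Xx|[l _ Hx]].
  by exists [:: (None, x)]; split=> //=; rewrite invg1 mul1g.
by exists [:: (Some l, x)]; split=> //=; rewrite invg1 mul1g.
Qed.

Definition walk_size g (n : nat) : bool := `[< exists2 p, walk_from_to 1 g p & size p = n >].

Lemma walk_size_exists g : exists n, walk_size g n.
Proof. by have [p gp] := walk_exists g; exists (size p); apply/asboolP; exists p. Qed.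

Definition rel_len g : nat := ex_minn (walk_size_exists g).

Local Notation D := (dist rel_len).

Lemma dist_walk x y : exists2 p, walk_from_to x y p & size p = D x y.
Proof.
rewrite /dist /rel_len; case: ex_minnP => n /asboolP[p wp <-] _.
exists (translate x p); last by rewrite size_map.
by have := walk_from_to_translate x wp; rewrite mulg1 mulVKg.
Qed.

Lemma walk_dist x y p : walk_from_to x y p -> (D x y <= size p)%N.
Proof.
move=> wp; rewrite /dist /rel_len; case: ex_minnP => n _; apply.
apply/asboolP; exists (translate x^-1 p); last by rewrite size_map.
by have := walk_from_to_translate x^-1 wp; rewrite mulVg.
Qed.

Lemma edge_dist l x y : edge H X l x y -> (D x y <= 1)%N.
Proof. by move=> xy; apply: (@walk_dist x y [:: (l, y)]); split. Qed.

Lemma coset_dist l x y : subgroup_set (H l) (x^-1 * y) -> (D x y <= 1)%N.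
Proof. by move=> xy; apply: (@edge_dist (Some l)). Qed.

Lemma walk_from_to_nil x y : walk_from_to x y [::] -> x = y.
Proof. by case. Qed.

Lemma rel_lenP : length_function rel_len.
Proof.
have lenE g : rel_len g = D 1 g by rewrite /dist invg1 mul1g.
have tri x y z : (D x z <= D x y + D y z)%N.
  have [p wp <-] := dist_walk x y; have [q wq <-] := dist_walk y z.
  by rewrite -size_cat; apply/walk_dist/walk_from_to_cat/wq.
have sym x y : (D x y <= D y x)%N.
  have [p wp <-] := dist_walk y x; rewrite -(size_walk_rev y p).
  exact/walk_dist/walk_from_to_rev.
split=> [g|g|g h|g k kg].
- split=> [|->]; rewrite lenE.
    have [[|a p] wp sp g0] := dist_walk 1 g; last by rewrite g0 in sp.
    by rewrite (walk_from_to_nil wp).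
  by apply/eqP; rewrite -leqn0; apply: (@walk_dist 1 1 [::]).
- have E : D g 1 = rel_len g^-1 by rewrite /dist mulg1.
  by rewrite -E lenE; apply/eqP; rewrite eqn_leq !sym.
- have E : D g (g * h) = rel_len h by rewrite /dist mulKg.
  by rewrite -E (lenE g) (lenE (g * h)).
- rewrite lenE in kg *; have [p wp sp] := dist_walk 1 g.
  have := wp; rewrite -(cat_take_drop k p) => -[/walk_cat[w1 w2]].
  rewrite walk_end_cat => e2.
  set h := walk_end 1 (take k p) in w2 e2; exists h.
    have l1 : (D 1 h <= k)%N.
      rewrite -[X in (_ <= X)%N](@size_takel k _ p) ?sp//.
      exact: walk_dist.
    have l2 : (D h g <= D 1 g - k)%N by rewrite -sp -size_drop; apply: walk_dist.
    by rewrite lenE; have := tri 1 h g; lia.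
  have l1 : (D 1 h <= k)%N.
    rewrite -[X in (_ <= X)%N](@size_takel k _ p) ?sp//.
    exact: walk_dist.
  have l2 : (D h g <= D 1 g - k)%N by rewrite -sp -size_drop; apply: walk_dist.
  by rewrite -/(D h g); have := tri 1 h g; lia.
Qed.

End WordLength.

(** * Area *)

Section Cosets.
Variables (G : groupType) (H : subgroup G).

Lemma coset_sym x y : subgroup_set H (x^-1 * y) -> subgroup_set H (y^-1 * x).
Proof.
by move=> xy; have := subgroup_div (subgroup1 H) xy; rewrite div1g invgM invgK.
Qed.

Lemma coset_trans x y z :
  subgroup_set H (x^-1 * y) -> subgroup_set H (y^-1 * z) -> subgroup_set H (x^-1 * z).
Proof.
move=> xy /coset_sym zy; have := subgroup_div xy zy.
by rewrite invgM invgK mulgA mulgK.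
Qed.

End Cosets.

Section Filling.
Variables (G : groupType) (Lambda : Type) (H : Lambda -> subgroup G) (X : set G).
Hypothesis Xsym : symmetric_set X.
Variable R : set (rel_free H X).
Hypothesis presR : relative_presentation R.
Hypothesis finR : finite_set R.
Hypothesis isoR : linear_isoperimetric R.
Let genX : relative_generating H X := proj1 presR.
Local Notation len := (rel_len Xsym genX).
Local Notation D := (dist len).
Local Notation epi := (rel_epi H X).

Let L : length_function len := rel_lenP Xsym genX.

Definition lipschitz (u : G -> int) : Prop :=
  forall x y, (`|(u x - u y)%R| <= D x y)%N.

Definition coset_repr (l : Lambda) (x : G) : G :=
  xget 1 [set z | subgroup_set (H l) (x^-1 * z)].

Lemma coset_reprP l x : subgroup_set (H l) (x^-1 * coset_repr l x).
Proof.
apply: (@xgetPex _ 1 [set z | subgroup_set (H l) (x^-1 * z)]).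
by exists x; rewrite /= mulVg; apply: subgroup1.
Qed.

Lemma coset_repr_eq l x y :
  subgroup_set (H l) (x^-1 * y) -> coset_repr l x = coset_repr l y.
Proof.
move=> xy; rewrite /coset_repr; congr xget; apply/seteqP.
by split=> z /=; [apply/coset_trans/coset_sym | apply: coset_trans].
Qed.

(** A primitive of the area form [du dv], made constant along the tree spanned
    by a coset so that peripheral relations have no area. *)
Definition area_cost (u v : G -> int) (l : option Lambda) (x y : G) : int :=
  (u (if l is Some i then coset_repr i x else x) * (v y - v x))%R.

Lemma area_cocycle u v : cocycle H (area_cost u v).
Proof.
move=> l x y z xy yz; rewrite /area_cost -(coset_repr_eq xy); lia.
Qed.

(** As [u] is unbounded, the cost of [z] alone has no uniform bound. Subtracting the chord leaves
    the area between the walk and its chord, which involves only differences of [u] and of [v]; on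
    relators the chord term vanishes. The length bound is carried along because gluing two pieces
    adds a triangle of area at most [M * M']. *)
Lemma area_bound (z : rel_free H X) : exists M, forall u v (cc : cocycle H (area_cost u v)) y,
  lipschitz u -> lipschitz v ->
  (`|((cost_hom X cc z).1 y - u y * (v (y * epi z)%g - v y))%R| <= M)%N /\
  (len (epi z) <= M)%N.
Proof.
have D1 y w : D y (y * w) = len w by rewrite /dist mulKg.
elim/rel_free_ind: z => [|l h|x|z z' [M EM] [M' EM']|z [M EM]].
- exists 0%N => u v cc y _ _; rewrite cost_hom1 multiplicative1 mulg1.
  by have /(len_eq1 L) -> := erefl (1 : G); split; lia.
- exists 1%N => u v cc y Lu Lv; rewrite cost_hom_sub rel_epi_sub /= /area_cost.
  have l1 : (len (val h) <= 1)%N.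
    by rewrite -(D1 1) mul1g (coset_dist Xsym genX (l := l))// invg1 mul1g;
      apply: subgroup_valP.
  split=> //; rewrite /= in l1; have /= := Lv (y * val h) y; rewrite (distC L) D1.
  have /= := Lu (coset_repr l y) y; rewrite (distC L).
  have := coset_dist Xsym genX (coset_reprP l y).
  set a := u _; set b := v _; set c := D _ _ => c1 a1 v1.
  have : (`|((a - u y) * (b - v y))%R| <= 1 * 1)%N.
    by rewrite abszM; apply: leq_mul; lia.
  lia.
- exists 1%N => u v cc y Lu Lv; rewrite cost_hom_basis rel_epi_basis /= /area_cost.
  split; first by lia.
  rewrite -(D1 1) mul1g (@edge_dist _ _ _ _ Xsym genX None) //= invg1 mul1g.
  by have := valP x; rewrite inE.
- exists (M + M' + M * M')%N => u v cc y Lu Lv; rewrite cost_homM gmulfM mulgA.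
  have [e1 l1] := EM u v cc y Lu Lv; have [e2 l2] := EM' u v cc (y * epi z) Lu Lv.
  split; last by have := lenM L (epi z) (epi z'); lia.
  have := Lu (y * epi z) y; rewrite (distC L) D1.
  have := Lv (y * epi z * epi z') (y * epi z); rewrite (distC L) D1.
  move: e1 e2; set a1 := (cost_hom _ _ z).1 _; set a2 := (cost_hom _ _ z').1 _.
  set b1 := u _; set b2 := u _; set c1 := v _; set c2 := v _; set c3 := v _.
  move: l1 l2; set m1 := len _; set m2 := len _ => l1 l2 e1 e2 dv du.
  have : (`|((b1 - b2) * (c1 - c3))%R| <= M * M')%N.
    by rewrite abszM; apply: leq_mul; lia.
  lia.
- exists (M + M * M)%N => u v cc y Lu Lv; rewrite cost_homV multiplicativeV.
  have [] := EM u v cc (y * (epi z)^-1) Lu Lv; rewrite mulgVK => e1 l1.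
  split; last by rewrite (lenV L); lia.
  have := Lu y (y * (epi z)^-1); rewrite D1 (lenV L).
  have := Lv y (y * (epi z)^-1); rewrite D1 (lenV L).
  move: e1 l1; set a := (cost_hom _ _ z).1 _.
  set b1 := u _; set b2 := u _; set c1 := v _; set c2 := v _; set m := len _.
  move=> e1 l1 dv du.
  have : (`|((b1 - b2) * (c1 - c2))%R| <= M * M)%N.
    by rewrite abszM; apply: leq_mul; lia.
  lia.
Qed.

Fixpoint walk_area (u v : G -> int) (x : G) (p : seq (option Lambda * G)) : int :=
  if p is (l, y) :: q then (u x * (v y - v x) + walk_area u v y q)%R else 0%R.

Theorem lipschitz_area : exists K, forall u v x p, lipschitz u -> lipschitz v ->
  walk_from_to H X x x p -> (`|walk_area u v x p| <= K * size p)%N.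
Proof.
have [|a m n|K KP] := @finite_set_bound (rel_free H X) nat 0%N addn R
    (fun r M => forall u v (cc : cocycle H (area_cost u v)) y,
        lipschitz u -> lipschitz v -> (`|(cost_hom X cc r).1 y| <= M)%N) finR.
- move=> r Rr; have [M MP] := area_bound r; exists M => u v cc y Lu Lv.
  have [+ _] := MP u v cc y Lu Lv.
  by rewrite (rel_epi_relator presR Rr) mulg1 GRing.subrr GRing.mulr0 GRing.subr0.
- by case=> P u v cc y Lu Lv; apply: leq_trans (P u v cc y Lu Lv) _; lia.
have [C [_ iso]] := isoR.
(* The extra 1 per edge pays for replacing the coset representative by the true starting point in
   [u]: a unit change of [u] times a unit change of [v]. *)
exists (C * K + 1)%N => u v x p Lu Lv wp.
have := closed_walk_cost presR iso (@area_cocycle u v)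
  (fun cc r y Rr => KP r Rr u v cc y Lu Lv) wp.
have diff y q : walk H X y q ->
    (`|(walk_cost (area_cost u v) y q - walk_area u v y q)%R| <= size q)%N.
  elim: q y => [|[l z] q IH] y //= [yz /IH].
  have d1 := edge_dist Xsym genX yz.
  have : (`|(area_cost u v l y z - u y * (v z - v y))%R| <= 1)%N.
    case: l yz => [l|] yz; rewrite /area_cost; last by lia.
    have := Lv z y; rewrite (distC L).
    have := Lu (coset_repr l y) y; rewrite (distC L).
    have := coset_dist Xsym genX (coset_reprP l y).
    set a := u _; set b := D _ (coset_repr _ _) => b1 a1 v1.
    have : (`|((a - u y) * (v z - v y))%R| <= 1 * 1)%N.
      by rewrite abszM; apply: leq_mul; lia.
    lia.
  lia.
by have := diff x p wp.1; lia.
Qed.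

End Filling.

(** * Isolated components *)

Lemma finite_union T (A B : set T) :
  finite_set A -> finite_set B -> finite_set (A `|` B).
Proof. by rewrite finite_setU. Qed.

Section Balls.
Variables (G : groupType) (Lambda : Type) (Om : set (Lambda * G)).

(** [Om] will hold the labelled peripheral letters that occur in the relators. Admitting 1 makes the
    balls increasing; admitting inverses makes [support_norm] Lipschitz in both directions. *)
Definition support_letter (l : Lambda) (s : G) : Prop :=
  s = 1 \/ Om (l, s) \/ Om (l, s^-1).

Fixpoint support_ball (l : Lambda) (n : nat) : set G :=
  if n is m.+1 then
    [set g | exists b s, [/\ support_ball l m b, support_letter l s & g = b * s]]
  else [set 1].

Lemma support_letterV l s : support_letter l s -> support_letter l s^-1.
Proof.
case=> [->|[Os|Os]]; first by left; rewrite invg1.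
  by right; right; rewrite invgK.
by right; left.
Qed.

Lemma support_ballS l n : support_ball l n `<=` support_ball l n.+1.
Proof. by move=> g gn; exists g, 1; split=> //; [left | rewrite mulg1]. Qed.

Lemma support_ball_le l m n : (m <= n)%N -> support_ball l m `<=` support_ball l n.
Proof.
elim: n => [|n IH]; first by rewrite leqn0 => /eqP->.
rewrite leq_eqVlt => /orP[/eqP-> //|]; rewrite ltnS => /IH mn g /mn.
exact: support_ballS.
Qed.

Lemma support_ball_eq1 l n g :
  (forall s, ~ Om (l, s)) -> support_ball l n g -> g = 1.
Proof.
move=> Ol; elim: n g => //= n IH g [b [s [/IH-> [->|[/Ol//|/Ol//]] ->]]].
by rewrite mulg1.
Qed.

Definition support_norm l x0 T y : nat :=
  ex_minn (ex_intro (fun n => `[< support_ball l n (x0^-1 * y) >] || (T <= n)%N) T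
    (introT orP (or_intror (leqnn T)))).

Lemma support_norm_ball l x0 T y : (support_norm l x0 T y < T)%N ->
  support_ball l (support_norm l x0 T y) (x0^-1 * y).
Proof.
rewrite /support_norm; case: ex_minnP => n /orP[/asboolP//|Tn] _ nT; lia.
Qed.

Lemma support_norm_le l x0 T y n : support_ball l n (x0^-1 * y) ->
  (support_norm l x0 T y <= n)%N.
Proof.
move=> bn; rewrite /support_norm; case: ex_minnP => m _; apply.
by apply/orP; left; apply/asboolP.
Qed.

Lemma support_norm_max l x0 T y : (support_norm l x0 T y <= T)%N.
Proof. by rewrite /support_norm; case: ex_minnP => m _; apply; rewrite leqnn orbT. Qed.

Lemma support_norm0 l x0 T : support_norm l x0 T x0 = 0%N.
Proof.
by apply/eqP; rewrite -leqn0; apply: support_norm_le; rewrite mulVg.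
Qed.

Lemma support_norm_lip l x0 T y s : Om (l, s) ->
  (`|(Posz (support_norm l x0 T (y * s)%g) - Posz (support_norm l x0 T y))%R| <= 1)%N.
Proof.
have half z t : support_letter l t ->
    (support_norm l x0 T (z * t)%g <= (support_norm l x0 T z).+1)%N.
  move=> lt; have [/support_norm_ball b|le] := ltnP (support_norm l x0 T z) T.
    apply: support_norm_le => /=; exists (x0^-1 * z), t; split=> //.
    by rewrite mulgA.
  by apply: leq_trans (leqW le); apply: support_norm_max.
move=> Os; have s1 : support_letter l s by right; left.
have := half y s s1; have := half (y * s) s^-1 (support_letterV s1).
by rewrite mulgK; lia.
Qed.

(** Finiteness is uniform over all labels, even infinitely many, because the letters of all the
    balls come from one finite set [S]. *)
Lemma finite_support_balls n : finite_set Om ->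
  finite_set (\bigcup_l support_ball l n).
Proof.
move=> fO; pose S := [set 1] `|` (@snd _ _ @` Om) `|` ((fun a => a.2^-1) @` Om).
have fS : finite_set S.
  by rewrite !finite_setU; split; [split|]; [exact: finite_set1 | exact: finite_image..].
elim: n => [|n IH].
  by apply: sub_finite_set (finite_set1 (1 : G)) => g [l _].
apply: sub_finite_set (finite_image2 (fun a b : G => a * b) IH fS).
move=> g [l _ [b [s [bn ls ->]]]]; exists b; first by exists l.
exists s => //; case: ls => [->|[Os|Os]]; first by left; left.
  by left; right; exists (l, s).
by right; exists (l, s^-1) => //=; rewrite invgK.
Qed.

Lemma finite_support_ball l n : finite_set Om -> finite_set (support_ball l n).
Proof.
by move=> /(finite_support_balls n); apply: sub_finite_set => g ?; exists l.
Qed.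

End Balls.

Section Isolated.
Variables (G : groupType) (Lambda : Type) (H : Lambda -> subgroup G) (X : set G).
Hypothesis Xsym : symmetric_set X.
Variable R : set (rel_free H X).
Hypothesis presR : relative_presentation R.
Hypothesis finR : finite_set R.
Hypothesis isoR : linear_isoperimetric R.
Local Notation epi := (rel_epi H X).
Local Notation walk_from_to := (walk_from_to H X).

Definition coset_cost (l0 : Lambda) (x0 : G) (phi : G -> int)
    (l : option Lambda) (x y : G) : int :=
  if `[< l = Some l0 /\ subgroup_set (H l0) (x0^-1 * x) >] then (phi y - phi x)%R
  else 0%R.

Lemma coset_cost_cocycle l0 x0 phi : cocycle H (coset_cost l0 x0 phi).
Proof.
move=> l x y z xy yz; rewrite /coset_cost.
case: asboolP => [[[?] x0x]|Nx]; last first.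
  case: asboolP => [[[?] x0y]|]; last by rewrite GRing.addr0.
  subst l; case: Nx; split=> //; exact/(coset_trans x0y)/coset_sym.
subst l; case: asboolP => [_|[]]; first by lia.
by split=> //; apply: coset_trans x0x _.
Qed.

(** The induction collects the peripheral letters of [z] in [Om] and counts them in [M]. Both are
    found before [l0], [x0] and [phi], and [phi] has to be Lipschitz only along [Om]; hence a bound
    that is meaningful inside an infinite subgroup and the same for all cosets. *)
Lemma relator_support_bound (z : rel_free H X) :
  exists (Om : set (Lambda * G)) (M : nat), finite_set Om /\
  forall l0 x0 phi (cc : cocycle H (coset_cost l0 x0 phi)) y,
    (forall y s, Om (l0, s) -> (`|(phi (y * s)%g - phi y)%R| <= 1)%N) ->
    (`|(cost_hom X cc z).1 y| <= M)%N.
Proof.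
elim/rel_free_ind: z => [|l h|x|z z' [O [M [fO EM]]] [O' [M' [fO' EM']]]|z [O [M [fO EM]]]].
- by exists set0, 0%N; split=> // l0 x0 phi cc y _; rewrite cost_hom1.
- exists [set (l, val h)], 1%N; split=> // l0 x0 phi cc y Lphi.
  rewrite cost_hom_sub /= /coset_cost; case: asboolP => // -[[?] _]; subst l.
  exact: Lphi.
- exists set0, 0%N; split=> // l0 x0 phi cc y _; rewrite cost_hom_basis /= /coset_cost.
  by case: asboolP => // -[].
- exists (O `|` O'), (M + M')%N; split; first by rewrite finite_setU.
  move=> l0 x0 phi cc y Lphi; rewrite cost_homM.
  apply: leq_trans (leqD_abs _ _) (leq_add _ _).
    by apply: EM => w s Os; apply: Lphi; left.
  by apply: EM' => w s Os; apply: Lphi; right.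
- exists O, M; split=> // l0 x0 phi cc y Lphi; rewrite cost_homV abszN.
  exact: EM.
Qed.

Lemma relators_support_bound :
  exists (Om : set (Lambda * G)) (M : nat), finite_set Om /\
  forall l0 x0 phi (cc : cocycle H (coset_cost l0 x0 phi)) r y, R r ->
    (forall y s, Om (l0, s) -> (`|(phi (y * s)%g - phi y)%R| <= 1)%N) ->
    (`|(cost_hom X cc r).1 y| <= M)%N.
Proof.
pose N := {O : set (Lambda * G) | finite_set O}.
pose joinN (a b : N * nat) : N * nat :=
  (exist (fun O => finite_set O) (sval a.1 `|` sval b.1)
     (finite_union (svalP a.1) (svalP b.1)), (a.2 + b.2)%N).
have [|a m n|[[O fO] M] KP] := @finite_set_bound (rel_free H X) (N * nat)%type
    (exist (fun O => finite_set O) set0 (finite_set0 _), 0%N) joinN R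
    (fun r b => forall l0 x0 phi (cc : cocycle H (coset_cost l0 x0 phi)) y,
      (forall y s, sval b.1 (l0, s) -> (`|(phi (y * s)%g - phi y)%R| <= 1)%N) ->
      (`|(cost_hom X cc r).1 y| <= b.2)%N) finR.
- move=> r _; have [O [M [fO OM]]] := relator_support_bound r.
  by exists (exist (fun O => finite_set O) O fO, M).
- by case=> P l0 x0 phi cc y Lphi /=; apply: leq_trans (P l0 x0 phi cc y _) _;
    [move=> w s Os; apply: Lphi; (left + right) | lia | move=> w s Os; apply: Lphi;
      right | lia].
- exists O, M; split=> // l0 x0 phi cc r y Rr; exact: KP.
Qed.

(** Only edges labelled [l0] are forbidden; the walk may still visit vertices of the coset. *)
Fixpoint avoids (l0 : Lambda) (x0 x : G) (p : seq (option Lambda * G)) : Prop :=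
  if p is (l, y) :: q then
    ~ (l = Some l0 /\ subgroup_set (H l0) (x0^-1 * x)) /\ avoids l0 x0 y q
  else True.

Lemma avoids_cost l0 x0 phi x p :
  avoids l0 x0 x p -> walk_cost (coset_cost l0 x0 phi) x p = 0%R.
Proof.
elim: p x => //= -[l y] p IH x [Nx /IH->].
by rewrite /coset_cost asboolF.
Qed.

Lemma avoids_cat l0 x0 x p q :
  avoids l0 x0 x (p ++ q) <-> avoids l0 x0 x p /\ avoids l0 x0 (walk_end x p) q.
Proof.
elim: p x => [|[l y] p IH] x /=; first by split=> [|[]].
by rewrite IH; split=> [[? []]|[[]]].
Qed.

Lemma avoids_rev l0 x0 x y p : walk_from_to x y p -> avoids l0 x0 x p ->
  avoids l0 x0 y (walk_rev x p).
Proof.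
move=> [wp <-]; elim: p x wp => //= -[l z] p IH x [lxz wp] [Nx ap].
rewrite -cats1; apply/avoids_cat; split; first exact: IH.
have [_ ->] := walk_from_to_rev Xsym (conj wp erefl : walk_from_to z _ p).
split=> // -[ll0 x0z]; apply: Nx; split=> //; subst l.
exact/(coset_trans x0z)/coset_sym.
Qed.

(** Osin's lemma on isolated components: the cost is the distance travelled in
    the coset, truncated so that it stays finite. *)
Theorem isolated_component : exists (Om : set (Lambda * G)) (K : nat),
  finite_set Om /\
  forall l x y z z' p1 p2 q,
    walk_from_to x z p1 -> subgroup_set (H l) (z^-1 * z') -> walk_from_to z' y p2 ->
    walk_from_to x y q ->
    avoids l z x p1 -> avoids l z z' p2 -> avoids l z x q ->
    support_ball Om l (K * (size p1 + size p2 + size q + 1))%N (z^-1 * z').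
Proof.
have [O [M [fO OM]]] := relators_support_bound; have [C [_ iso]] := isoR.
exists O, (C * M)%N; split=> // l x y z z' p1 p2 q w1 zz' w2 wq a1 a2 aq.
(* The 1 in the length of the loop is the component itself. Truncating at [n.+1], one above the
   bound to be proved, turns a norm at most [n] into genuine membership in a ball. *)
set n := (_ * (_ + 1))%N; pose phi w := Posz (support_norm O l z n.+1 w).
have wr := walk_from_to_rev Xsym wq.
have wp : walk_from_to x x (p1 ++ (Some l, z') :: p2 ++ walk_rev x q).
  apply: walk_from_to_cat w1 (walk_from_to_cat (y := z') (p := [:: _]) _ _).
    by split=> //; split.
  exact: walk_from_to_cat w2 wr.
have := closed_walk_cost presR iso (@coset_cost_cocycle l z phi)
  (fun cc r w Rr => OM l z phi cc r w Rr (fun v s => @support_norm_lip _ _ O l z n.+1 v s)) wp.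
rewrite !walk_cost_cat /= !walk_cost_cat w1.2 w2.2 (avoids_cost _ a1).
rewrite (avoids_cost _ a2) (avoids_cost _ (avoids_rev wq aq)) /coset_cost asboolT; last first.
  by split=> //; rewrite mulVg; apply: subgroup1.
rewrite /phi support_norm0 !size_cat /= size_cat size_walk_rev.
rewrite (_ : (size p1 + (size p2 + size q).+1)%N = (size p1 + size p2 + size q + 1)%N);
  last by lia.
rewrite -/n => le.
have le' : (support_norm O l z n.+1 z' <= n)%N by lia.
by apply: (support_ball_le le'); apply: support_norm_ball; rewrite ltnS.
Qed.

End Isolated.

(** * Hyperbolicity *)

Section Hyperbolicity.
Variables (G : groupType) (len : G -> nat) (L : length_function len).
Local Notation D := (dist len).
Implicit Types (a b c p q w x y z : G) (s : seq G).

Lemma dist_geodesic x y k : (k <= D x y)%N ->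
  exists2 z, D x z = k & D z y = (D x y - k)%N.
Proof.
move=> /(len_geodesic L)[h hk hy]; exists (x * h); first by rewrite /dist mulKg.
by rewrite -hy /dist invgM mulgA.
Qed.

(** Gromov's four-point condition, in terms of distances so that no Gromov product has to be
    halved. *)
Definition hyperbolic (delta : nat) : Prop := forall w x y z,
  (D w x + D y z <= D w y + D x z + delta)%N \/
  (D w x + D y z <= D w z + D x y + delta)%N.

Definition adjacent x y : bool := (D x y <= 1)%N.

Fixpoint path_area (u v : G -> int) x s : int :=
  if s is y :: s' then (u x * (v y - v x) + path_area u v y s')%R else 0%R.

Lemma path_area_cat u v x s1 s2 :
  path_area u v x (s1 ++ s2) = (path_area u v x s1 + path_area u v (last x s1) s2)%R.
Proof. by elim: s1 x => [|y s1 IH] x /=; [lia | rewrite IH; lia]. Qed.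

Definition area_isoperimetric (K : nat) : Prop := forall (u v : G -> int) x s,
  (forall y z, (`|(u y - u z)%R| <= D y z)%N) ->
  (forall y z, (`|(v y - v z)%R| <= D y z)%N) ->
  path adjacent x s -> last x s = x -> (`|path_area u v x s| <= K * size s)%N.

Variable K : nat.
Hypothesis area : area_isoperimetric K.

Definition between a x b : Prop := (D a x + D x b = D a b)%N.

Definition reach_outside p R n x y : Prop :=
  exists s, [/\ path adjacent x s, last x s = y, (size s <= n)%N &
                all (fun z => R <= D p z)%N (x :: s)].

Lemma reach_outside_cat p R m n x y z :
  reach_outside p R m x y -> reach_outside p R n y z -> reach_outside p R (m + n) x z.
Proof.
move=> [s [s1 s2 s3 s4]] [t [t1 t2 t3 t4]]; exists (s ++ t).
rewrite cat_path last_cat size_cat s2; split=> //; first by rewrite s1.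
  by apply: leq_add.
by move: t4; rewrite -cat_cons all_cat s4 /= => /andP[_ ->].
Qed.

Lemma reach_outside_between p R x y :
  (forall z, between x z y -> R <= D p z)%N -> reach_outside p R (D x y) x y.
Proof.
move: {2}(D x y) (erefl (D x y)) => n; elim: n x => [|n IH] x xy far.
  have E := dist_eq0 L xy; subst x; exists [::]; split=> //=; rewrite andbT.
  by apply: far; rewrite /between !(distxx L).
have [|z xz zy] := @dist_geodesic x y 1; first by rewrite xy.
have [||s [s1 s2 s3 s4]] := IH z; first by rewrite zy xy subn1.
  by move=> w zwy; apply: far; move: zwy; rewrite /between;
    have := dist_tri L x z w; have := dist_tri L x w y; lia.
exists (z :: s); split=> //=; first by rewrite s1 andbT /adjacent xz.
  by rewrite xy; lia.
apply/andP; split=> //; apply: far; rewrite /between (distxx L); lia.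
Qed.

Lemma reach_outside_rev p R n x y :
  reach_outside p R n x y -> reach_outside p R n y x.
Proof.
move=> [s [s1 s2 s3 s4]]; exists (rev (belast x s)).
have sym : symmetric adjacent by move=> w z; rewrite /adjacent (distC L).
split.
- rewrite -s2 rev_path; apply: sub_path s1 => w z; by rewrite sym.
- case: s {s1 s3 s4} s2 => [|w s] /= s2; first by [].
  by rewrite rev_cons last_rcons.
- by rewrite size_rev size_belast.
- by rewrite -s2 -rev_rcons -lastI all_rev.
Qed.

Section Dip.
Variables (p a b : G) (R : nat).
(** The subtraction is truncated: [u] vanishes off the [R]-ball at [p], so a path staying outside
    that ball carries no area. *)
Let u x : int := Posz (R - D p x).
Let v x : int := Posz (D a x).

Fact dip_lip y z : (`|(u y - u z)%R| <= D y z)%N.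
Proof.
rewrite /u; have := dist_tri L p y z; have := dist_tri L p z y.
by rewrite (distC L z y); lia.
Qed.

Fact dip_lip' y z : (`|(v y - v z)%R| <= D y z)%N.
Proof.
rewrite /v; have := dist_tri L a y z; have := dist_tri L a z y.
by rewrite (distC L z y); lia.
Qed.

Lemma dip_outside x s : all (fun z => R <= D p z)%N (x :: s) -> path_area u v x s = 0%R.
Proof.
elim: s x => //= y s IH x /andP[xR sR]; rewrite IH // /u.
by have -> : (R - D p x = 0)%N; lia.
Qed.

Lemma dip_segment x y : between a x y ->
  exists s, [/\ path adjacent x s, last x s = y, size s = D x y &
                (0 <= path_area u v x s)%R].
Proof.
move: {2}(D x y) (erefl (D x y)) => n; elim: n x => [|n IH] x xy axy.
  by exists [::]; rewrite xy (dist_eq0 L xy).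
have [|z xz zy] := @dist_geodesic x y 1; first by rewrite xy.
have [||s [s1 s2 s3 s4]] := IH z; first by rewrite zy xy subn1.
  by move: axy; rewrite /between; have := dist_tri L a x z; have := dist_tri L a z y; lia.
exists (z :: s); split=> //=; [by rewrite s1 andbT /adjacent xz | by rewrite s3; lia |].
have vz : v z = (v x + 1)%R.
  rewrite /v; move: axy; rewrite /between.
  by have := dist_tri L a x z; have := dist_tri L a z y; lia.
have -> : (v z - v x = 1)%R by lia.
by rewrite GRing.mulr1; move: (path_area _ _ _ _) s4 => e; rewrite /u; lia.
Qed.

(** The area under the dip along a geodesic of length [k] ending at [p]. It reaches its full value,
    half of [R * (R - 1)], once [k >= R], since the remaining terms are truncated to 0. *)
Fixpoint dip_sum (k : nat) : nat := if k is j.+1 then ((R - k) + dip_sum j)%N else 0%N.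

Lemma dip_sum_lower k : (R <= k)%N -> (R * (R - 1) <= 2 * dip_sum k)%N.
Proof.
have H j : (j <= R)%N -> (2 * dip_sum j + j * j + j = 2 * j * R)%N.
  by elim: j => [|j IH] //= jR; have := IH (ltnW jR); nia.
move=> Rk; rewrite -(subnK Rk); elim: (k - R)%N => [|j IH]; last by rewrite /=; lia.
by rewrite add0n; have := H R (leqnn R); nia.
Qed.

Lemma dip_descent x : between a x p ->
  exists s, [/\ path adjacent x s, last x s = p, size s = D x p &
                path_area u v x s = Posz (dip_sum (D x p))].
Proof.
move: {2}(D x p) (erefl (D x p)) => n; elim: n x => [|n IH] x xy axy.
  by exists [::]; rewrite xy (dist_eq0 L xy).
have [|z xz zy] := @dist_geodesic x p 1; first by rewrite xy.
have zn : D z p = n by lia.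
have [||s [s1 s2 s3 s4]] := IH z; first by rewrite zy xy subn1.
  by move: axy; rewrite /between; have := dist_tri L a x z; have := dist_tri L a z p; lia.
exists (z :: s); split=> //=; [by rewrite s1 andbT /adjacent xz | by rewrite s3; lia |].
have vz : v z = (v x + 1)%R.
  rewrite /v; move: axy; rewrite /between.
  by have := dist_tri L a x z; have := dist_tri L a z p; lia.
have -> : (v z - v x = 1)%R by lia.
by rewrite s4 GRing.mulr1 zn xy /= /u (distC L p x) xy; lia.
Qed.

(** Comparing the dip [R - D p] with the distance from [a], the area enclosed
    by a geodesic through [p] and a path avoiding the [R]-ball at [p] is
    quadratic in [R]. *)
Lemma quadratic_dip n : between a p b -> reach_outside p R n b a ->
  (R * (R - 1) <= 2 * K * (D a b + n))%N.
Proof.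
move=> apb [s [s1 s2 s3 s4]].
have [|s' [d1 d2 d3 d4]] := @dip_descent a; first by rewrite /between (distxx L).
have [t [t1 t2 t3 t4]] := dip_segment apb.
have Ra : (R <= D a p)%N.
  have /allP := s4; rewrite (distC L) -s2; apply; exact: mem_last.
have := @area u v a (s' ++ t ++ s) dip_lip dip_lip'.
rewrite !cat_path !last_cat d1 d2 t1 t2 s1 s2 => /(_ isT erefl).
rewrite !path_area_cat d2 t2 d4 (dip_outside s4) !size_cat d3 t3.
have := dip_sum_lower Ra; move: apb; rewrite /between.
move: (path_area u v p t) t4 => e e0; move: (dip_sum _) => g.
move=> <- h1 h2.
have : (g <= K * (D a p + (D p b + size s)))%N by lia.
move=> h3; have : (K * (D a p + (D p b + size s)) <= K * (D a p + D p b + n))%N.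
  by rewrite leq_mul2l; lia.
by lia.
Qed.

End Dip.

Lemma betweenC a x b : between a x b -> between b x a.
Proof. by rewrite /between (distC L b x) (distC L x a) (distC L b a); lia. Qed.

Definition on_sides a b c q : Prop := between a q c \/ between c q b.

Lemma on_sides_to_apex a b c q z :
  on_sides a b c q -> between q z c -> on_sides a b c z.
Proof.
rewrite /on_sides /between => -[aqc|cqb] qzc; [left|right].
  by have := dist_tri L a q z; have := dist_tri L a z c; lia.
have := dist_tri L z q b; have := dist_tri L c z b.
by rewrite (distC L z q) (distC L c z); rewrite (distC L c q) in cqb; lia.
Qed.

(** A side is the union of all geodesics between its ends. The perimeter bound [n] makes a largest
    [R] exist and passes to the smaller triangles of the argument; the final bound on [R] does not
    involve [n]. *)
Definition fat n R : Prop := exists a b c p,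
  [/\ (D a b + D b c + D a c <= n)%N, between a p b &
      forall q, on_sides a b c q -> (R <= D p q)%N].

Section MaximallyFat.
Variables (n R : nat).
Hypothesis R_gt0 : (0 < R)%N.
Hypothesis maxR : ~ fat n R.+1.

Lemma near_side a b c p : (D a b + D b c + D a c <= n)%N -> between a p b ->
  exists2 q, on_sides a b c q & (D p q <= R)%N.
Proof.
move=> per apb; apply: contrapT => far; apply: maxR; exists a, b, c, p; split=> //.
move=> q sq; rewrite ltnNge; apply/negP => pq; apply: far; by exists q.
Qed.

Variables (a b c p : G).
Hypothesis perim : (D a b + D b c + D a c <= n)%N.
Hypothesis far : forall q, on_sides a b c q -> (R <= D p q)%N.

(** The points may lie on different sides, whose evident connection is the possibly distant apex
    [c]. Maximality of [R], applied to the smaller triangle [q1 c q2], gives a crossing of length at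
    most [R] between its two long sides, [12 * R] away from [q1]. The detour has length at most 12R
    + R + (R + 12R + 8R) = 34R. *)
Lemma reach_along_sides q1 q2 : on_sides a b c q1 -> on_sides a b c q2 ->
  (D q1 q2 <= 8 * R)%N -> (D p q1 <= 4 * R)%N ->
  reach_outside p R (34 * R) q1 q2.
Proof.
move=> s1 s2 q12 pq1.
have weak m m' x y : (m <= m')%N -> reach_outside p R m x y -> reach_outside p R m' x y.
  by move=> mm' [s [? ? ? ?]]; exists s; split=> //; apply: leq_trans mm'.
have toc q z : on_sides a b c q -> between q z c -> (R <= D p z)%N.
  by move=> sq qzc; apply: far; apply: on_sides_to_apex qzc.
have fromc q z : on_sides a b c q -> between c z q -> (R <= D p z)%N.
  by move=> sq /betweenC; apply: toc.
have [le|gt] := leqP (D q1 c) (12 * R).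
  have r1 : reach_outside p R (D q1 c) q1 c by apply: reach_outside_between => z; apply: toc.
  have r2 : reach_outside p R (D c q2) c q2 by apply: reach_outside_between => z; apply: fromc.
  apply: weak (reach_outside_cat r1 r2).
  by have := dist_tri L c q1 q2; rewrite (distC L c q1); lia.
have [x q1x xc] := dist_geodesic (ltnW gt).
have q1xc : between q1 x c by rewrite /between; lia.
have [y sy xy] : exists2 y, on_sides q1 c q2 y & (D x y <= R)%N.
  apply: near_side q1xc; apply: leq_trans perim.
  have tri := dist_tri L; have := (tri q1 a q2, tri q1 b q2, tri q1 a b, tri q1 b a).
  have := (tri a b q2, tri b a q2, tri a b c, tri b a c).
  have sC := distC L; have := (sC q1 a, sC q2 c, sC b c, sC c a, sC a b).
  have := (sC q1 b, sC q2 b, sC q1 c); move: s1 s2; rewrite /on_sides /between.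
  by move=> [] h1 [] h2 [[e1 e2] e3] [[[[e4 e5] e6] e7] e8] [[[t1 t2] t3] t4] [[[t5 t6] t7] t8]; lia.
(* [y] cannot lie on the short side: it is at least [11 * R] away from [q1], while [q1] and [q2] are
   at most [8 * R] apart. *)
have q2yc : between q2 y c.
  case: sy => //; rewrite /between => h; exfalso.
  by have := dist_tri L q1 y x; rewrite (distC L y x); lia.
have r1 : reach_outside p R (D q1 x) q1 x.
  apply: reach_outside_between => z q1zx; apply: (toc q1) => //.
  move: q1zx q1xc; rewrite /between.
  by have := dist_tri L z x c; have := dist_tri L q1 z c; lia.
have r2 : reach_outside p R (D x y) x y.
  apply: reach_outside_between => z; rewrite /between.
  have := dist_tri L q1 p x; have := dist_tri L p z x.
  by rewrite (distC L q1 p) (distC L z x); lia.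
have r3 : reach_outside p R (D y q2) y q2.
  apply: reach_outside_between => z yzq2; apply: (toc q2) => //.
  move: yzq2 q2yc; rewrite /between.
  have := dist_tri L z y c; have := dist_tri L q2 z c.
  by rewrite (distC L q2 z) (distC L z y) (distC L q2 y); lia.
apply: weak (reach_outside_cat (reach_outside_cat r1 r2) r3).
by have := dist_tri L y x q2; have := dist_tri L x q1 q2;
  rewrite (distC L y x) (distC L x q1); lia.
Qed.

(** From [p] the side is followed for [3 * R] both ways, or up to a vertex, and then left by a jump
    of length at most [R] to the other sides, whose landing points are joined within [34 * R]. The
    loop has length at most 6R + 36R = 42R, so [quadratic_dip] bounds [R * (R - 1)] by 84KR. *)
Lemma maximally_fat_bound : between a p b -> (R <= 84 * K + 1)%N.
Proof.
move=> apb.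
have side_a : on_sides a b c a by left; rewrite /between (distxx L).
have side_b : on_sides a b c b by right; rewrite /between (distxx L) addn0.
have leave e : e = a \/ e = b -> exists x q,
    [/\ between p x e, (D p x <= 3 * R)%N, on_sides a b c q,
        (D p q <= 4 * R)%N & reach_outside p R R x q].
  move=> eab; have pe_between x : between p x e -> between a x b.
    rewrite /between; case: eab => -> pxe.
      have := dist_tri L a x b; have := dist_tri L x p b; move: apb.
      by rewrite /between (distC L a p) (distC L a x) (distC L x p); lia.
    have := dist_tri L a x b; have := dist_tri L a p x; move: apb.
    by rewrite /between; lia.
  have side_e : on_sides a b c e by case: eab => ->.
  have [le|gt] := leqP (D p e) (3 * R).
    exists e, e; split=> //; [by rewrite /between (distxx L) addn0 | lia |].
    exists [::]; split=> //=; rewrite andbT; exact: far.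
  have [x px xe] := dist_geodesic (ltnW gt).
  have pxe : between p x e by rewrite /between; lia.
  have [q sq xq] := near_side perim (pe_between _ pxe).
  exists x, q; split=> //; [lia | by have := dist_tri L p x q; lia |].
  have [s [s1 s2 s3 s4]] : reach_outside p R (D x q) x q.
    apply: reach_outside_between => z; rewrite /between.
    by have := dist_tri L p z x; rewrite (distC L z x); lia.
  by exists s; split=> //; lia.
have [x [qx [pxa px sx pqx rx]]] := leave a (or_introl erefl).
have [y [qy [pyb py sy pqy ry]]] := leave b (or_intror erefl).
have rq : reach_outside p R (34 * R) qy qx.
  apply: reach_along_sides => //.
  by have := dist_tri L qy p qx; rewrite (distC L qy p); lia.
have loop := reach_outside_cat (reach_outside_cat ry rq) (reach_outside_rev rx).
have xpy : between x p y.
  move: apb pxa pyb; rewrite /between.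
  have := dist_tri L a x y; have := dist_tri L a y b; have := dist_tri L x p y.
  by rewrite (distC L a x) (distC L x p) (distC L a p); lia.
have := quadratic_dip xpy loop; rewrite /between in xpy.
rewrite -xpy (distC L x p) => le.
have : (R * (R - 1) <= R * (84 * K))%N.
  apply: leq_trans le _;
    have : (2 * K * (D p x + D p y + (R + 34 * R + R)) <= 2 * K * (42 * R))%N.
    by rewrite leq_mul2l; lia.
  lia.
by rewrite leq_mul2l; lia.
Qed.

End MaximallyFat.

Lemma fat_bound n R : fat n R -> (R <= 84 * K + 1)%N.
Proof.
move=> fR; have bound m : `[< fat n m >] -> (m <= n)%N.
  move=> /asboolP[a [b [c [p [per apb far]]]]].
  have := far a; rewrite /on_sides /between (distxx L) => /(_ (or_introl erefl)).
  by move: apb; rewrite /between (distC L p a); lia.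
have ex : exists m, `[< fat n m >] by exists R; apply/asboolP.
have [M /asboolP fM maxM] := ex_maxnP ex bound.
apply: leq_trans (maxM R _) _; first exact/asboolP.
have [->|M0] := posnP M; first by [].
have [a [b [c [p [per apb far]]]]] := fM.
apply: (maximally_fat_bound M0 _ per far apb).
by move=> /asboolP/maxM; rewrite ltnn.
Qed.

Lemma thin_triangles a b c p : between a p b ->
  exists2 q, on_sides a b c q & (D p q <= 84 * K + 1)%N.
Proof.
move=> apb; apply: contrapT => Nq.
have : (84 * K + 2 <= 84 * K + 1)%N; last by lia.
apply: (@fat_bound (D a b + D b c + D a c)); exists a, b, c, p; split=> // q sq.
by rewrite leqNgt; apply/negP => lt; apply: Nq; exists q => //; lia.
Qed.

Let d0 := (84 * K + 1)%N.

(** A discrete intermediate value argument: the points of a geodesic from [x] to [y] start near the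
    side from [w] to [x] and end near the side from [w] to [y]. At the changeover a point is within
    [d0] of the first side and [d0 + 1] of the second, whence [4 * d0 + 2]. *)
Lemma near_apex w x y : exists2 p, between x p y &
  (2 * D w p + D x y <= D w x + D w y + 4 * d0 + 2)%N.
Proof.
pose near z p := exists2 q, between w q z & (D p q <= d0)%N.
suff H n p : D p y = n -> between x p y -> near x p -> exists2 p, between x p y &
    (2 * D w p + D x y <= D w x + D w y + 4 * d0 + 2)%N.
  apply: (H (D x y) x) => //; first by rewrite /between (distxx L).
  by exists x; rewrite /between !(distxx L) ?addn0.
have conclude q : between x q y -> near x q ->
    (exists2 r, between w r y & (D q r <= d0 + 1)%N) ->
    exists2 p, between x p y & (2 * D w p + D x y <= D w x + D w y + 4 * d0 + 2)%N.
  move=> xqy [r wrx qr] [t wty qt]; exists q => //; move: xqy wrx wty; rewrite /between.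
  have tri := dist_tri L; have := (tri w r q, tri w t q, tri x r q, tri q t y).
  have sC := distC L; have := (sC r q, sC t q, sC x r).
  by move=> [[e1 e2] e3] [[[t1 t2] t3] t4]; lia.
elim: n p => [|n IH] p py xpy nxp.
  have E := dist_eq0 L py; subst p; apply: conclude xpy nxp _.
  by exists y; rewrite /between !(distxx L) ?addn0.
have [|p' pp' p'y] := @dist_geodesic p y 1; first by rewrite py.
have xp'y : between x p' y.
  move: xpy; rewrite /between; have tri := dist_tri L.
  by have := (tri x p p', tri x p' y) => -[t1 t2]; lia.
have [r [xrw|wry] p'r] := @thin_triangles x y w p' xp'y.
  apply: (IH p') => //; first by rewrite p'y py subn1.
  by exists r => //; apply: betweenC.
apply: conclude xpy nxp _; exists r => //.
by have := dist_tri L p p' r; lia.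
Qed.

(** The point [p] that [near_apex] gives between [y] and [z] is within [d0] of a point [q] on
    another side of the triangle [x], [y], [z]. Replacing [p] by [q] adds [2 * d0] to
    [4 * d0 + 2]. *)
Theorem area_hyperbolic : hyperbolic (6 * d0 + 2).
Proof.
move=> w x y z.
have [p yz pw] := near_apex w y z.
have tri := dist_tri L; have sC := distC L.
have low q a b : between a q b -> (D w a + D w b <= 2 * D w q + D a b)%N.
  by rewrite /between; have := (tri w q a, tri w q b, sC a q) => -[[t1 t2] t3]; lia.
have [q [yqx|xqz] pq] := @thin_triangles y z x p yz.
  right; have := low q y x yqx; have := (tri w p q, sC x y) => -[t1 t2].
  rewrite /d0 in pw *; lia.
left; have := low q x z xqz; have := tri w p q.
rewrite /d0 in pw *; lia.
Qed.

End Hyperbolicity.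

(** * Acylindricity *)

(** Left invariance allows one of the two displaced points to be 1. *)
Definition acylindrical (G : groupType) (len : G -> nat) : Prop :=
  forall eps, exists R N, forall y, (R <= len y)%N ->
    exists s : seq G, (size s <= N)%N /\
      forall h, (len h <= eps)%N -> (dist len y (h * y)%g <= eps)%N -> h \in s.

Section Acylindricity.
Variables (G : groupType) (Lambda : Type) (H : Lambda -> subgroup G) (X : set G).
Hypothesis Xsym : symmetric_set X.
Hypothesis finX : finite_set X.
Hypothesis genX : relative_generating H X.
Local Notation walk_from_to := (walk_from_to H X).
Local Notation len := (rel_len Xsym genX).
Local Notation D := (dist len).
Local Notation avoids := (avoids H).
Let L : length_function len := rel_lenP Xsym genX.
Implicit Types (x y z g h : G) (p q : seq (option Lambda * G)).

Variables (Om : set (Lambda * G)) (K : nat).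
Hypothesis finOm : finite_set Om.
Hypothesis isolated : forall l x y z z' p1 p2 q,
    walk_from_to x z p1 -> subgroup_set (H l) (z^-1 * z') -> walk_from_to z' y p2 ->
    walk_from_to x y q ->
    avoids l z x p1 -> avoids l z z' p2 -> avoids l z x q ->
    support_ball Om l (K * (size p1 + size p2 + size q + 1))%N (z^-1 * z').

Lemma not_avoids l z0 x p : ~ avoids l z0 x p ->
  exists p1 a p2, p = p1 ++ (Some l, a) :: p2 /\
    subgroup_set (H l) (z0^-1 * walk_end x p1).
Proof.
elim: p x => [|[m y] p IH] x /=; first by [].
have [[-> z0x] _|Nx Na] := pselect (m = Some l /\ subgroup_set (H l) (z0^-1 * x)).
  by exists [::], y, p.
have [|p1 [a [p2 [-> e]]]] := IH y; first by move=> ay; apply: Na.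
by exists ((m, y) :: p1), a, p2.
Qed.

Lemma walk_from_to_split x y p1 a l p2 :
  walk_from_to x y (p1 ++ (Some l, a) :: p2) ->
  [/\ walk_from_to x (walk_end x p1) p1, subgroup_set (H l) ((walk_end x p1)^-1 * a) &
      walk_from_to a y p2].
Proof.
move=> [/walk_cat[w1 [/= e w2]]]; rewrite walk_end_cat => ey.
by split.
Qed.

Lemma avoids_coset l z0 z1 x p : subgroup_set (H l) (z0^-1 * z1) ->
  avoids l z0 x p -> avoids l z1 x p.
Proof.
move=> z01; elim: p x => //= -[m y] p IH x [Nx /IH ap]; split=> // -[ml z1x].
by apply: Nx; split=> //; apply: coset_trans z01 z1x.
Qed.

(** A peripheral coset has diameter at most 1, so a geodesic contains at most one of its edges, and
    this edge lies in only one of the two pieces. *)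
Lemma geodesic_avoids l z0 x m y p1 p2 :
  walk_from_to x m p1 -> walk_from_to m y p2 -> (size p1 + size p2)%N = D x y ->
  avoids l z0 x p1 \/ avoids l z0 m p2.
Proof.
move=> w1 w2 geo; have [|N1] := pselect (avoids l z0 x p1); first by left.
have [|N2] := pselect (avoids l z0 m p2); [by right | exfalso].
have [q1 [a [q2 [E1 e1]]]] := not_avoids N1.
have [r1 [b [r2 [E2 e2]]]] := not_avoids N2.
subst p1 p2; have [v1 h1 v2] := walk_from_to_split w1.
have [u1 h2 u2] := walk_from_to_split w2.
have ab : (D (walk_end x q1) b <= 1)%N.
  by apply: (@coset_dist _ _ _ _ Xsym genX l);
    apply: coset_trans (coset_trans (coset_sym e1) e2) h2.
have := walk_dist Xsym genX v1; have := walk_dist Xsym genX u2.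
have := dist_tri L x (walk_end x q1) b; have := dist_tri L x b y.
by move: geo; rewrite !size_cat /=; lia.
Qed.

Lemma geodesic_avoids_rest l z0 x y p1 a p2 :
  walk_from_to x y (p1 ++ (Some l, a) :: p2) -> size (p1 ++ (Some l, a) :: p2) = D x y ->
  subgroup_set (H l) (z0^-1 * walk_end x p1) ->
  avoids l z0 x p1 /\ avoids l z0 a p2.
Proof.
move=> w sz e; have [w1 h w2] := walk_from_to_split w.
have we : walk_from_to (walk_end x p1) a [:: (Some l, a)] by split.
have Ne : ~ avoids l z0 (walk_end x p1) [:: (Some l, a)] by move=> /= [/(_ (conj erefl e))].
have sE : size (p1 ++ (Some l, a) :: p2) = (size p1 + 1 + size p2)%N.
  by rewrite size_cat /=; lia.
split.
- have := @geodesic_avoids l z0 x _ y p1 ((Some l, a) :: p2) w1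
    (walk_from_to_cat we w2).
  by case=> //=; [rewrite -sz sE; lia | case=> /(_ (conj erefl e))].
- have := @geodesic_avoids l z0 x _ y (p1 ++ [:: (Some l, a)]) p2
    (walk_from_to_cat w1 we) w2.
  by case=> //; [rewrite -sz sE size_cat /=; lia | move=> /avoids_cat[_ /Ne]].
Qed.

Lemma far_avoids l z0 x y p : walk_from_to x y p -> (size p < D x z0)%N ->
  avoids l z0 x p.
Proof.
move=> w lt; apply: contrapT => /not_avoids[p1 [a [p2 [E e]]]]; subst p.
have [w1 h w2] := walk_from_to_split w; have := walk_dist Xsym genX w1.
have := coset_dist Xsym genX (coset_sym e); have := dist_tri L x (walk_end x p1) z0.
by move: lt; rewrite size_cat /=; lia.
Qed.

Fixpoint products (S : set G) (n : nat) : set G :=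
  if n is m.+1 then [set g | exists s t, [/\ S s, products S m t & g = s * t]]
  else [set 1].

Lemma finite_products S n : finite_set S -> finite_set (products S n).
Proof.
move=> fS; elim: n => [|n IH] /=; first exact: finite_set1.
apply: sub_finite_set (finite_image2 (fun a b : G => a * b) fS IH).
by move=> g [s [t [Ss tn ->]]]; exists s => //; exists t.
Qed.

Lemma products_le S m n : S 1 -> (m <= n)%N -> products S m `<=` products S n.
Proof.
move=> S1; elim: n => [|n IH]; first by rewrite leqn0 => /eqP->.
rewrite leq_eqVlt => /orP[/eqP-> //|]; rewrite ltnS => /IH mn g /mn gn.
by exists 1, g; split=> //; rewrite mul1g.
Qed.

Lemma walk_products S x p :
  (forall p1 l a p2, p = p1 ++ (l, a) :: p2 -> S ((walk_end x p1)^-1 * a)) ->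
  products S (size p) (x^-1 * walk_end x p).
Proof.
elim: p x => [|[l y] p IH] x PS /=; first by rewrite /= mulVg.
exists (x^-1 * y), (y^-1 * walk_end y p); split; last by rewrite mulgA mulgK.
  exact: (PS [::] l y p).
by apply: IH => p1 m a p2 E; apply: (PS ((l, y) :: p1) m a p2); rewrite E.
Qed.

Variable delta : nat.
Hypothesis hyp : hyperbolic len delta.

Lemma displacement_between eps h y z : between len 1 z y ->
  (len h <= eps)%N -> (D y (h * y)%g <= eps)%N -> (D z (h * z)%g <= eps + delta)%N.
Proof.
rewrite /between -(dist1 _ h) => zy h1 hy.
have := hyp 1 y z (h * z).
have := dist_tri L y (h * y) (h * z); have := dist_tri L 1 h (h * z).
have E : D h (h * z) = D 1 z by rewrite -{1}(mulg1 h) dist_mul.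
by rewrite E dist_mul (distC L y z) => *; lia.
Qed.

Section Window.
Variables (kappa W : nat).
Hypothesis WE : (2 * kappa + 1 <= W)%N.
Let B := \bigcup_l support_ball Om l (K * (4 * W + 2 * kappa + 1))%N.
Let S := [set 1] `|` X `|` B.

Variables (m z : G) (p1 p2 : seq (option Lambda * G)).
Hypotheses (wp1 : walk_from_to 1 m p1) (wp2 : walk_from_to m z p2).
Hypotheses (sp1 : size p1 = W) (sp2 : size p2 = W) (zW : D 1 z = (2 * W)%N).
Let vertices := unzip2 (p1 ++ p2).

(** Take a geodesic from [m] to [h * m]. A peripheral edge of it that is isolated in the loop
    through 1 or in the loop through [z] has its letter in [B]; if all are, the second alternative
    holds. Otherwise the fixed geodesic and its translate both run along the coset of some edge, and
    the edge joining their exit points [a] and [h * v] has its letter in [B], so finitely many data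
    determine [h]. *)
Lemma window_dichotomy h : (len h <= kappa)%N -> (D m (h * m)%g <= kappa)%N ->
  (D z (h * z)%g <= kappa)%N ->
  (exists a b v, [/\ a \in vertices, v \in vertices, B b & h = a * b * v^-1]) \/
  products S kappa (m^-1 * (h * m)).
Proof.
move=> h1 hm hz.
have [J wJ sJ] := dist_walk Xsym genX m (h * m).
have [J0 wJ0 sJ0] := dist_walk Xsym genX 1 h.
have [Jz wJz sJz] := dist_walk Xsym genX z (h * z).
have S1 : S 1 by left; left.
have m1 : D 1 m = W.
  have := walk_dist Xsym genX wp1; have := walk_dist Xsym genX wp2.
  by have := dist_tri L 1 m z; rewrite sp1 sp2; lia.
have mz : D m z = W.
  by have := walk_dist Xsym genX wp2; have := dist_tri L 1 m z; rewrite sp2; lia.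
have whp1 := walk_from_to_translate h wp1; rewrite mulg1 in whp1.
have whp2 := walk_from_to_translate h wp2.
have wp := walk_from_to_cat wp1 wp2; have whp := walk_from_to_cat whp1 whp2.
have sp : size (p1 ++ p2) = D 1 z by rewrite size_cat sp1 sp2 zW; lia.
have shp : size (translate h p1 ++ translate h p2) = D h (h * z).
  by rewrite -[X in D X _]mulg1 dist_mul -sp !size_cat !size_map.
have [|N] := pselect (exists a b v, [/\ a \in vertices, v \in vertices,
  B b & h = a * b * v^-1]).
  by left.
right; rewrite -{1}wJ.2; apply: products_le (walk_products _) => //.
  by rewrite sJ.
move=> j1 l e' j2 EJ; set e := walk_end m j1.
rewrite EJ in wJ sJ.
case: l EJ wJ sJ => [l|] EJ wJ sJ; last first.
  by move: wJ => [/walk_cat[_ /= [? _]] _]; left; right.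
have [w1 ee' w2] := walk_from_to_split wJ; rewrite -/e in w1 ee'.
have ee : subgroup_set (H l) (e^-1 * e) by rewrite mulVg; apply: subgroup1.
have [a1 a2] := geodesic_avoids_rest wJ sJ ee.
have sj : (size j1 + size j2 + 1 <= kappa)%N.
  by move: sJ; rewrite size_cat /=; lia.
have me : (D m e <= kappa)%N by have := walk_dist Xsym genX w1; lia.
(* [e] is within [kappa] of [m]; the margin [2 * kappa + 1 <= W] keeps the short connections at 1
   and at [z] off its coset. *)
have aJ0 : avoids l e 1 J0.
  apply: far_avoids wJ0 _; rewrite sJ0 dist1.
  by have := dist_tri L 1 e m; rewrite (distC L e m); lia.
have aJz : avoids l e z Jz.
  apply: far_avoids wJz _; rewrite sJz.
  by have := dist_tri L m e z; rewrite (distC L e z); lia.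
have loop q : walk_from_to m (h * m) q -> avoids l e m q ->
    (size q <= 2 * W + kappa)%N -> S (e^-1 * e').
  move=> wq aq sq; right; exists l => //.
  apply: support_ball_le (isolated w1 ee' w2 wq a1 a2 aq).
  by rewrite leq_mul2l; apply/orP; right; lia.
have left_loop : avoids l e 1 p1 -> avoids l e h (translate h p1) -> S (e^-1 * e').
  move=> A1 B1; have wr := walk_from_to_rev Xsym wp1.
  apply: (loop (walk_rev 1 p1 ++ (J0 ++ translate h p1))).
  - exact: walk_from_to_cat wr (walk_from_to_cat wJ0 whp1).
  - rewrite !avoids_cat wr.2 wJ0.2; split=> //; exact: avoids_rev wp1 A1.
  - by rewrite !size_cat size_walk_rev size_map sp1 sJ0 dist1; lia.
have right_loop : avoids l e m p2 -> avoids l e (h * m) (translate h p2) -> S (e^-1 * e').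
  move=> A2 B2; have wr := walk_from_to_rev Xsym whp2.
  apply: (loop (p2 ++ (Jz ++ walk_rev (h * m) (translate h p2)))).
  - exact: walk_from_to_cat wp2 (walk_from_to_cat wJz wr).
  - rewrite !avoids_cat wp2.2 wJz.2; split=> //; split=> //; exact: avoids_rev whp2 B2.
  - by rewrite !size_cat size_walk_rev size_map sp2 sJz; lia.
have [Ap|NAp] := pselect (avoids l e 1 (p1 ++ p2)).
  move: Ap => /avoids_cat[A1 A2]; rewrite wp1.2 in A2.
  have [|B1|B2] := @geodesic_avoids l e _ _ _ _ _ whp1 whp2;
    [by rewrite -size_cat | exact: left_loop | exact: right_loop].
have [Bp|NBp] := pselect (avoids l e h (translate h p1 ++ translate h p2)).
  move: Bp => /avoids_cat[B1 B2]; rewrite whp1.2 in B2.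
  have [|A1|A2] := @geodesic_avoids l e _ _ _ _ _ wp1 wp2;
    [by rewrite -size_cat | exact: left_loop | exact: right_loop].
exfalso; apply: N.
have [pa [a [pa' [Ea ea]]]] := not_avoids NAp.
have [pb [b [pb' [Eb eb]]]] := not_avoids NBp.
have va : a \in vertices by rewrite /vertices Ea /unzip2 map_cat mem_cat /= mem_head orbT.
have : b \in unzip2 (translate h (p1 ++ p2)).
  by rewrite /translate map_cat Eb /unzip2 map_cat mem_cat /= mem_head orbT.
rewrite /unzip2 -map_comp (_ : _ \o _ = (fun g => h * g) \o snd) // map_comp.
move=> /mapP[v vv bv]; rewrite -/vertices in vv.
exists a, (a^-1 * b), v; split=> //; last by rewrite bv !mulgA mulgV mul1g mulgK.
rewrite Ea in wp sp; rewrite Eb in whp shp.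
have [_ ha wa] := walk_from_to_split wp; have [_ hb wb] := walk_from_to_split whp.
have [_ aa] := geodesic_avoids_rest wp sp ea.
have [_ ab] := geodesic_avoids_rest whp shp eb.
have hea := coset_trans ea ha; have heb := coset_trans eb hb.
have wr := walk_from_to_rev Xsym wb.
exists l => //; apply: support_ball_le (@isolated l a b a b [::] [::]
    (pa' ++ (Jz ++ walk_rev b pb')) _ _ _ _ _ _ _) => //.
- rewrite leq_mul2l; apply/orP; right; move: sp shp.
  have -> : D h (h * z) = D 1 z by rewrite -{1}(mulg1 h) dist_mul.
  rewrite zW /= !size_cat /= size_walk_rev sJz.
  by lia.
- exact: coset_trans (coset_sym hea) heb.
- exact: walk_from_to_cat wa (walk_from_to_cat wJz wr).
- apply: avoids_coset hea _; rewrite !avoids_cat wa.2 wJz.2; split=> //; split=> //.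
  exact: avoids_rev wb ab.
Qed.

End Window.

Lemma rel_acylindrical : acylindrical len.
Proof.
move=> eps; pose kappa := (eps + delta)%N; pose W := (2 * kappa + 1)%N.
pose B := \bigcup_l support_ball Om l (K * (4 * W + 2 * kappa + 1))%N.
pose S := [set 1] `|` X `|` B.
have fB : finite_set B by apply: finite_support_balls.
have fS : finite_set S by apply: finite_union fB; apply: finite_union finX; apply: finite_set1.
have [sB EB] := (finite_seqP B).1 fB.
have [sS ES] := (finite_seqP _).1 (finite_products kappa fS).
(* The summands count the two alternatives of [window_dichotomy]: triples [(a, b, v)] with [2 * W]
   choices for each of the vertices [a] and [v], and products of [kappa] elements of [S]. *)
exists (2 * W)%N, (2 * W * (2 * W) * size sB + size sS)%N => y yW.
have [|z z1 zy] := @dist_geodesic _ _ L 1 y (2 * W); first by rewrite dist1.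
have [|m m1 mz] := @dist_geodesic _ _ L 1 z W; first by rewrite z1; lia.
have [p1 w1 s1] := dist_walk Xsym genX 1 m; have [p2 w2 s2] := dist_walk Xsym genX m z.
have s1W : size p1 = W by rewrite s1.
have s2W : size p2 = W by rewrite s2 mz z1; lia.
pose vs := unzip2 (p1 ++ p2).
have svs : size vs = (2 * W)%N by rewrite size_map size_cat s1W s2W; lia.
exists ([seq ab.1 * ab.2 * v^-1 | ab <- [seq (a, b) | a <- vs, b <- sB], v <- vs]
        ++ [seq m * g * m^-1 | g <- sS]).
split; first by rewrite size_cat !size_allpairs svs size_map leq_add2r mulnAC.
move=> h h1 hy.
have by1 : between len 1 z y by move: zy z1; rewrite /between !dist1; lia.
have bm : between len 1 m y.
  by have := dist_tri L m z y; have := dist_tri L 1 m y; move: mz m1 by1; rewrite /between; lia.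
rewrite mem_cat; apply/orP.
have [||||[a [b [v [va vv Bb ->]]]]|] :=
  @window_dichotomy kappa W _ m z p1 p2 w1 w2 s1W s2W z1 h.
- by rewrite /W.
- by rewrite /kappa; lia.
- exact: displacement_between bm h1 hy.
- exact: displacement_between by1 h1 hy.
- left; apply/allpairsP; exists ((a, b), v); split=> //.
  by apply/allpairsP; exists (a, b); split=> //; have : [set` sB] b by rewrite -EB.
- rewrite -[products _ _ _]/(products S _ _) ES => /= g; right; apply/mapP.
  by exists (m^-1 * (h * m)) => //; rewrite mulVKg mulgK.
Qed.

End Acylindricity.

(** * Unboundedness *)

Section Unbounded.
Variables (G : groupType) (Lambda : Type) (H : Lambda -> subgroup G) (X : set G).
Hypothesis Xsym : symmetric_set X.
Hypothesis finX : finite_set X.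
Hypothesis genX : relative_generating H X.
Local Notation walk_from_to := (walk_from_to H X).
Local Notation len := (rel_len Xsym genX).
Local Notation D := (dist len).
Local Notation avoids := (avoids H).
Let L : length_function len := rel_lenP Xsym genX.
Implicit Types (x y z g h : G) (p q : seq (option Lambda * G)).

Variables (Om : set (Lambda * G)) (K : nat).
Hypothesis finOm : finite_set Om.
Hypothesis isolated : forall l x y z z' p1 p2 q,
    walk_from_to x z p1 -> subgroup_set (H l) (z^-1 * z') -> walk_from_to z' y p2 ->
    walk_from_to x y q ->
    avoids l z x p1 -> avoids l z z' p2 -> avoids l z x q ->
    support_ball Om l (K * (size p1 + size p2 + size q + 1))%N (z^-1 * z').
Hypothesis proper : forall l, (H l : set G) <> setT.
Hypothesis infG : ~ finite_set [set: G].

Lemma subgroupM (B : subgroup G) x y :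
  subgroup_set B x -> subgroup_set B y -> subgroup_set B (x * y).
Proof.
move=> Bx By; have := subgroup_div Bx (subgroup_div (subgroup1 B) By).
by rewrite div1g invgK.
Qed.

Lemma bounded_products n : (forall g, len g <= n)%N ->
  setT = products (X `|` \bigcup_l H l `|` [set 1]) n.
Proof.
move=> ln; apply/esym; rewrite -subTset => g _.
have [p wp sp] := dist_walk Xsym genX 1 g.
set S := _ `|` [set 1]; have S1 : S 1 by right.
have wS : products S (size p) (1^-1 * walk_end 1 p).
  apply: walk_products => p1 l a p2 E; move: wp => []; rewrite E => /walk_cat[_ [e _]] _.
  left; case: l e {E} => [l|] e; [by right; exists l | by left].
by move: wS; rewrite wp.2 invg1 mul1g sp dist1; apply: products_le.
Qed.

(** If every [H l] were contained in some ball, all of them would be finite, and trivial for the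
    labels absent from [Om]; bounded word length would then make [G] finite. *)
Lemma large_peripheral n : (forall g, len g <= n)%N ->
  exists l, forall m, exists2 h, subgroup_set (H l) h & ~ support_ball Om l m h.
Proof.
move=> ln; apply: contrapT => Nex.
have small l : exists m, (H l : set G) `<=` support_ball Om l m.
  apply: contrapT => Nm; apply: Nex; exists l => m; apply: contrapT => Nh.
  by apply: Nm; exists m => h Hh; apply: contrapT => Nb; apply: Nh; exists h.
have fH l : finite_set (H l).
  by have [m sm] := small l; apply: sub_finite_set sm (finite_support_ball l m finOm).
apply: infG; rewrite (bounded_products ln); apply: finite_products.
apply: finite_union (finite_set1 _); apply: finite_union => //.
apply: (@sub_finite_set _ _ ([set 1] `|` \bigcup_(l in @fst _ _ @` Om) H l)).
  move=> g [l _ Hg]; have [[s Os]|Nl] := pselect (exists s, Om (l, s)).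
    by right; exists l => //; exists (l, s).
  left; have [m sm] := small l; apply: (@support_ball_eq1 _ _ Om l m) (sm _ Hg).
  by move=> s Os; apply: Nl; exists s.
apply: finite_union (finite_set1 _) _; apply: bigcup_finite => //.
exact: finite_image.
Qed.

Lemma outside_letter l : exists a m, [/\ edge H X m 1 a, ~ subgroup_set (H l) a & m <> Some l].
Proof.
have [a [Xa Na]] : exists a, (X `|` \bigcup_l H l) a /\ ~ subgroup_set (H l) a.
  apply: contrapT => Na; apply: (@proper l); rewrite -subTset => g _.
  have : subgroup_set (gen (X `|` \bigcup_l H l)) g by rewrite genX.
  by apply=> a Xa; apply: contrapT => Nl; apply: Na; exists a.
case: Xa => [Xa|[k _ Ha]].
  by exists a, None; split=> //=; rewrite invg1 mul1g.
exists a, (Some k); split=> //=; first by rewrite invg1 mul1g.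
by move=> [kl]; subst k.
Qed.

(** The cosets are distinct, so one edge of [p] can spoil at most one of them. *)
Lemma avoid_pigeonhole l (E : nat -> G) (I : seq nat) x p : uniq I ->
  {in I &, forall i j, i <> j -> ~ subgroup_set (H l) ((E i)^-1 * E j)} ->
  (size p < size I)%N -> exists2 i, i \in I & avoids l (E i) x p.
Proof.
elim: p x I => [|[m y] p IH] x I uI dI sI.
  by case: I sI {uI dI} => //= i I _; exists i; rewrite ?mem_head.
have [[i0 [i0I [ml Ei0]]]|N] := pselect (exists i, i \in I /\
    (m = Some l /\ subgroup_set (H l) ((E i)^-1 * x))).
  have [||i iI ai] := IH y (rem i0 I) (rem_uniq i0 uI).
  - by move=> i j /mem_rem iI /mem_rem jI; apply: dI.
  - by rewrite size_rem //; move: sI => /=; lia.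
  - have ii0 : i <> i0 by move=> E0; move: iI; rewrite E0 mem_rem_uniq // inE eqxx.
    exists i => /=; first exact: mem_rem iI.
    split=> // -[_ Ei]; apply: (dI i i0 (mem_rem iI) i0I ii0).
    exact/(coset_trans Ei)/coset_sym.
have [|i iI ai] := IH y I uI dI; first exact: ltnW.
by exists i => //; split=> // -[? ?]; apply: N; exists i.
Qed.

Section Zigzag.
Variables (l : Lambda) (a h : G) (m : option Lambda).
Hypotheses (ea : edge H X m 1 a) (Na : ~ subgroup_set (H l) a) (ml : m <> Some l).
Hypothesis Hh : subgroup_set (H l) h.

Fixpoint zigzag x n : seq (option Lambda * G) :=
  if n is k.+1 then (m, x * a) :: (Some l, x * a * h) :: zigzag (x * a * h) k
  else [::].

Lemma size_zigzag x n : size (zigzag x n) = (2 * n)%N.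
Proof. by elim: n x => //= n IH x; rewrite IH; lia. Qed.

Lemma letter_walk x : walk_from_to x (x * a) [:: (m, x * a)].
Proof.
by split=> //; split=> //; have := edge_translate H X x m 1 a; rewrite mulg1 => ->.
Qed.

Lemma zigzag_walk x n : walk_from_to x (x * (a * h) ^+ n) (zigzag x n).
Proof.
elim: n x => [|n IH] x; first by rewrite mulg1; split.
apply: (walk_from_to_cat (p := [:: _]) (letter_walk x)).
apply: (walk_from_to_cat (p := [:: _]) (y := x * a * h)).
  by split=> //; split=> //=; rewrite mulKg.
by have := IH (x * a * h); rewrite expgS !mulgA.
Qed.

Lemma zigzag_avoids z0 x n :
  (forall i, (i < n)%N -> ~ subgroup_set (H l) (z0^-1 * (x * (a * h) ^+ i * a))) ->
  avoids l z0 x (zigzag x n).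
Proof.
elim: n x => //= n IH x Nz; split; first by case.
split; first by case=> _; have := Nz 0%N isT; rewrite expg0 mulg1.
apply: IH => i i_n; have := Nz i.+1 i_n; by rewrite expgS !mulgA.
Qed.

Lemma letter_avoids z0 x y : avoids l z0 x [:: (m, y)].
Proof. by split=> // -[]. Qed.

Let swap i : (a * h) ^+ i * a = a * (h * a) ^+ i.
Proof. by elim: i => [|i IH]; rewrite ?mulg1 ?mul1g // !expgS -!mulgA IH. Qed.

(** If [(h * a) ^+ k] were in [H l], a single edge labelled [l] would close up the alternating walk.
    By minimality of [k] the first edge [h] would be isolated in this loop of length at most
    [2 * n], and [h] would lie in the excluded ball. *)
Lemma zigzag_cosets n : ~ support_ball Om l (K * (2 * n)) h ->
  forall k, (0 < k <= n)%N -> ~ subgroup_set (H l) ((h * a) ^+ k).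
Proof.
move=> Nh k; elim/ltn_ind: k => k IH /andP[k0 kn] Hk.
case: k k0 kn Hk IH => [//|[|k]] _ kn Hk IH.
  apply: Na; rewrite expg1 in Hk.
  by have := subgroupM (subgroup_div (subgroup1 (H l)) Hh) Hk; rewrite div1g mulKg.
apply: Nh; set y := (a * h) ^+ k.+1 * a.
have Hy : subgroup_set (H l) y.
  have := subgroupM (subgroup_div (subgroup1 (H l)) Hh) Hk.
  by rewrite div1g expgS -mulgA mulKg -swap.
have NaV : ~ subgroup_set (H l) (a^-1 * 1).
  by rewrite mulg1 => /(subgroup_div (subgroup1 (H l))); rewrite div1g invgK.
have w0 : walk_from_to 1 a [:: (m, a)] by have := letter_walk 1; rewrite mul1g.
have w1 := zigzag_walk (a * h) k; have w2 := letter_walk (a * h * (a * h) ^+ k).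
have yE : a * h * (a * h) ^+ k * a = y by rewrite /y expgS.
rewrite yE in w2; have wq : walk_from_to 1 y [:: (Some l, y)].
  by split=> //; split=> //=; rewrite invg1 mul1g.
rewrite -(mulKg a h); apply: support_ball_le (isolated w0 _ (walk_from_to_cat w1 w2) wq _ _ _).
- by rewrite leq_mul2l size_cat size_zigzag /=; lia.
- by rewrite mulKg.
- exact: letter_avoids.
- apply/avoids_cat; split; last by rewrite w1.2; apply: letter_avoids.
  apply: zigzag_avoids => i ik.
  have -> : a^-1 * (a * h * (a * h) ^+ i * a) = (h * a) ^+ i.+1.
    by rewrite -!mulgA mulKg swap expgS -!mulgA.
  by apply: IH; lia.
- by split=> // -[_].
Qed.

(** The [n] edges [h] of the zigzag lie in distinct cosets. A walk of at most [d < n] edges between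
    its ends misses one of these cosets, and the edge [h] in it is then isolated in the resulting
    loop. *)
Lemma zigzag_long n d : ~ support_ball Om l (K * (2 * n + d)) h -> (d < n)%N ->
  (d < len ((a * h) ^+ n))%N.
Proof.
move=> Nh dn; rewrite ltnNge; apply/negP => le; pose E i := (a * h) ^+ i * a.
have NE i j : (i < n)%N -> (j < n)%N -> i <> j -> ~ subgroup_set (H l) ((E i)^-1 * E j).
  suff H1 i' j' : (i' < j')%N -> (j' < n)%N -> ~ subgroup_set (H l) ((E i')^-1 * E j').
    move=> i_n j_n ij; have [ij'|ji|//] := ltngtP i j; first exact: H1.
    by move=> /coset_sym; apply: H1.
  move=> ij jn; rewrite /E.
  have -> : ((a * h) ^+ i' * a)^-1 * ((a * h) ^+ j' * a) = (h * a) ^+ (j' - i').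
    rewrite -(subnKC (ltnW ij)) expgnDr invgM -!mulgA mulKg swap mulKg.
    by rewrite addnC addnK.
  apply: (@zigzag_cosets n); last by lia.
  by move=> b; apply: Nh; apply: support_ball_le b; rewrite leq_mul2l; lia.
have [J wJ sJ] := dist_walk Xsym genX 1 ((a * h) ^+ n); rewrite dist1 in sJ.
have [|||i] := @avoid_pigeonhole l E (iota 0 n) 1 J.
- exact: iota_uniq.
- by move=> i j; rewrite !mem_iota /= !add0n; apply: NE.
- by rewrite size_iota; lia.
rewrite mem_iota /= add0n => i_n aJ; apply: Nh.
have w0 := zigzag_walk 1 i; have w1 := letter_walk (1 * (a * h) ^+ i).
have w2 := zigzag_walk (E i * h) (n - i.+1).
have EE : 1 * (a * h) ^+ i * a = E i by rewrite mul1g.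
have EN : E i * h * (a * h) ^+ (n - i.+1) = (a * h) ^+ n.
  by rewrite /E -(mulgA _ a h) -expgSr -expgnDr; congr (_ ^+ _); lia.
rewrite EE in w1; rewrite EN in w2.
rewrite -(mulKg (E i) h).
apply: support_ball_le (isolated (walk_from_to_cat w0 w1) _ w2 wJ _ _ aJ).
- by rewrite leq_mul2l size_cat !size_zigzag /=; lia.
- by rewrite mulKg.
- apply/avoids_cat; split; last by rewrite w0.2; apply: letter_avoids.
  by apply: zigzag_avoids => j ji; rewrite mul1g; apply: NE; lia.
- apply: zigzag_avoids => j ji.
  have -> : E i * h * (a * h) ^+ j * a = E (i.+1 + j)%N.
    by rewrite /E expgnDr expgSr -!mulgA.
  by apply: NE; lia.
Qed.

End Zigzag.

Theorem rel_len_unbounded n : exists g, (n <= len g)%N.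
Proof.
apply: contrapT => N; have ln g : (len g <= n)%N.
  by rewrite leqNgt; apply/negP => lt; apply: N; exists g; apply: ltnW.
have [l lP] := large_peripheral ln; have [a [m [ea Na ml]]] := outside_letter l.
have [h Hh Nh] := lP (K * (2 * n.+1 + n))%N.
by have := zigzag_long ea Na ml Hh Nh (ltnSn n); rewrite ltnNge ln.
Qed.

End Unbounded.

Lemma path_labelled (G : groupType) (Lambda : Type) (H : Lambda -> subgroup G) (X : set G)
    (Xsym : symmetric_set X) (genX : relative_generating H X) (u v : G -> int) x s :
  path (adjacent (rel_len Xsym genX)) x s ->
  exists p, [/\ walk_from_to H X x (last x s) p, (size p <= size s)%N &
                walk_area u v x p = path_area u v x s].
Proof.
have L := rel_lenP Xsym genX.
elim: s x => [|y s IH] x /=; first by exists [::].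
move=> /andP[xy /IH[p [wp sp ap]]]; have [[|a q] wq sq] := dist_walk Xsym genX x y.
  have E := dist_eq0 L (esym sq); subst y; exists p; split=> //; first exact: leqW.
  by rewrite ap; lia.
move: xy; rewrite /adjacent -sq; case: q wq {sq} => // wq _; case: a wq => l z wq.
have E : z = y := wq.2; subst z; exists ((l, y) :: p); split=> //=; last by rewrite ap.
exact: walk_from_to_cat wq wp.
Qed.

Theorem relatively_hyperbolic_acylindrical (G : groupType) (Lambda : Type)
    (H : Lambda -> subgroup G) :
  relatively_hyperbolic H -> (forall l, (H l : set G) <> setT) ->
  ~ finite_set [set: G] ->
  exists (len : G -> nat) (delta : nat),
    [/\ length_function len, hyperbolic len delta, acylindrical len &
        forall n, exists g, (n <= len g)%N].
Proof.
move=> [X [R [Xsym finX finR presR isoR]]] proper infG; pose genX := proj1 presR.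
have L := rel_lenP Xsym genX.
have [K areaK] := lipschitz_area Xsym presR finR isoR.
have areaP : area_isoperimetric (rel_len Xsym genX) K.
  move=> u v x s Lu Lv xs lx; have [p [wp sp <-]] := path_labelled u v xs.
  rewrite lx in wp; apply: leq_trans (areaK u v x p Lu Lv wp) _.
  by rewrite leq_mul2l sp orbT.
have hyp := area_hyperbolic L areaP.
have [Om [M [finOm isolated]]] := isolated_component Xsym presR finR isoR.
exists (rel_len Xsym genX), (6 * (84 * K + 1) + 2)%N; split=> //.
- exact: (rel_acylindrical finX finOm isolated hyp).
- exact: (rel_len_unbounded Xsym finX genX finOm isolated proper infG).
Qed.

(** * Loxodromic elements *)

Section IntegerPowers.
Variable G : groupType.
Implicit Types (g h : G) (i j : int).

Definition zpow g i : G := match i with Posz n => g ^+ n | Negz n => g ^- n.+1 end.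

Lemma zpow1 g : zpow g 1 = g. Proof. by []. Qed.

Lemma zpowS g i : zpow g (i + 1)%R = zpow g i * g.
Proof.
case: i => [n|[|n]].
- by rewrite (_ : (Posz n + 1)%R = Posz n.+1) /= ?expgSr //; lia.
- by rewrite (_ : (Negz 0 + 1)%R = Posz 0) /= ?mulVg //; lia.
- rewrite (_ : (Negz n.+1 + 1)%R = Negz n); last by lia.
  by rewrite /zpow (expgS g n.+1) invgM mulgVK.
Qed.

Lemma zpowB1 g i : zpow g (i - 1)%R = zpow g i * g^-1.
Proof.
have := zpowS g (i - 1)%R; rewrite (_ : (i - 1 + 1)%R = i); last by lia.
by move=> ->; rewrite mulgK.
Qed.

Lemma zpowD g i j : zpow g (i + j)%R = zpow g i * zpow g j.
Proof.
elim/int_rect: j => [|n IH|n IH].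
- by rewrite GRing.addr0 mulg1.
- have E : (Posz n.+1 = Posz n + 1)%R by lia.
  by rewrite E GRing.addrA !zpowS IH mulgA.
- have E : (- Posz n.+1 = - Posz n - 1)%R by lia.
  by rewrite E GRing.addrA !zpowB1 IH mulgA.
Qed.

Lemma zpowN g i : zpow g (- i)%R = (zpow g i)^-1.
Proof. by apply/esym/mulg1_eq; rewrite -zpowD GRing.addrN. Qed.

Lemma zpow_nat g (n : nat) : zpow g n = g ^+ n. Proof. by []. Qed.

Lemma zpowM g i j : zpow g (i * j)%R = zpow (zpow g i) j.
Proof.
elim/int_rect: j => [|n IH|n IH].
- by rewrite GRing.mulr0.
- have E : (i * Posz n.+1 = i * Posz n + i)%R by lia.
  have E' : (Posz n.+1 = Posz n + 1)%R by lia.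
  by rewrite E zpowD IH E' zpowS.
- have E : (i * - Posz n.+1 = i * - Posz n - i)%R by lia.
  have E' : (- Posz n.+1 = - Posz n - 1)%R by lia.
  by rewrite E zpowD IH E' zpowB1 (zpowN g i).
Qed.

Lemma zpowJ g h i : h * zpow g i * h^-1 = zpow (h * g * h^-1) i.
Proof.
elim/int_rect: i => [|n IH|n IH].
- by rewrite mulg1 mulgV.
- have E : (Posz n.+1 = Posz n + 1)%R by lia.
  by rewrite E !zpowS -IH !mulgA mulgVK.
- have E : (- Posz n.+1 = - Posz n - 1)%R by lia.
  by rewrite E !zpowB1 -IH !invgM invgK !mulgA mulgVK.
Qed.

End IntegerPowers.

Section Loxodromic.
Variables (G : groupType) (len : G -> nat) (L : length_function len) (delta : nat).
Hypothesis hyp : hyperbolic len delta.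
Local Notation D := (dist len).
Implicit Types (g h w x y z : G).

Let tri := dist_tri L.
Let sC := distC L.

Lemma len_zpow g i : len (zpow g i) = len (g ^+ `|i|).
Proof. by case: i => n //=; rewrite lenV. Qed.

Lemma dist_zpow g i j : D (zpow g i) (zpow g j) = len (g ^+ `|(i - j)%R|).
Proof.
rewrite /dist -zpowN -zpowD len_zpow; congr (len (_ ^+ _)); lia.
Qed.

Section Chains.
Variable kappa : nat.

(** A broken geodesic: [kappa] bounds the backtracking at each corner, which is twice a Gromov
    product, and every step exceeds it by more than [2 * delta]. In the four-point inequality this
    excludes the wrong alternative, so the local condition forces global progress. *)
Definition chain (x : nat -> G) : Prop := forall i,
  (kappa + 2 * delta < D (x i) (x i.+1))%N /\
  (D (x i) (x i.+1) + D (x i.+1) (x i.+2) <= D (x i) (x i.+2) + kappa)%N.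

Lemma chain_shift (x : nat -> G) k : chain x -> chain (fun i => x (k + i)%N).
Proof. by move=> cx i; rewrite !addnS; apply: cx. Qed.

Lemma chain_last (x : nat -> G) n : chain x ->
  (D (x 0) (x n) + D (x n) (x n.+1) <= D (x 0) (x n.+1) + kappa + delta)%N.
Proof.
move=> cx; elim: n => [|n IH]; first by rewrite (distxx L); lia.
have [d b] := cx n; have := hyp (x 0) (x n.+1) (x n) (x n.+2).
by rewrite (sC (x n.+1) (x n)) in IH *; lia.
Qed.

Lemma chain_first (x : nat -> G) n : chain x ->
  (D (x 0) (x 1) + D (x 1) (x n.+1) <= D (x 0) (x n.+1) + kappa + delta)%N.
Proof.
elim: n x => [|n IH] x cx; first by rewrite (distxx L); lia.
have := IH _ (chain_shift 1 cx); rewrite !add1n => {}IH.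
have [d b] := cx 0; have [d' _] := cx 1%N; have := hyp (x 0) (x 2%N) (x 1%N) (x n.+2).
by rewrite (sC (x 2%N) (x 1%N)); lia.
Qed.

Lemma chain_between (x : nat -> G) i j : chain x ->
  (D (x 0) (x i) + D (x i) (x (i + j)%N) <= D (x 0) (x (i + j)%N) + kappa + 2 * delta)%N.
Proof.
move=> cx; case: j => [|j]; first by rewrite addn0 (distxx L); lia.
have := chain_first j (chain_shift i cx); have := chain_last i cx.
rewrite !addn0 addn1; have [d _] := cx i.
have := hyp (x 0) (x i.+1) (x i) (x (i + j.+1)%N).
by rewrite (sC (x i.+1) (x i)); lia.
Qed.

Lemma chain_growth (x : nat -> G) n : chain x -> (n <= D (x 0) (x n))%N.
Proof.
move=> cx; elim: n => // n IH; have := chain_last n cx; have [d _] := cx n.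
by lia.
Qed.

End Chains.

(** Quasi-additivity with constant [c] says that [n |-> g ^+ n] runs along a
    geodesic up to [c]. *)
Definition quasi_additive (c : nat) g : Prop := forall m n : nat,
  (len (g ^+ m) + len (g ^+ n) <= len (g ^+ (m + n)) + c)%N.

Definition loxodromic g : Prop :=
  (exists c, quasi_additive c g) /\
  (forall k, exists n0, forall n, (n0 <= n)%N -> (k <= len (g ^+ n)%g)%N).

Lemma loxodromic_growth g c : quasi_additive c g -> (forall k, exists n,
  (k <= len (g ^+ n)%g)%N) ->
  loxodromic g.
Proof.
move=> qa gr; split; first by exists c.
move=> k; have [n0 n0P] := gr (k + c)%N; exists n0 => n nn0.
by have := qa n0 (n - n0)%N; rewrite subnKC //; lia.
Qed.

Lemma loxodromic_chain kappa (x : nat -> G) w k : chain kappa x -> x 0 = 1 ->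
  (0 < k)%N -> (forall i j, x (k * i + j)%N = w ^+ i * x j) ->
  loxodromic w /\ quasi_additive (kappa + 2 * delta) w.
Proof.
move=> cx x0 k0 xw; have xE i : x (k * i)%N = w ^+ i.
  by have := xw i 0; rewrite addn0 x0 mulg1.
have qa : quasi_additive (kappa + 2 * delta) w.
  move=> m n; have := chain_between (k * m) (k * n) cx.
  rewrite -mulnDr !xE x0 !dist1 // /dist -(subnKC (leq_addr n m)).
  by rewrite expgnDr mulKg addKn addnA.
split=> //; apply: loxodromic_growth qa _ => n; exists n.
have := chain_growth (k * n) cx; rewrite x0 xE dist1.
by apply: leq_trans; rewrite leq_pmull.
Qed.

(** The powers of [g] form a chain whose backtracking is exactly [2 * len g - len (g ^+ 2)]. *)
Lemma loxodromic_criterion g : (len g + 2 * delta < len (g ^+ 2)%g)%N -> loxodromic g.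
Proof.
move=> lt; have D1 i : D (g ^+ i) (g ^+ i.+1) = len g.
  by rewrite /dist expgSr mulKg.
have D2 i : D (g ^+ i) (g ^+ i.+2) = len (g ^+ 2).
  by rewrite /dist -addn2 expgnDr mulKg.
have l2 : (len (g ^+ 2)%g <= 2 * len g)%N by apply: leq_trans (lenM L g g) _; lia.
have cg : chain (2 * len g - len (g ^+ 2)%g) (fun i => g ^+ i).
  by move=> i; rewrite !D1 D2; lia.
have [] // := @loxodromic_chain _ _ g 1 cg (expg0 g) isT.
by move=> i j; rewrite mul1n expgnDr.
Qed.

Lemma len_mul_dist x y : len (x * y) = D x^-1 y.
Proof. by rewrite /dist invgK. Qed.

(** Without loxodromic elements the metric is ultrametric up to a constant,
    which is absurd at the midpoint of a long geodesic. *)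
Lemma loxodromic_exists : (forall n, exists g, (n <= len g)%N) -> exists g, loxodromic g.
Proof.
move=> unb; apply: contrapT => Nlox.
have NL g : (len (g ^+ 2)%g <= len g + 2 * delta)%N.
  by rewrite leqNgt; apply/negP => /loxodromic_criterion lg; apply: Nlox; exists g.
have alt x y : (len (x * y)%g <= maxn (len x) (len y) + 2 * delta)%N \/
               (len (y * x)%g <= maxn (len x) (len y) + 2 * delta)%N.
  apply: contrapT => N; have N1 : ~ (len (x * y)%g <= maxn (len x) (len y) + 2 * delta)%N.
    by move=> h; apply: N; left.
  have N2 : ~ (len (y * x)%g <= maxn (len x) (len y) + 2 * delta)%N.
    by move=> h; apply: N; right.
  have D2 := tri 1 x (x * y); have D3 := tri 1 (x * y) (x * y * x).
  have D4 := tri 1 (x * y * x) (x * y * x * y).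
  have E1 : D x (x * y) = len y by rewrite /dist mulKg.
  have E2 : D (x * y) (x * y * x) = len x by rewrite /dist mulKg.
  have E3 : D (x * y * x) (x * y * x * y) = len y by rewrite /dist mulKg.
  have E4 : D x (x * y * x) = len (y * x) by rewrite /dist -!mulgA mulKg.
  have E5 : D (x * y) (x * y * x * y) = len (x * y).
    by rewrite /dist -(mulgA (x * y)) mulKg.
  have E6 : len (x * y * x * y) = len ((x * y) ^+ 2) by rewrite expg2 mulgA.
  have NLxy := NL (x * y).
  rewrite !dist1 // E1 E2 E3 in D2 D3 D4.
  have h1 := hyp 1 (x * y) x (x * y * x); have h2 := hyp 1 (x * y * x) (x * y) (x * y * x * y).
  rewrite !dist1 // E2 E3 E4 E5 E6 ?(sC (x * y) x) ?(sC (x * y * x) (x * y)) E1 ?E2 in h1 h2.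
  by lia.
have ultra x y : (D x y <= maxn (len x) (len y) + 4 * delta)%N.
  have [h|h] := alt x^-1 y; first by apply: leq_trans h _; rewrite (lenV L); lia.
  rewrite len_mul_dist (lenV L) in h.
  have h1 := hyp 1 x^-1 y^-1 x; have h2 := hyp 1 y^-1 x y.
  have e := sC y^-1 x^-1; have NLx := NL x; have NLy := NL y.
  rewrite !expg2 !len_mul_dist in NLx NLy; rewrite !dist1 !(lenV L) in h1 h2.
  by lia.
have [g lg] := unb (10 * delta + 10)%N.
(* Cutting at [5 * delta + 5] makes both pieces shorter than [g] by more than the error [4 * delta]
   of [ultra]. *)
have [|z z1 zg] := @dist_geodesic _ _ L 1 g (5 * delta + 5); first by rewrite dist1; lia.
have := ultra (z^-1 * 1) (z^-1 * g); rewrite dist_mul dist1 // mulg1 (lenV L).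
by rewrite -/(D z g) zg -(dist1 _ z) z1 dist1 //; move: lg; lia.
Qed.

End Loxodromic.

Lemma uniq_pigeonhole (T : eqType) (u : nat -> T) (s : seq T) :
  (forall i, (i <= size s)%N -> u i \in s) ->
  exists i j, [/\ (i < j)%N, (j <= size s)%N & u i = u j].
Proof.
move=> us; have /uniqPn : ~~ uniq (mkseq u (size s).+1).
  apply/negP => U; suff /(uniq_leq_size U) : {subset mkseq u (size s).+1 <= s}.
    by rewrite size_mkseq ltnn.
  by move=> x /mapP[i]; rewrite mem_iota => /= i_s ->; apply: us.
by move=> /(_ (u 0%N))[i [j [ij]]]; rewrite size_mkseq => js; rewrite !nth_mkseq ?ltnS //;
  [exists i, j | lia].
Qed.

(** * Long overlaps of axes *)

Section Overlap.
Variables (G : groupType) (len : G -> nat) (L : length_function len) (delta : nat).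
Hypothesis hyp : hyperbolic len delta.
Hypothesis acyl : acylindrical len.
Local Notation D := (dist len).
Implicit Types (g h w x y z : G).

Let tri := dist_tri L.
Let sC := distC L.

Lemma quasi_additive_le c c' g : (c <= c')%N -> quasi_additive len c g ->
  quasi_additive len c' g.
Proof. by move=> cc' qa m n; have := qa m n; lia. Qed.

Lemma len_pow_le g n : (len (g ^+ n)%g <= n * len g)%N.
Proof.
elim: n => [|n IH]; first by rewrite expg0 (_ : len 1 = 0%N) //; apply/(len_eq1 L).
by rewrite expgS mulSn; apply: leq_trans (lenM L _ _) _; rewrite leq_add2l.
Qed.

Lemma loxodromic_pow_neq1 g n : loxodromic len g -> (0 < n)%N -> g ^+ n <> 1.
Proof.
move=> [_ /(_ 1%N)[n0 gr]] n_gt0 gn.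
have := gr (n * n0)%N (leq_pmull _ n_gt0).
by rewrite expgnA gn expg1n (_ : len 1 = 0%N) //; apply/(len_eq1 L).
Qed.

Lemma close_on_geodesic alpha w z x y :
  (D w x + D x z <= D w z + alpha)%N -> (D w y + D y z <= D w z + alpha)%N ->
  (D x y <= D w x - D w y + (D w y - D w x) + alpha + delta)%N.
Proof. by have := hyp w z x y; rewrite (sC x z) (sC y z); lia. Qed.

Lemma translate_dist g x y : D (g^-1 * x) y = D x (g * y).
Proof. by rewrite -(dist_mul _ g) mulVKg. Qed.

Lemma dist_pow g m n : (m <= n)%N -> D (g ^+ m) (g ^+ n) = len (g ^+ (n - m)).
Proof. by move=> mn; rewrite /dist -{1}(subnKC mn) expgnDr mulKg. Qed.

(** During the overlap, [h * g2 ^+ j] stays within [eps] of a power [g1 ^+ s j] of about the same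
    length. The discrepancies [k i] at the times [i * q] are short and all carry [g2 ^+ M] to nearly
    the same place, so acylindricity leaves at most [N] quotients of [k i] by [k 0] for [N + 1]
    times. A coincidence is the desired relation between powers. *)
Lemma overlap_commensurates g1 g2 : loxodromic len g1 -> loxodromic len g2 ->
  forall d, exists c2, forall h b b', (len h <= d)%N ->
    (D (g1 ^+ b) (h * g2 ^+ b') + c2 < len (g1 ^+ b)%g + len (h * g2 ^+ b')%g)%N ->
    exists n m, [/\ (0 < n)%N, (0 < m)%N & h * g2 ^+ n * h^-1 = g1 ^+ m].
Proof.
move=> lox1 lox2 d; have [[c1 qa1] gr1] := lox1; have [[c1' qa2] gr2] := lox2.
set c := maxn c1 c1'.
have {}qa1 : quasi_additive len c g1 by apply: quasi_additive_le qa1; rewrite /c; lia.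
have {}qa2 : quasi_additive len c g2 by apply: quasi_additive_le qa2; rewrite /c; lia.
pose alpha := (c + 2 * d + delta)%N; pose eps := (len g1 + alpha + delta)%N.
pose eps' := (6 * eps + c)%N; have [R [N acylP]] := acyl eps'.
(* [g2 ^+ q] outweighs the errors, so [s] is monotone along multiples of [q]; [g2 ^+ M] is long
   enough for acylindricity; [c2] makes the overlap cover all [j <= J]. *)
have [q0 q0P] := gr2 (2 * d + c)%N; pose q := q0.+1.
have qP : (2 * d + c <= len (g2 ^+ q)%g)%N by apply: q0P; rewrite /q.
have [M MP] := gr2 (maxn R (2 * d + c))%N; have {}MP := MP M (leqnn M).
pose J := (N * q + M)%N; exists (2 * (d + J * len g2))%N => h b b' hd big.
pose x j := h * g2 ^+ j.
have lx j : (len (x j) <= d + j * len g2)%N.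
  by apply: leq_trans (lenM L _ _) _; apply: leq_add hd (len_pow_le _ _).
have Dh j : D h (x j) = len (g2 ^+ j) by rewrite /dist /x mulKg.
have Dx j k : D (x j) (x (j + k)%N) = len (g2 ^+ k) by rewrite /x dist_mul /dist expgnDr mulKg.
have Jb' j : (j <= J)%N -> (j <= b')%N.
  move=> jJ; rewrite leqNgt; apply/negP => b'j.
  have h1 := lx b'; have h2 : (b' * len g2 <= J * len g2)%N.
    by rewrite leq_mul2r; apply/orP; right; lia.
  have := tri 1 (x b') (g1 ^+ b); rewrite !dist1 (sC (x b')).
  by move: big; rewrite -/(x b'); lia.
have short j : (j <= J)%N -> (len (x j) <= d + J * len g2)%N.
  by move=> jJ; apply: leq_trans (lx j) _; rewrite leq_add2l leq_mul2r jJ orbT.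
have on1 j : (j <= J)%N -> (D 1 (x j) + D (x j) (g1 ^+ b) <= D 1 (g1 ^+ b) + alpha)%N.
  move=> jJ; have := short j jJ; have := Dh j; have := Dh b'.
  have := qa2 j (b' - j)%N; have := Dx j (b' - j)%N; rewrite subnKC ?Jb' //.
  have := tri h 1 (x b'); have := tri 1 h (x j).
  have := hyp 1 (x b') (x j) (g1 ^+ b); have : (D h 1 <= d)%N by rewrite sC dist1.
  have : (D 1 h <= d)%N by rewrite dist1.
  rewrite !dist1 -/(x b') in big *; rewrite (sC (x b') (x j)) (sC (x b') (g1 ^+ b)) /alpha.
  by lia.
have ex_s j : exists s, (len (x j) <= len (g1 ^+ s)%g)%N.
  by have [n0 n0P] := gr1 (len (x j)); exists n0; apply: n0P.
pose s j := ex_minn (ex_s j).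
have sP j : (len (x j) <= len (g1 ^+ s j)%g)%N by rewrite /s; case: ex_minnP.
have s_min j k : (len (x j) <= len (g1 ^+ k)%g)%N -> (s j <= k)%N.
  by rewrite /s; case: ex_minnP => t _; apply.
have s_le j : (len (g1 ^+ s j)%g <= len (x j) + len g1)%N.
  case: (posnP (s j)) => [->|s0]; first by rewrite expg0 (_ : len 1 = 0%N) //;
    apply/(len_eq1 L).
  have : ~ (len (x j) <= len (g1 ^+ (s j).-1)%g)%N by move=> /s_min; lia.
  have : (len (g1 ^+ s j)%g <= len (g1 ^+ (s j).-1)%g + len g1)%N.
    by rewrite -{1}(prednK s0) expgSr; apply: lenM L _ _.
  by lia.
have s_b j : (j <= J)%N -> (s j <= b)%N.
  move=> jJ; apply: s_min; have := short j jJ; have := tri 1 (g1 ^+ b) (x b').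
  by rewrite !dist1; move: big; rewrite -/(x b'); lia.
have close j : (j <= J)%N -> (D (x j) (g1 ^+ s j) <= eps)%N.
  move=> jJ; have on2 : (D 1 (g1 ^+ s j) + D (g1 ^+ s j) (g1 ^+ b) <= D 1 (g1 ^+ b) + alpha)%N.
    have := qa1 (s j) (b - s j)%N; rewrite subnKC ?s_b // !dist1 dist_pow ?s_b //.
    by rewrite /alpha; lia.
  have := close_on_geodesic (on1 j jJ) on2; rewrite !dist1 /eps.
  by have := sP j; have := s_le j; lia.
have mono j k : (2 * d + c <= len (g2 ^+ k)%g)%N -> (s j <= s (j + k))%N.
  move=> kP; apply: s_min; apply: leq_trans (sP _).
  have := qa2 j k; have := Dh j; have := Dh (j + k)%N.
  have := tri h 1 (x (j + k)%N); have := tri 1 h (x j).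
  have : (D h 1 <= d)%N by rewrite sC dist1.
  have : (D 1 h <= d)%N by rewrite dist1.
  by rewrite !dist1; lia.
have iJ i : (i <= N)%N -> (i * q + M <= J)%N by move=> iN;
  rewrite /J leq_add2r leq_mul2r iN orbT.
have iJ' i : (i <= N)%N -> (i * q <= J)%N by move=> /iJ; lia.
pose k i := (g1 ^+ s (i * q)%N)^-1 * x (i * q)%N.
pose t i := (s (i * q + M) - s (i * q))%N.
have k_len i : (i <= N)%N -> (D 1 (k i) <= eps)%N.
  by move=> iN; rewrite sC translate_dist mulg1; apply/close/iJ'.
have k_M i : (i <= N)%N -> (D (k i * g2 ^+ M) (g1 ^+ t i) <= eps)%N.
  move=> iN; rewrite /k -mulgA translate_dist -expgnDr subnKC; last by apply: mono; lia.
  by rewrite /x -mulgA -expgnDr; apply/close/iJ.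
have t_len i : (i <= N)%N ->
    (len (g1 ^+ t i)%g <= len (g2 ^+ M)%g + 2 * eps)%N /\
    (len (g2 ^+ M)%g <= len (g1 ^+ t i)%g + 2 * eps)%N.
  move=> iN; have h1 := k_len i iN; have h2 := k_M i iN.
  have E : D (k i) (k i * g2 ^+ M) = len (g2 ^+ M) by rewrite /dist mulKg.
  have := tri 1 (k i) (k i * g2 ^+ M); have := tri 1 (k i * g2 ^+ M) (g1 ^+ t i).
  have := tri (k i) 1 (g1 ^+ t i); have := tri (k i) (g1 ^+ t i) (k i * g2 ^+ M).
  have := sC (k i) 1; have := sC (g1 ^+ t i) (k i * g2 ^+ M).
  by rewrite E; have := dist1 len (g1 ^+ t i); lia.
have t_close i j : (i <= N)%N -> (j <= N)%N -> (D (g1 ^+ t i) (g1 ^+ t j) <= 4 * eps + c)%N.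
  move=> iN jN; wlog tij : i j iN jN / (t i <= t j)%N.
    move=> W; have [|] := leqP (t i) (t j); first exact: W.
    by move=> /ltnW; rewrite sC; apply: W.
  have := qa1 (t i) (t j - t i)%N; rewrite subnKC //.
  by rewrite dist_pow //; have [a1 a2] := t_len i iN; have [a3 a4] := t_len j jN; lia.
have [] := acylP (g2 ^+ M); first by apply: leq_trans MP; apply: leq_maxl.
move=> l [lN lP].
have ul i : (i <= size l)%N -> (k 0%N)^-1 * k i \in l.
  move=> il; have iN : (i <= N)%N by lia.
  apply: lP.
    rewrite -/(dist len (k 0%N) (k i)); have := tri (k 0%N) 1 (k i); have := k_len i iN.
    by have := k_len 0%N (leq0n _); rewrite (sC (k 0%N) 1) /eps'; lia.
  rewrite sC -mulgA translate_dist.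
  have h1 := k_M i iN; have h2 := k_M 0%N (leq0n _); have h3 := t_close i 0%N iN (leq0n _).
  rewrite sC in h2; apply: leq_trans (tri _ (g1 ^+ t i) _) _.
  apply: leq_trans (leq_add h1 (leq_trans (tri _ _ _) (leq_add h3 h2))) _.
  by rewrite /eps'; lia.
have [i [j [ij jl /mulgI kij]]] := uniq_pigeonhole ul.
have sij : (s (i * q) <= s (j * q))%N.
  have -> : (j * q)%N = (i * q + (j - i) * q)%N by rewrite -mulnDl subnKC // ltnW.
  by apply/mono/q0P; rewrite /q -[q0]mul1n; apply: leq_mul; lia.
exists ((j - i) * q)%N, (s (j * q) - s (i * q))%N; split.
- by rewrite muln_gt0 subn_gt0 ij.
- rewrite subn_gt0 ltn_neqAle sij andbT; apply/negP => /eqP sE.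
  have := loxodromic_pow_neq1 (n := ((j - i) * q)%N) lox2 _; rewrite muln_gt0 subn_gt0 ij.
  move=> /(_ isT); apply; apply: (@mulgI _ (x (i * q)%N)); rewrite mulg1.
  rewrite {1}/x -mulgA -expgnDr -mulnDl subnKC; last exact: ltnW.
  by move: kij; rewrite /k sE => /mulgI ->.
- have xE : x (j * q)%N = g1 ^+ (s (j * q) - s (i * q))%N * x (i * q)%N.
    have -> : x (j * q)%N = g1 ^+ s (j * q)%N * k j by rewrite /k mulVKg.
    rewrite -kij /k mulgA; congr (_ * _); rewrite -{1}(subnK sij) expgnDr.
    by rewrite mulgK.
  have E : (j * q)%N = ((j - i) * q + i * q)%N by rewrite -mulnDl subnK // ltnW.
  apply: (@mulIg _ (x (i * q)%N)); rewrite -xE {1}E /x -!mulgA mulKg.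
  by rewrite -expgnDr.
Qed.

End Overlap.

(** * Commensurators *)

Section Commensurator.
Variables (G : groupType) (len : G -> nat) (L : length_function len) (delta : nat).
Hypothesis hyp : hyperbolic len delta.
Hypothesis acyl : acylindrical len.
Local Notation D := (dist len).
Implicit Types (g h w x y z : G).

Let tri := dist_tri L.
Let sC := distC L.

Definition commensurates g h : Prop :=
  exists (n : nat) (m : int), (0 < n)%N /\ h * g ^+ n * h^-1 = zpow g m.

Lemma loxodromicV g : loxodromic len g -> loxodromic len g^-1.
Proof.
move=> [[c qa] gr]; split; last by move=> k; have [n0 P] := gr k; exists n0 => n;
  rewrite expVgn (lenV L); apply: P.
by exists c => m n; rewrite !expVgn !(lenV L).
Qed.

Lemma commensurates_int g h (i j : int) : i != 0%R ->
  h * zpow g i * h^-1 = zpow g j -> commensurates g h.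
Proof.
case: i => [n|n] i0 E.
  by exists n, j; split=> //; move: i0; case: n {E}.
exists n.+1, (- j)%R; split=> //.
by rewrite zpowN -E /= !invgM !invgK mulgA.
Qed.

Lemma commensurates1 g : commensurates g 1.
Proof. by exists 1%N, 1%R; split=> //; rewrite mul1g divg1. Qed.

Lemma commensuratesM g h h' : commensurates g h -> commensurates g h' ->
  commensurates g (h * h').
Proof.
move=> [n [m [n0 E]]] [n' [m' [n0' E']]].
exists (n' * n)%N, (m * m')%R; split; first by rewrite muln_gt0 n0 n0'.
rewrite -zpow_nat PoszM zpowM invgM.
rewrite (_ : _ * (h'^-1 * h^-1) = h * (h' * zpow (zpow g n') n * h'^-1) * h^-1);
  last by rewrite !mulgA.
rewrite zpowJ (zpow_nat g n') E' -zpowM (GRing.mulrC m') (zpowM g n) zpowJ (zpow_nat g n) E.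
by rewrite -zpowM.
Qed.

Lemma commensuratesV g h : loxodromic len g -> commensurates g h -> commensurates g h^-1.
Proof.
move=> lox [n [m [n0 E]]]; apply: (@commensurates_int g _ m n).
  apply/eqP => m0; move: E; rewrite m0 /= => E.
  apply: (loxodromic_pow_neq1 L lox n0); apply: (@mulgI _ h); apply: (@mulIg _ h^-1).
  by rewrite E mulg1 mulgV.
by rewrite -E invgK !mulgA mulVg mul1g mulgVK.
Qed.

Lemma commensurates_zpow g i : commensurates g (zpow g i).
Proof.
exists 1%N, 1%R; split=> //; rewrite -[g ^+ 1]/(zpow g 1) -zpowD GRing.addrC zpowD.
by rewrite mulgK.
Qed.

(** Conjugation by [h] changes the length of every power by at most [2 * len h], whereas
    quasi-additivity drives the lengths of [g ^+ (n * t)] and [g ^+ (|m| * t)] apart as [t] grows,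
    unless [n] and [|m|] agree. *)
Lemma commensurates_abs g h n m : loxodromic len g -> (0 < n)%N ->
  h * g ^+ n * h^-1 = zpow g m -> `|m|%N = n.
Proof.
move=> lox n0 E; have [[c qa] gr] := lox; set d := len h.
have near t : (len (g ^+ (`|m| * t))%g <= len (g ^+ (n * t))%g + 2 * d)%N /\
              (len (g ^+ (n * t))%g <= len (g ^+ (`|m| * t))%g + 2 * d)%N.
  have E' : h * g ^+ (n * t) * h^-1 = zpow g (m * t)%R.
    by rewrite zpowM -E -zpowJ -zpow_nat PoszM zpowM zpow_nat.
  have lE : len (zpow g (m * t)%R) = len (g ^+ (`|m| * t)).
    by rewrite len_zpow // abszM.
  split.
    rewrite -lE -E'; apply: leq_trans (lenM L _ _) _; rewrite (lenV L).
    by rewrite mul2n -addnn addnA leq_add2r addnC; apply: lenM L _ _.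
  have -> : g ^+ (n * t) = h^-1 * zpow g (m * t)%R * h.
    by rewrite -E' !mulgA mulVg mul1g mulgVK.
  apply: leq_trans (lenM L _ _) _; rewrite mul2n -addnn addnA leq_add2r.
  by apply: leq_trans (lenM L _ _) _; rewrite (lenV L) lE addnC.
have [mn|nm|//] := ltngtP `|m|%N n; exfalso.
  have [t0 tP] := gr (2 * d + c + 1)%N; have [a1 a2] := near t0.
  have := qa (`|m| * t0)%N ((n - `|m|) * t0)%N; rewrite -mulnDl subnKC; last exact: ltnW.
  have := tP ((n - `|m|) * t0)%N; rewrite leq_pmull ?subn_gt0 // => /(_ isT).
  by lia.
have [t0 tP] := gr (2 * d + c + 1)%N; have [a1 a2] := near t0.
have := qa (n * t0)%N ((`|m| - n) * t0)%N; rewrite -mulnDl subnKC; last exact: ltnW.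
have := tP ((`|m| - n) * t0)%N; rewrite leq_pmull ?subn_gt0 // => /(_ isT).
by lia.
Qed.

Lemma expVg_zpow g (n : nat) : g^-1 ^+ n = zpow g (- Posz n)%R.
Proof. by rewrite expVgn zpowN. Qed.

(** [overlap_commensurates] concerns natural exponents; the four constants treat the possible signs
    of [i] and [j]. *)
Lemma overlap_bound g : loxodromic len g -> forall d, exists c2, forall h i j,
  ~ commensurates g h -> (len h <= d)%N ->
  (len (zpow g i) + len (h * zpow g j)%g <= D (zpow g i) (h * zpow g j)%g + c2)%N.
Proof.
move=> lox d; have loxV := loxodromicV lox.
have [cpp pp] := overlap_commensurates L hyp acyl lox lox d.
have [cpm pm] := overlap_commensurates L hyp acyl lox loxV d.
have [cmp mp] := overlap_commensurates L hyp acyl loxV lox d.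
have [cmm mm] := overlap_commensurates L hyp acyl loxV loxV d.
exists (cpp + cpm + cmp + cmm)%N => h i j Nc hd; rewrite leqNgt; apply/negP => big.
apply: Nc; have zE (k : int) : zpow g k = g ^+ `|k| \/ zpow g k = g^-1 ^+ `|k|.
  by case: k => k; [left | right; rewrite expVgn].
have [iE|iE] := zE i; have [jE|jE] := zE j; rewrite iE jE in big.
- have [|n [m [n0 m0 E]]] := pp h `|i|%N `|j|%N hd; first by apply: leq_ltn_trans big;
  rewrite leq_add2l; lia.
  by exists n, m.
- have [|n [m [n0 m0 E]]] := pm h `|i|%N `|j|%N hd; first by apply: leq_ltn_trans big;
  rewrite leq_add2l; lia.
  by apply: (@commensurates_int g h (- Posz n)%R m); [lia | rewrite -expVg_zpow].
- have [|n [m [n0 m0 E]]] := mp h `|i|%N `|j|%N hd; first by apply: leq_ltn_trans big;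
  rewrite leq_add2l; lia.
  by exists n, (- Posz m)%R; split=> //; rewrite -expVg_zpow.
- have [|n [m [n0 m0 E]]] := mm h `|i|%N `|j|%N hd; first by apply: leq_ltn_trans big;
  rewrite leq_add2l; lia.
  apply: (@commensurates_int g h (- Posz n)%R (- Posz m)%R); first by lia.
  by rewrite -!expVg_zpow.
Qed.

End Commensurator.

(** * The commensurator as finitely many cosets of the cyclic subgroup *)

Section Cosets.
Variables (G : groupType) (len : G -> nat) (L : length_function len) (delta : nat).
Hypothesis hyp : hyperbolic len delta.
Hypothesis acyl : acylindrical len.
Local Notation D := (dist len).
Implicit Types (g h w x y z k : G).

Let tri := dist_tri L.
Let sC := distC L.

Lemma dist_mulr x y : D (x * y) x = len y.
Proof. by rewrite sC /dist mulKg. Qed.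

Definition sign (e : int) : Prop := e = 1%R \/ e = (-1)%R.

Lemma abs_sign e i : sign e -> `|(e * i)%R|%N = `|i|%N.
Proof. by case=> ->; lia. Qed.

(** [e] tells whether [h] preserves or reverses the direction of the axis. *)
Definition intertwines g (e : int) h (n : nat) : Prop :=
  forall t : int, h * zpow g (Posz n * t)%R = zpow g (e * (Posz n * t))%R * h.

Lemma commensurates_intertwines g h : loxodromic len g -> commensurates g h ->
  exists e n, [/\ sign e, (0 < n)%N & intertwines g e h n].
Proof.
move=> lox [n [m [n0 E]]]; have mn := commensurates_abs L lox n0 E.
have [e se me] : exists2 e, sign e & m = (e * Posz n)%R.
  by case: m mn {E} => m mn; [exists 1%R | exists (-1)%R]; rewrite /sign; (by auto) || lia.
exists e, n; split=> // t; apply: (@mulIg _ h^-1); rewrite mulgK.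
by rewrite zpowM zpowJ zpow_nat E -zpowM me GRing.mulrA.
Qed.

Lemma intertwines_zpow g e h n i : intertwines g e h n -> intertwines g e (zpow g i * h) n.
Proof.
move=> fl t; rewrite -mulgA fl !mulgA; congr (_ * _).
by rewrite -!zpowD GRing.addrC.
Qed.

Section Ray.
Variables (g : G) (c : nat).
Hypothesis qa : quasi_additive len c g.

Lemma zpow_between e (i j : nat) : sign e -> (i <= j)%N ->
  (D 1 (zpow g (e * i)%R) + D (zpow g (e * i)%R) (zpow g (e * j)%R)
     <= D 1 (zpow g (e * j)%R) + c)%N.
Proof.
move=> se ij; rewrite !dist1 (dist_zpow L) !(len_zpow L) !abs_sign // !absz_nat.
have -> : `|(e * i - e * j)%R|%N = (j - i)%N by case: se => ->; lia.
by have := qa i (j - i)%N; rewrite subnKC.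
Qed.

Lemma zpow_at_length (n T : nat) : (n <= len (g ^+ T)%g)%N ->
  exists j, [/\ (j <= T)%N, (n <= len (g ^+ j)%g)%N & (len (g ^+ j)%g <= n + len g)%N].
Proof.
move=> nT; have ex : exists j, (n <= len (g ^+ j)%g)%N by exists T.
exists (ex_minn ex); case: ex_minnP => j nj jmin; split=> //; first exact: jmin.
case: (posnP j) => [->|j0]; first by rewrite expg0 (_ : len 1 = 0%N) //; apply/(len_eq1 L).
have Nj : ~ (n <= len (g ^+ j.-1)%g)%N by move=> /jmin; lia.
have : (len (g ^+ j)%g <= len (g ^+ j.-1)%g + len g)%N.
  by rewrite -{1}(prednK j0) expgSr; apply: lenM L _ _.
by lia.
Qed.

(** The points [h * zpow g (Posz T)] and [h * zpow g (- Posz T)] lie within [len h] of powers of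
    [g], and [h] is between them up to [c]. For [T] huge compared with [len h] these errors at the
    far ends do not reach [h], so the bound depends neither on [h] nor on [n]. *)
Lemma near_axis h e n : loxodromic len g -> sign e -> (0 < n)%N -> intertwines g e h n ->
  exists i, (D h (zpow g i) <= len g + c + 4 * delta)%N.
Proof.
move=> [_ gr] se n0 fl; set d := len h.
have [t0 t0P] := gr (10 * (d + c + delta + 1))%N.
pose T := (n * t0)%N; have lT : (10 * (d + c + delta + 1) <= len (g ^+ T)%g)%N.
  by apply: t0P; rewrite leq_pmull.
set l := len (g ^+ T) in lT.
pose A := h * zpow g (- Posz T)%R; pose B := h * zpow g (Posz T).
pose P := zpow g (e * - Posz T)%R; pose Q := zpow g (e * Posz T)%R.
have AE : A = P * h by have := fl (- Posz t0)%R;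
  rewrite (_ : (Posz n * - Posz t0)%R = (- Posz T)%R) //; rewrite /T; lia.
have BE : B = Q * h by have := fl (Posz t0);
  rewrite (_ : (Posz n * Posz t0)%R = (Posz T)%R) //; rewrite /T; lia.
have AP : D A P = d by rewrite AE dist_mulr.
have BQ : D B Q = d by rewrite BE dist_mulr.
have hA : D h A = l by rewrite sC dist_mulr (len_zpow L) abszN.
have hB : D h B = l by rewrite sC dist_mulr len_zpow.
have AB : (l + l <= D A B + c)%N.
  rewrite /A /B dist_mul (dist_zpow L).
  have -> : `|(- Posz T - Posz T)%R|%N = (T + T)%N by lia.
  exact: qa.
have P1 : D 1 P = l by rewrite dist1 /P (len_zpow L) abs_sign // abszN.
have Q1 : D 1 Q = l by rewrite dist1 /Q (len_zpow L) abs_sign.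
have hd : D 1 h = d by rewrite dist1.
have PQ : (D h P + D h Q <= D P Q + c + 2 * delta)%N.
  have h1 := hyp h P A B; have h2 := hyp h Q B P.
  have t1 := tri h P A; have t2 := tri h Q B; have t3 := tri h A P; have t4 := tri h B Q.
  rewrite (sC P A) (sC Q B) AP BQ in h1 h2 t1 t2; rewrite AP BQ in t3 t4.
  by rewrite (sC B P) (sC Q P) in h2; lia.
have [Z [s [ss ZE hZ]]] : exists Z s, [/\ sign s, Z = zpow g (s * Posz T)%R &
    (D 1 h + D h Z <= D 1 Z + (c + 3 * delta))%N].
  have := hyp 1 h P Q => -[h1|h1].
    exists P, (- e)%R; split; last by lia.
    - by case: se => ->; rewrite /sign ?GRing.opprK; auto.
    - by rewrite /P GRing.mulrN GRing.mulNr.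
  by exists Q, e; split=> //; lia.
have [|j [jT jd jg]] := @zpow_at_length d T; first by rewrite -/l; lia.
exists (s * Posz j)%R; have Z1 := zpow_between ss jT; rewrite -ZE in Z1.
have Z2 : (D 1 (zpow g (s * Posz j)%R) + D (zpow g (s * Posz j)%R) Z <= D 1 Z + (c + 3 * delta))%N.
  by lia.
have := close_on_geodesic L hyp hZ Z2; rewrite hd dist1 (len_zpow L) abs_sign // absz_nat.
by lia.
Qed.

(** [k] carries the far power [g ^+ (n * M)] to within [eps] of a power of [g]; both points of the
    conclusion are then close to the same geodesic at similar distances from 1, whence a bound free
    of [M]. *)
Lemma forward_image eps k e n M : sign e -> (0 < n)%N -> intertwines g e k n ->
  (len k <= eps)%N ->
  (D (k * g ^+ M)%g (zpow g (e * Posz M)%R) <= 3 * eps + c + delta)%N.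
Proof.
move=> se n0 fl keps; pose T := (n * M)%N; have MT : (M <= T)%N by rewrite leq_pmull.
set Y := zpow g (e * Posz T)%R; have kT : k * g ^+ T = Y * k by have := fl (Posz M);
  rewrite -PoszM.
have Z1 := zpow_between se MT; rewrite -/Y in Z1.
have Z2 : (D 1 (k * g ^+ M) + D (k * g ^+ M) Y <= D 1 Y + (c + 2 * eps))%N.
  have t1 := tri 1 k (k * g ^+ M); have t2 := tri (k * g ^+ M) (k * g ^+ T) Y.
  have E1 : D k (k * g ^+ M) = len (g ^+ M) by rewrite sC dist_mulr.
  have E2 : D (k * g ^+ M) (k * g ^+ T) = len (g ^+ (T - M)) by rewrite dist_mul dist_pow.
  have E3 : D (k * g ^+ T) Y = len k by rewrite kT dist_mulr.
  rewrite E1 (dist1 len k) in t1; rewrite E2 E3 in t2.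
  have := qa M (T - M)%N; rewrite subnKC // => q1.
  have -> : D 1 Y = len (g ^+ T) by rewrite dist1 /Y (len_zpow L) abs_sign.
  apply: leq_trans (leq_add t1 t2) _; lia.
have Z1' : (D 1 (zpow g (e * Posz M)%R) + D (zpow g (e * Posz M)%R) Y <= D 1 Y + (c + 2 * eps))%N by lia.
apply: leq_trans (close_on_geodesic L hyp Z2 Z1') _.
have E : len (zpow g (e * Posz M)%R) = len (g ^+ M) by rewrite (len_zpow L) abs_sign.
rewrite !dist1 E; have t1 := lenM L k (g ^+ M).
have t2 := tri k 1 (k * g ^+ M); rewrite (sC k 1) !dist1 sC dist_mulr in t2.
have : (len (k * g ^+ M)%g <= eps + len (g ^+ M)%g)%N by apply: leq_trans t1 _; lia.
by lia.
Qed.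

End Ray.

(** By [near_axis], representatives of length at most [eps0] suffice. Two of them with the same sign
    carry [g ^+ M] close to the same power, so acylindricity leaves finitely many quotients;
    opposite signs lead to opposite ends of the axis and are treated apart. *)
Theorem commensurator_cosets g : loxodromic len g -> exists s : seq G,
  forall h, commensurates g h -> exists i k, k \in s /\ h = zpow g i * k.
Proof.
move=> lox; have [[c qa] gr] := lox; pose eps0 := (len g + c + 4 * delta)%N.
pose eps1 := (3 * eps0 + c + delta)%N.
have [R [N acylP]] := acyl (2 * eps1)%N; have [M /(_ M (leqnn M)) MR] := gr R.
have [l [_ lP]] := acylP _ MR.
pose C e k := (len k <= eps0)%N /\ exists2 n, (0 < n)%N & intertwines g e k n.
have finC e : sign e -> exists s : seq G, forall k, C e k -> k \in s.
  move=> se; have [[k0 [l0 [n0 n0_gt0 f0]]]|N0] := pselect (exists k, C e k); last first.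
    by exists [::] => k Ck; case: N0; exists k.
  exists [seq k0 * x | x <- l] => k [lk [n n_gt0 fk]]; apply/mapP; exists (k0^-1 * k);
    last by rewrite mulVKg.
  have F0 := forward_image qa M se n0_gt0 f0 l0; have F := forward_image qa M se n_gt0 fk lk.
  apply: lP.
    apply: leq_trans (lenM L _ _) _; rewrite (lenV L).
    by apply: leq_trans (leq_add l0 lk) _; rewrite /eps1; lia.
  rewrite sC -mulgA translate_dist //; rewrite sC in F0.
  apply: leq_trans (tri _ _ _) _; apply: leq_trans (leq_add F F0) _.
  by rewrite mul2n -addnn.
have [s1 P1] := finC 1%R (or_introl erefl); have [s2 P2] := finC (-1)%R (or_intror erefl).
exists (s1 ++ s2) => h /(commensurates_intertwines lox)[e [n [se n0 fl]]].
have [i hi] := near_axis qa lox se n0 fl.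
exists i, (zpow g (- i)%R * h); split; last by rewrite mulgA -zpowD GRing.addrN mul1g.
have Ck : C e (zpow g (- i)%R * h).
  split; last by exists n => //; apply: intertwines_zpow.
  by rewrite zpowN; move: hi; rewrite sC.
rewrite mem_cat; apply/orP; case: se Ck => -> Ck; [left; exact: P1 | right; exact: P2].
Qed.

End Cosets.

(** * Conjugating out of the commensurator *)

Section Core.
Variables (G : groupType) (len : G -> nat) (L : length_function len) (delta : nat).
Hypothesis hyp : hyperbolic len delta.
Hypothesis acyl : acylindrical len.
Hypothesis non_elementary : ~ elementary G.
Hypothesis no_finite_normal : forall N : subgroup G,
  normal_subgroup N -> finite_set N -> N `<=` [set 1].
Implicit Types (g h f : G).

Lemma gen1P g x : subgroup_set (gen [set g]) x <-> exists i, x = zpow g i.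
Proof.
split=> [|[i ->] H /(_ g erefl) Hg].
  have SC : group_closed [in [set x | exists i, x = zpow g i]].
    split=> [|a b]; rewrite !inE; first by exists 0%R.
    by move=> [i ->] [j ->]; exists (i - j)%R; rewrite zpowD zpowN.
  by apply: (_ : gen_set [set g] x -> _) => /(_ (Subgroup SC)); apply=> _ ->; exists 1%R.
elim/int_rect: i => [|n IH|n IH]; first exact: subgroup1.
  rewrite (_ : Posz n.+1 = Posz n + 1)%R; last by lia.
  rewrite zpowS -[g in _ * g]invgK; apply: subgroup_div IH _.
  by have := subgroup_div (subgroup1 H) Hg; rewrite div1g.
rewrite (_ : - Posz n.+1 = - Posz n - 1)%R; last by lia.
by rewrite zpowB1; apply: subgroup_div IH Hg.
Qed.

Lemma not_commensurates_exists g : loxodromic len g -> exists a, ~ commensurates g a.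
Proof.
move=> lox; apply: contrapT => N; have all h : commensurates g h.
  by apply: contrapT => Nh; apply: N; exists h.
apply: non_elementary; exists (gen [set g]); split; first by exists g.
have [s sP] := commensurator_cosets L hyp acyl lox.
apply: (@sub_finite_set _ _ ((fun k => [set k^-1 * h | h in gen [set g]]) @` [set` s]));
  last first.
  exact/finite_image/finite_seq.
(* [finite_index] is about left cosets while [sP] puts the power of [g] on the left, hence the
   passage to [x^-1]. *)
move=> _ [x _ <-]; have [i [k [ks xE]]] := sP x^-1 (all _); exists k => //.
have {}xE : x = k^-1 * zpow g (- i)%R by rewrite -[x]invgK xE invgM zpowN.
apply/seteqP; split=> _ /= [h /gen1P[j ->] <-].
  by exists (zpow g (i + j)%R); [apply/gen1P;
    exists (i + j)%R | rewrite xE -mulgA -zpowD GRing.addKr].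
by exists (zpow g (- i + j)%R); [apply/gen1P; exists (- i + j)%R | rewrite xE zpowD mulgA].
Qed.

Lemma commensurates_power g z : loxodromic len g -> commensurates g z ->
  exists (q : nat) (j : int), (0 < q)%N /\ z ^+ q = zpow g j.
Proof.
move=> lox gz; have [s sP] := commensurator_cosets L hyp acyl lox.
have zc n : commensurates g (z ^+ n).
  elim: n => [|n IH]; first exact: commensurates1.
  by rewrite expgS; apply: commensuratesM IH.
have /choice[j jP] : forall n, exists ik : int * G, ik.2 \in s /\ z ^+ n = zpow g ik.1 * ik.2.
  by move=> n; have [i' [k [ks E]]] := sP _ (zc n); exists (i', k).
have [p [q [pq _ E]]] := @uniq_pigeonhole _ (fun n => (j n).2) s (fun n _ => (jP n).1).
have [_ Ep] := jP p; have [_ Eq] := jP q.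
exists (q - p)%N, ((j q).1 - (j p).1)%R; rewrite subn_gt0; split=> //.
rewrite zpowD zpowN; apply: (@mulIg _ (z ^+ p)).
by rewrite -expgnDr subnK ?(ltnW pq) // Ep Eq E mulgA mulgVK.
Qed.

(** The core [K] contains no nontrivial power of [g]: the conjugate of such a power by [a] would
    commensurate [g], so one of its own powers would be a power of [g], and [a] itself would
    commensurate [g], for every [a]. Hence a coset representative determines an element of [K], and
    [K] is finite. *)
Lemma commensurator_core g f : loxodromic len g -> f <> 1 ->
  exists c, ~ commensurates g (c^-1 * f * c).
Proof.
move=> lox f1; apply: contrapT => Nc.
pose K : set G := [set x | forall c, commensurates g (c^-1 * x * c)].
have KC : group_closed [in K].
  split=> [|x y]; rewrite !inE.
    by move=> c; rewrite mulg1 mulVg; apply: commensurates1.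
  move=> Kx Ky c; rewrite (_ : _ * c = (c^-1 * x * c) * (c^-1 * y * c)^-1).
    by apply: commensuratesM => //; apply: (commensuratesV L lox).
  by rewrite !invgM invgK !mulgA mulgK.
have Kf : K f by move=> c; apply: contrapT => Nfc; apply: Nc; exists c.
have [s sP] := commensurator_cosets L hyp acyl lox.
have [a Na] := not_commensurates_exists lox.
have Kz i : K (zpow g i) -> i = 0%R.
  move=> Ki; apply/eqP; apply: contrapT => /negP i0; apply: Na.
  pose z := a^-1 * zpow g i * a.
  have zn n : zpow z n = a^-1 * zpow g (i * n)%R * a.
    by rewrite /z -{2}[a]invgK -zpowJ invgK -zpowM.
  have [q [j [q0 zE]]] := commensurates_power lox (Ki a : commensurates g z).
  have aV : commensurates g a^-1.
    apply: (@commensurates_int _ g a^-1 (i * Posz q)%R j).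
      by rewrite GRing.mulf_neq0 //; lia.
    by rewrite invgK -zn zpow_nat zE.
  by rewrite -[a]invgK; apply: (commensuratesV L lox).
have finK : finite_set K.
  apply: (@sub_finite_set _ _ ((fun k => xget 1 [set x | K x /\ exists i,
    x = zpow g i * k]) @` [set` s])); last first.
    exact/finite_image/finite_seq.
  move=> x Kx; have Kx1 := Kx 1; rewrite invg1 mul1g mulg1 in Kx1.
  have [i [k [ks xE]]] := sP x Kx1; exists k => //; apply: xget_subset1.
    by split=> //; exists i.
  move=> y z [Ky [i1 yE]] [Kz' [i2 zE]].
  have : K (y * z^-1) by have := KC.2 y z; rewrite !inE; apply.
  rewrite yE zE invgM mulgA mulgK -zpowN -zpowD => /Kz E.
  by have -> : i1 = i2 by lia.
apply: f1; apply: (no_finite_normal (N := Subgroup KC)) => //= x y Kx c.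
have := Kx (y * c); rewrite /conjg invgM !mulgA; exact.
Qed.

End Core.

(** * Combining a loxodromic element with a conjugate *)

Section Combination.
Variables (G : groupType) (len : G -> nat) (L : length_function len) (delta : nat).
Hypothesis hyp : hyperbolic len delta.
Hypothesis acyl : acylindrical len.
Local Notation D := (dist len).
Implicit Types (g h w x y z k f p : G).

Let tri := dist_tri L.
Let sC := distC L.

Section Word.
Variables (g c : G) (cg kc : nat).
Hypothesis qa : quasi_additive len cg g.
Hypothesis overlap_c : forall i j,
  (len (zpow g i) + len (c * zpow g j)%g <= D (zpow g i) (c * zpow g j)%g + kc)%N.
Variables n m : nat.
Let C := len c.
Let kappa := (kc + 2 * C)%N.
Hypothesis n_large : (kappa + 2 * delta < len (g ^+ n)%g)%N.
Hypothesis m_large : (kappa + 2 * delta + 2 * C < len (g ^+ m)%g)%N.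

Definition bent_word : G := g ^+ n * (c * g ^+ m * c^-1).
Local Notation w := bent_word.

Let corner (i : nat) : G := w ^+ i./2 * (if odd i then g ^+ n else 1).

Lemma cornerE i j : corner (2 * i + j) = w ^+ i * corner j.
Proof.
rewrite /corner oddD mul2n odd_double /= halfD odd_double /= add0n doubleK.
by rewrite expgnDr mulgA.
Qed.

Lemma len_conj (i : int) : (len (g ^+ `|i|)%g <= len (c * zpow g i * c^-1)%g + 2 * C)%N.
Proof.
have E : zpow g i = c^-1 * (c * zpow g i * c^-1) * c.
  by rewrite !mulgA mulVg mul1g mulgVK.
rewrite -(len_zpow L) {1}E; apply: leq_trans (lenM L _ _) _;
  rewrite mul2n -addnn addnA leq_add2r addnC.
by apply: leq_trans (lenM L _ _) _; rewrite (lenV L).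
Qed.

Lemma overlap_conj (i j : int) :
  (len (zpow g i) + len (c * zpow g j * c^-1)%g <= D (zpow g i) (c * zpow g j * c^-1)%g + kappa)%N.
Proof.
have E : D (c * zpow g j * c^-1) (c * zpow g j) = C by rewrite dist_mulr // (lenV L).
have t1 := tri (zpow g i) (c * zpow g j * c^-1) (c * zpow g j); rewrite E in t1.
have t2 : (len (c * zpow g j * c^-1)%g <= len (c * zpow g j)%g + C)%N.
  by apply: leq_trans (lenM L _ _) _; rewrite (lenV L).
apply: leq_trans (leq_add (leqnn _) t2) _; rewrite addnA.
apply: leq_trans (leq_add (overlap_c i j) (leqnn C)) _.
apply: leq_trans (leq_add (leq_add t1 (leqnn kc)) (leqnn C)) _.
by rewrite /kappa; lia.
Qed.

Lemma corner_chain : chain len delta kappa corner.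
Proof.
have evenE i : corner i.*2 = w ^+ i.
  by rewrite /corner odd_double doubleK mulg1.
have oddE i : corner i.*2.+1 = w ^+ i * g ^+ n.
  by rewrite /corner /= odd_double /= uphalf_double.
have wS i : w ^+ i.+1 = w ^+ i * g ^+ n * (c * g ^+ m * c^-1).
  by rewrite expgSr /bent_word mulgA.
have lconj := len_conj m; rewrite absz_nat /= in lconj.
move=> i; rewrite -(odd_double_half i); case: (odd i); rewrite ?add1n ?add0n.
- rewrite -doubleS !oddE evenE; move: (i./2) => {}i.
  have E1 : D (w ^+ i * g ^+ n) (w ^+ i.+1) = len (c * g ^+ m * c^-1).
    by rewrite sC wS sC /dist mulKg.
  have E2 : D (w ^+ i.+1) (w ^+ i.+1 * g ^+ n) = len (g ^+ n) by rewrite /dist mulKg.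
  have E3 : D (w ^+ i * g ^+ n) (w ^+ i.+1 * g ^+ n) = D (zpow g n) (c * zpow g (- Posz m)%R * c^-1).
    rewrite wS -(mulgA (w ^+ i * g ^+ n)) [RHS]sC /dist mulKg zpowN.
    by rewrite !invgM !invgK !mulgA.
  rewrite E1 E2 E3; split.
    by move: lconj m_large; lia.
  have := overlap_conj n (- Posz m)%R.
  have -> : len (c * zpow g (- Posz m)%R * c^-1) = len (c * g ^+ m * c^-1).
    by rewrite -(lenV L) !invgM zpowN !invgK mulgA.
  by rewrite addnC.
- rewrite -doubleS oddE !evenE; move: (i./2) => {}i.
  have E1 : D (w ^+ i) (w ^+ i * g ^+ n) = len (g ^+ n) by rewrite /dist mulKg.
  have E2 : D (w ^+ i * g ^+ n) (w ^+ i.+1) = len (c * g ^+ m * c^-1).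
    by rewrite wS /dist mulKg.
  have E3 : D (w ^+ i) (w ^+ i.+1) = D (zpow g (- Posz n)%R) (c * zpow g m * c^-1).
    by rewrite wS -mulgA /dist mulKg zpowN invgK.
  rewrite E1 E2 E3; split; first exact: n_large.
  have := overlap_conj (- Posz n)%R m.
  have -> : len (zpow g (- Posz n)%R) = len (g ^+ n) by rewrite (len_zpow L) abszN.
  by [].
Qed.

Lemma bent_word_loxodromic : loxodromic len w.
Proof.
have [] // := @loxodromic_chain _ _ L _ hyp _ _ w 2 corner_chain (mulg1 1) isT.
exact: cornerE.
Qed.

Lemma corner_even i : corner (2 * i) = w ^+ i.
Proof. by rewrite -[(2 * i)%N]addn0 cornerE /corner /= !mulg1. Qed.

Let kappa' := (kappa + 2 * delta)%N.

Lemma between_first t : (0 < t)%N ->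
  (D 1 (g ^+ n) + D (g ^+ n) (w ^+ t) <= D 1 (w ^+ t) + kappa')%N.
Proof.
move=> t0; have := @chain_between _ _ L _ hyp _ corner 1 (2 * t - 1) corner_chain.
rewrite subnKC ?muln_gt0 // corner_even (_ : corner 1 = g ^+ n);
  last by rewrite /corner /= mul1g.
by rewrite (_ : corner 0 = 1) ?addnA //; rewrite /corner /= mulg1.
Qed.

Lemma between_word t : (0 < t)%N ->
  (D 1 w + D w (w ^+ t) <= D 1 (w ^+ t) + kappa')%N.
Proof.
move=> t0; have := @chain_between _ _ L _ hyp _ corner (2 * 1) (2 * t.-1) corner_chain.
rewrite -mulnDr add1n prednK // !corner_even expg1.
by rewrite (_ : corner 0 = 1) ?addnA //; rewrite /corner /= mulg1.
Qed.

Lemma between_inverse t : (0 < t)%N ->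
  (D 1 (c * g ^- m * c^-1)%g + D (c * g ^- m * c^-1)%g (w ^- t) <= D 1 (w ^- t) + kappa')%N.
Proof.
move=> t0; have := @chain_between _ _ L _ hyp _ corner (2 * t.-1 + 1) 1 corner_chain.
have -> : (2 * t.-1 + 1 + 1 = 2 * t)%N by lia.
rewrite corner_even cornerE.
rewrite (_ : corner 0 = 1); last by rewrite /corner /= mulg1.
rewrite (_ : corner 1 = g ^+ n); last by rewrite /corner /= mul1g.
have -> : w ^+ t.-1 * g ^+ n = w ^+ t * (c * g ^- m * c^-1).
  rewrite -{2}(prednK t0) expgSr -mulgA; congr (_ * _).
  by rewrite /bent_word -!mulgA mulKg mulVKg mulgV mulg1.
set y := c * g ^- m * c^-1.
have -> : D 1 (w ^+ t * y) = D y (w ^- t) by rewrite -(translate_dist len) mulg1 sC.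
have -> : D (w ^+ t * y) (w ^+ t) = D 1 y by rewrite dist_mulr // dist1.
have -> : D 1 (w ^+ t) = D 1 (w ^- t) by rewrite !dist1 (lenV L).
by move: (D 1 y) (D y _) (D 1 _) => a b d; rewrite /kappa'; lia.
Qed.

Let kappa'' := (2 * kappa' + 4 * C + cg)%N.

Lemma len_pow_conj : (len (g ^+ m)%g <= D (g ^+ n) w + 2 * C)%N.
Proof. by have := len_conj m; rewrite absz_nat /dist mulKg. Qed.

(** These interior points of the conjugated segment of [w] will be compared with the points
    [c * g ^- (n + r)] of the first segment of the inverse, which are about equally far from 1. *)
Lemma between_bend t r : (0 < t)%N -> (r <= m)%N ->
  (D 1 (g ^+ n * (c * g ^+ r))%g + D (g ^+ n * (c * g ^+ r))%g (w ^+ t)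
    <= D 1 (w ^+ t) + kappa'')%N.
Proof.
move=> t0 rm; set P := g ^+ n * (c * g ^+ r).
have h1 := between_word t0.
have h2 := between_first (ltn0Sn 0); rewrite expg1 in h2.
have h3 := len_pow_conj; have h4 := qa r (m - r)%N; rewrite subnKC // in h4.
have t1 := tri 1 (g ^+ n) P; have t2 := tri P w (w ^+ t).
have E1 : (D (g ^+ n) P <= C + len (g ^+ r)%g)%N by rewrite /dist mulKg; apply: lenM.
have E2 : (D P w <= len (g ^+ (m - r))%g + C)%N.
  rewrite /P /bent_word dist_mul -mulgA dist_mul.
  have t3 := tri (g ^+ r) (g ^+ m) (g ^+ m * c^-1); apply: leq_trans t3 _.
  by rewrite dist_pow // leq_add2l sC dist_mulr // (lenV L).
by rewrite /kappa'' /kappa'; lia.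
Qed.

Lemma between_bend_inverse t r : (0 < t)%N -> (n + r <= m)%N ->
  (D 1 (c * g ^- (n + r))%g + D (c * g ^- (n + r))%g (w ^- t)
    <= D 1 (w ^- t) + kappa'')%N.
Proof.
move=> t0 rm; set Q := c * g ^- (n + r); have h1 := between_inverse t0.
set y := c * g ^- m * c^-1 in h1.
have h2 : (len (g ^+ m)%g <= D 1 y + 2 * C)%N.
  have := len_conj (- Posz m)%R; rewrite abszN absz_nat zpowN dist1; exact.
have h4 := qa (n + r) (m - (n + r))%N; rewrite subnKC // in h4.
have t1 := lenM L c (g ^- (n + r)); rewrite (lenV L) -/Q -(dist1 len) in t1.
have t2 := tri Q y (w ^- t).
have E2 : (D Q y <= len (g ^+ (m - (n + r)))%g + C)%N.
  rewrite /Q /y -mulgA dist_mul.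
  have t3 := tri (g ^- (n + r)) (g ^- m) (g ^- m * c^-1); apply: leq_trans t3 _.
  apply: leq_add; last by rewrite sC dist_mulr // (lenV L).
  rewrite -[g ^- m]/((zpow g m)^-1) -[g ^- (n + r)]/((zpow g (Posz (n + r)))^-1) -!zpowN.
  rewrite (dist_zpow L) (_ : `|_|%N = (m - (n + r))%N) //; lia.
by rewrite /kappa''; lia.
Qed.

Lemma len_bend r :
  (len (g ^+ n)%g + len (g ^+ r)%g <= len (g ^+ n * (c * g ^+ r))%g + C + kc)%N /\
  (len (g ^+ n * (c * g ^+ r))%g <= len (g ^+ n)%g + len (g ^+ r)%g + C)%N.
Proof.
split.
  have := overlap_c (- Posz n)%R r.
  have -> : D (zpow g (- Posz n)%R) (c * zpow g r) = len (g ^+ n * (c * g ^+ r)).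
    by rewrite /dist zpowN invgK.
  rewrite (len_zpow L) abszN absz_nat zpow_nat => h.
  have t1 : (len (g ^+ r)%g <= len (c * g ^+ r)%g + C)%N.
    rewrite -{1}(mulKg c (g ^+ r)) addnC; apply: leq_trans (lenM L _ _) _.
    by rewrite (lenV L).
  by lia.
apply: leq_trans (lenM L _ _) _; rewrite -addnA leq_add2l addnC.
exact: lenM.
Qed.

End Word.

Lemma moved_between f p Y Z alpha d : (len f <= d)%N -> (D (f * Y)%g Z <= d)%N ->
  D 1 Y = D 1 Z -> (D 1 p + D p Y <= D 1 Y + alpha)%N ->
  (D 1 (f * p)%g + D (f * p)%g Z <= D 1 Z + (alpha + 2 * d))%N.
Proof.
move=> fd fY YZ pY; have t1 := tri 1 f (f * p); have t2 := tri (f * p) (f * Y) Z.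
have E1 : D f (f * p) = D 1 p by rewrite /dist mulKg invg1 mul1g.
rewrite E1 (dist1 _ f) in t1; rewrite dist_mul in t2.
by apply: leq_trans (leq_add t1 t2) _; lia.
Qed.

Lemma moved_len f p d : (len f <= d)%N ->
  (len (f * p)%g <= len p + d)%N /\ (len p <= len (f * p)%g + d)%N.
Proof.
move=> fd; split; first by apply: leq_trans (lenM L _ _) _; rewrite addnC leq_add2l.
rewrite -{1}(mulKg f p); apply: leq_trans (lenM L _ _) _.
by rewrite (lenV L) addnC leq_add2l.
Qed.

End Combination.

(** * Shrinking the commensurator *)

Section Step.
Variables (G : groupType) (len : G -> nat) (L : length_function len) (delta : nat).
Hypothesis hyp : hyperbolic len delta.
Hypothesis acyl : acylindrical len.
Local Notation D := (dist len).
Implicit Types (g h w x y z k f p : G).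

Let tri := dist_tri L.
Let sC := distC L.

(** An element commensurating [w] commutes with some power of [w] or inverts it, and the latter is
    excluded by [backward]. Commuting makes [f] move [g ^+ n] little, so [f] commensurates [g]; for
    [f0], moving [w] little as well contradicts the choice of [c]. *)
Lemma bent_word_commensurator g c f0 d : loxodromic len g ->
  commensurates g f0 -> ~ commensurates g (c^-1 * f0 * c) -> (len f0 <= d)%N ->
  exists w, [/\ loxodromic len w,
    forall f, (len f <= d)%N -> commensurates w f -> commensurates g f &
    ~ commensurates w f0].
Proof.
move=> lox gf0 Ngf0 f0d; have [[cg qa] gr] := lox; set C := len c.
have Nc : ~ commensurates g c.
  move=> gc; apply: Ngf0; apply: commensuratesM => //.
  by apply: commensuratesM => //; apply: (commensuratesV L lox).
have ob := overlap_bound L hyp acyl lox.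
have [kc kcP] := ob C; pose overlap_c i j := kcP c i j Nc (leqnn _).
pose kappa := (kc + 2 * C)%N; pose kappa' := (kappa + 2 * delta)%N.
pose kappa'' := (2 * kappa' + 4 * C + cg)%N.
pose eta := (3 * d + kappa' + delta)%N.
pose eta' := (2 * C + kc + cg + d + (kappa'' + 2 * d) + delta)%N.
have [c1 O1] := ob d; have [c2 O2] := ob (d + 2 * C)%N.
have [c3 O3] := ob (d + C)%N; have [c4 O4] := ob eta'.
have [r /(_ r (leqnn r)) rP] := gr (2 * eta' + c4 + 1)%N.
have [e0 [n0 [se0 n0_gt0 fl0]]] := commensurates_intertwines L lox gf0.
have [N1 N1P] := gr (d + eta + c1 + kappa + 2 * delta + eta' + C + c3 + d + C + cg + 1)%N.
(* A multiple of [n0], so that [f0] commutes with [g ^+ n] or inverts it. *)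
pose n := (n0 * N1)%N; have {}N1P := N1P n (leq_pmull _ n0_gt0).
have [N2 N2P] := gr (d + eta + c2 + kappa + 2 * delta + 4 * C + 1)%N.
(* The summand [n + r] leaves the room inside the long segment that [between_bend_inverse]
   requires. *)
pose m := (n + r + N2)%N; have {}N2P := N2P m (leq_addl _ _).
have n_large : (kc + 2 * len c + 2 * delta < len (g ^+ n)%g)%N.
  by move: N1P; rewrite /kappa -/C; lia.
have m_large : (kc + 2 * len c + 2 * delta + 2 * len c < len (g ^+ m)%g)%N.
  by move: N2P; rewrite /kappa -/C; lia.
set w := bent_word g c n m.
have loxw : loxodromic len w := bent_word_loxodromic L hyp overlap_c n_large m_large.
have forward f t p : (len f <= d)%N -> f * w ^+ t = w ^+ t * f ->
    (D 1 p + D p (w ^+ t) <= D 1 (w ^+ t) + kappa')%N -> (D p (f * p)%g <= eta)%N.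
  move=> fd fw pw.
  have fY : (D (f * w ^+ t)%g (w ^+ t) <= d)%N by rewrite fw dist_mulr.
  have q := moved_between L fd fY erefl pw.
  have pw' : (D 1 p + D p (w ^+ t) <= D 1 (w ^+ t) + (kappa' + 2 * d))%N.
    by apply: leq_trans pw _; lia.
  apply: leq_trans (close_on_geodesic L hyp pw' q) _.
  by rewrite !dist1; have [a1 a2] := moved_len L p fd; rewrite /eta; lia.
(* A reversal would carry the corner of [w ^+ t] at [g ^+ n] into the interior of the straight first
   segment of [w ^- t]. The pieces before and after the corner then follow powers of [g], so
   [c^-1 * f] and [g ^+ n * c^-1 * f * g ^+ n * c] commensurate [g], and together they force [c] to
   do so. *)
have backward f t : (len f <= d)%N -> (0 < t)%N -> f * w ^+ t <> w ^- t * f.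
  move=> fd t0 fw.
  have fY : (D (f * w ^+ t)%g (w ^- t) <= d)%N by rewrite fw dist_mulr.
  have YZ : D 1 (w ^+ t) = D 1 (w ^- t) by rewrite !dist1 (lenV L).
  pose P s := g ^+ n * (c * g ^+ s); pose Q s := c * g ^- (n + s).
  have close s : (n + s <= m)%N -> (D (f * P s)%g (Q s) <= eta')%N.
    move=> sm; have sm' : (s <= m)%N by lia.
    have b1 := between_bend L hyp qa overlap_c n_large m_large t0 sm'.
    have b2 := between_bend_inverse L hyp qa overlap_c n_large m_large t0 sm.
    have q1 := moved_between L fd fY YZ b1.
    have q2 : (D 1 (Q s) + D (Q s) (w ^- t) <= D 1 (w ^- t) + (kappa'' + 2 * d))%N.
      by apply: leq_trans b2 _; rewrite leq_add2l /kappa'' /kappa' /kappa /C; lia.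
    apply: leq_trans (close_on_geodesic L hyp q1 q2) _; rewrite !dist1.
    have [a1 a2] := moved_len L (P s) fd;
      have [a3 a4] := len_bend L cg overlap_c n_large m_large s.
    have [a5 a6] := moved_len L (g ^- (n + s)) (leqnn C); rewrite (lenV L) in a5 a6.
    have a7 := qa n s; have a8 := lenM L (g ^+ n) (g ^+ s); rewrite -expgnDr in a8.
    rewrite -/(P s) in a1 a2 a3 a4 *; rewrite -/(Q s) in a5 a6 *; move: a1 a2 a3 a4 a5 a6 a7 a8.
    move: (len (f * P s)) (len (P s)) (len (Q s)) => l1 l2 l3.
    move: (len (g ^+ (n + s))) (len (g ^+ n)) (len (g ^+ s)) => l4 l5 l6.
    by rewrite /eta' /kappa'' /kappa' /kappa /C; lia.
  have gn : len (zpow g (- Posz n)%R) = len (g ^+ n) by rewrite (len_zpow L) abszN.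
  have gr' : len (zpow g (- Posz r)%R) = len (g ^+ r) by rewrite (len_zpow L) abszN.
  have h1 : commensurates g (c^-1 * f).
    apply: contrapT => Nh; have ld : (len (c^-1 * f)%g <= d + C)%N.
      by apply: leq_trans (lenM L _ _) _; rewrite (lenV L) addnC leq_add2r.
    have o := O3 _ (- Posz n)%R n Nh ld; rewrite gn zpow_nat in o.
    have cl := close 0%N; rewrite addn0 in cl;
      have {}cl := cl (leq_trans (leq_addr r n) (leq_addr _ _)).
    have E1 : D (zpow g (- Posz n)%R) (c^-1 * f * g ^+ n) = D (Q 0%N) (f * g ^+ n).
      by rewrite sC -mulgA translate_dist sC /Q addn0 zpowN.
    have E2 : D (f * P 0%N) (f * g ^+ n) = C by rewrite dist_mul /P expg0 mulg1 dist_mulr.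
    have t1 := tri (Q 0%N) (f * P 0%N) (f * g ^+ n); rewrite E2 (sC (Q 0%N) (f * P 0%N)) in t1.
    have [b1 b2] := moved_len L (g ^+ n) ld; rewrite E1 in o.
    by move: N1P; lia.
  have h2 : commensurates g (g ^+ n * c^-1 * f * g ^+ n * c).
    apply: contrapT => Nh.
    have E s : D (zpow g (- Posz s)%R) (g ^+ n * c^-1 * f * g ^+ n * c * g ^+ s) = D (f * P s) (Q s).
      have e1 : Q s = Q 0%N * zpow g (- Posz s)%R.
        by rewrite /Q addn0 addnC expgnDr invgM mulgA zpowN.
      have e2 : f * P s = Q 0%N * (g ^+ n * c^-1 * f * g ^+ n * c * g ^+ s).
        by rewrite /Q /P addn0 !mulgA mulgVK mulgV mul1g.
      by rewrite e1 e2 dist_mul sC.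
    have l2 : (len (g ^+ n * c^-1 * f * g ^+ n * c)%g <= eta')%N.
      have := E 0%N; rewrite /= expg0 mulg1 dist1 => ->; apply: close;
        rewrite addn0 /m -addnA; exact: leq_addr.
    have o := O4 _ (- Posz r)%R r Nh l2; rewrite gr' zpow_nat E in o.
    have cl := close r (leq_addr _ _).
    have [b1 b2] := moved_len L (g ^+ r) l2.
    by move: rP; lia.
  apply: (Nc); have -> : c = zpow g (- Posz n)%R * (c^-1 * f)^-1 * zpow g (- Posz n)%R *
      (g ^+ n * c^-1 * f * g ^+ n * c).
    by rewrite zpowN zpow_nat !invgM !invgK !mulgA !mulgVK mulgK mulgVK mulVg mul1g.
  apply: commensuratesM h2; apply: commensuratesM (commensurates_zpow _ _).
  apply: commensuratesM (commensurates_zpow _ _) _; exact: (commensuratesV L lox).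
have commute f : (len f <= d)%N -> commensurates w f ->
    exists t, (0 < t)%N /\ f * w ^+ t = w ^+ t * f.
  move=> fd /(commensurates_intertwines L loxw)[e [t [se t0 /(_ 1%R)]]].
  rewrite GRing.mulr1 => fl; exists t; split=> //; move: fl; case: se => ->.
    by rewrite GRing.mul1r.
  by rewrite GRing.mulN1r zpowN => fl; case: (backward f t fd t0).
have stays f : (len f <= d)%N -> commensurates w f -> (D (g ^+ n) (f * g ^+ n)%g <= eta)%N.
  move=> fd /(commute f fd)[t [t0 fw]]; apply: forward fd fw _.
  exact: (between_first L hyp overlap_c n_large m_large t0).
exists w; split=> //.
  move=> f fd wf; have cl := stays f fd wf; apply: contrapT => Nf.
  have o := O1 f n n Nf fd; rewrite zpow_nat in o; have [b1 b2] := moved_len L (g ^+ n) fd.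
  by move: N1P; lia.
move=> wf0; have cl := stays f0 f0d wf0; have [t [t0 fw]] := commute f0 f0d wf0.
have fl := fl0 (Posz N1); rewrite -PoszM -/n zpow_nat in fl.
(* With the other sign [f0] would carry [g ^+ n] near its inverse, farther than [eta] allows. *)
have fgn : f0 * g ^+ n = g ^+ n * f0.
  case: se0 fl => -> fl; first by rewrite fl GRing.mul1r.
  exfalso; rewrite GRing.mulN1r in fl; rewrite fl in cl.
  have E1 : D (zpow g (- Posz n)%R * f0) (zpow g (- Posz n)%R) = len f0 by rewrite dist_mulr.
  have E2 : D (zpow g n) (zpow g (- Posz n)%R) = len (g ^+ (n + n)).
    by rewrite (dist_zpow L) GRing.opprK.
  have t1 := tri (g ^+ n) (zpow g (- Posz n)%R * f0) (zpow g (- Posz n)%R).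
  rewrite E1 -[X in D X (zpow g (- Posz n)%R)]zpow_nat E2 in t1.
  by have := leq_trans t1 (leq_add cl f0d); have := qa n n; move: N1P; lia.
(* As [f0] commutes with [g ^+ n], the displacement of [w * c] by [f0] equals that of [g ^+ m] by
   [c^-1 * f0 * c], which is therefore bounded. *)
have clw : (D w (f0 * w)%g <= eta)%N.
  apply: forward f0d fw _; exact: (between_word L hyp overlap_c n_large m_large t0).
have wE : w * c = g ^+ n * (c * g ^+ m) by rewrite /w /bent_word -!mulgA mulVg mulg1.
have E : D (g ^+ m) (c^-1 * f0 * c * g ^+ m) = D (w * c) (f0 * w * c).
  have e : f0 * w * c = g ^+ n * (f0 * (c * g ^+ m)) by rewrite -mulgA wE mulgA fgn -mulgA.
  by rewrite e wE dist_mul sC -!mulgA translate_dist sC.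
have t1 := tri (w * c) w (f0 * w * c); have t2 := tri w (f0 * w) (f0 * w * c).
have e1 : D (w * c) w = C by rewrite dist_mulr.
have e2 : D (f0 * w) (f0 * w * c) = C by rewrite sC dist_mulr.
rewrite e1 in t1; rewrite e2 in t2.
have hl : (len (c^-1 * f0 * c)%g <= d + 2 * C)%N.
  apply: leq_trans (lenM L _ _) _; rewrite mul2n -addnn addnA leq_add2r.
  by apply: leq_trans (lenM L _ _) _; rewrite (lenV L) addnC leq_add2r.
have o := O2 _ m m Ngf0 hl; rewrite zpow_nat E in o.
have [b1 b2] := moved_len L (g ^+ m) hl.
by move: N2P; lia.
Qed.

End Step.

(** * Ping-pong *)

Section PingPong.
Variables (G : groupType) (A B : subgroup G) (U : set G).
Hypothesis A_out : forall a, subgroup_set A a -> ~ U a.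
Hypothesis A_moves : forall a x, subgroup_set A a -> a <> 1 -> U x -> ~ U (a * x).
Hypothesis B_moves : forall b x, subgroup_set B b -> b <> 1 -> ~ U x -> U (b * x).

Let fam := pair_family (subgroup_type A) (subgroup_type B).
Let letter := {b : bool & fam b}.
Let lift := freeprod2_lift (subgroup_incl A) (subgroup_incl B).

Let incl (x : letter) : freeprod2 (subgroup_type A) (subgroup_type B) :=
  freeprod_incl (projT2 x).

Let value (x : letter) : G := lift (incl x).

Let side (x : letter) : bool := projT1 x.

Let letter_inl (a : subgroup_type A) : letter := existT fam true a.
Let letter_inr (b : subgroup_type B) : letter := existT fam false b.

Lemma value_inl a : value (letter_inl a) = val a.
Proof. exact: ((freeprod2_liftE (subgroup_incl A) (subgroup_incl B)).1 a). Qed.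

Lemma value_inr b : value (letter_inr b) = val b.
Proof. exact: ((freeprod2_liftE (subgroup_incl A) (subgroup_incl B)).2 b). Qed.

Lemma letterP (P : letter -> Prop) :
  (forall a, P (letter_inl a)) -> (forall b, P (letter_inr b)) -> forall x, P x.
Proof. by move=> PA PB [[] a]; [apply: PA | apply: PB]. Qed.

Lemma value_side x : if side x then subgroup_set A (value x) else subgroup_set B (value x).
Proof.
move: x; apply: letterP => a.
  change (subgroup_set A (value (letter_inl a))); rewrite (value_inl a).
  exact: (subgroup_valP (H := fun _ : unit => A) (l := tt)).
change (subgroup_set B (value (letter_inr a))); rewrite (value_inr a).
exact: (subgroup_valP (H := fun _ : unit => B) (l := tt)).
Qed.

Lemma incl1 b : incl (existT fam b 1) = 1.
Proof. exact: (morph_mulg1 (@freeprod_inclM bool fam b)). Qed.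

Lemma value_neq1 x : incl x <> 1 -> value x <> 1.
Proof.
move: x; apply: letterP => a N a1; apply: N.
  have -> : a = 1 by apply: val_inj; rewrite -(value_inl a) a1.
  exact: (incl1 true).
have -> : a = 1 by apply: val_inj; rewrite -(value_inr a) a1.
exact: (incl1 false).
Qed.

Let word (s : seq letter) := \prod_(x <- s) incl x.

Fixpoint reduced (s : seq letter) : Prop :=
  if s is x :: s' then
    incl x <> 1 /\ reduced s' /\ (if s' is y :: _ then side x <> side y else True)
  else True.

Lemma same_side_mul x y : side x = side y ->
  exists2 z, side z = side x & incl z = incl x * incl y.
Proof.
case: x y => [b a] [b' a'] /= E; rewrite /side /= in E; subst b'.
exists (existT _ b (a * a')) => //; exact: (@freeprod_inclM bool fam b).
Qed.

Lemma reduced_cons x s : reduced s -> exists2 s', reduced s' & word s' = incl x * word s.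
Proof.
move=> rs; have [x1|xN] := pselect (incl x = 1).
  by exists s => //; rewrite x1 mul1g.
case: s rs => [|y s] /= rs.
  by exists [:: x] => //; rewrite /word !big_cons.
have [xy|xy] := pselect (side x = side y); last first.
  by exists (x :: y :: s) => //; rewrite /word !big_cons.
have [z zx zE] := same_side_mul xy; move: rs => [yN [rs sy]].
have E : incl x * word (y :: s) = incl z * word s by rewrite /word big_cons mulgA zE.
rewrite E; have [z1|zN] := pselect (incl z = 1).
  by exists s => //; rewrite z1 mul1g.
exists (z :: s); last by rewrite /word big_cons.
split=> //; split=> //; case: s {rs E} sy => // u s.
by rewrite zx xy.
Qed.

Lemma reduced_exists z : exists2 s, reduced s & z = word s.
Proof.
have mulP s : forall z, (exists2 t, reduced t & z = word t) ->
    exists2 t, reduced t & word s * z = word t.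
  elim: s => [|x s IH] u [t rt ->].
    by exists t => //; rewrite /word big_nil mul1g.
  have [t' rt' E] := IH _ (ex_intro2 _ _ t rt erefl).
  have [t2 rt2 E2] := reduced_cons x rt'.
  by exists t2 => //; rewrite E2 -E mulgA {1}/word big_cons.
have nilP : exists2 t, reduced t & 1 = word t by exists [::] => //; rewrite /word big_nil.
elim/presented_ind: z => [|x|y z [s rs ->] [t rt ->]|z [s rs ->]].
- exact: nilP.
- have [t rt E] := mulP [:: x] 1 nilP; exists t => //.
  by rewrite -E mulg1 /word big_seq1 /incl; case: (x).
- by apply: mulP; exists t.
- have [t E] : exists t, (word s)^-1 = word t.
    elim: s {rs} => [|x s [t E]]; first by exists [::]; rewrite /word big_nil invg1.
    exists (t ++ [:: existT fam (projT1 x) (projT2 x)^-1]).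
    rewrite /word big_cons big_cat big_seq1 invgM -/(word s) -/(word t) E; congr (_ * _).
    exact/esym/(morph_mulgV (@freeprod_inclM bool fam (projT1 x))).
  by rewrite E -[word t]mulg1; apply: mulP.
Qed.

Lemma lift_word_cons x s : lift (word (x :: s)) = value x * lift (word s).
Proof. by rewrite /word big_cons gmulfM. Qed.

Lemma lift_word_nil : lift (word [::]) = 1.
Proof. by rewrite /word big_nil multiplicative1. Qed.

Lemma reduced_position x s : reduced (x :: s) ->
  if side x then ~ U (lift (word (x :: s))) else U (lift (word (x :: s))).
Proof.
elim: s x => [|y s IH] x [xN [rs xy]].
  rewrite lift_word_cons lift_word_nil; have := value_side x; case: (side x) => vx.
    by rewrite mulg1; apply: A_out.
  by apply: B_moves (value_neq1 xN) (A_out (subgroup1 A)).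
have := IH y rs; rewrite (lift_word_cons x); have := value_side x.
case: (side x) (side y) xy => [] [] // _ vx Uy.
  exact: A_moves (value_neq1 xN) Uy.
exact: B_moves (value_neq1 xN) Uy.
Qed.

(** A word beginning in [B] sends 1 into [U]. For one beginning in [A], [A_out] is needed on all of
    [A]: if the product were 1, the tail, if nonempty, would be an element of [A] lying in [U]. *)
Lemma reduced_lift_neq1 x s : reduced (x :: s) -> lift (word (x :: s)) <> 1.
Proof.
move=> rs E; have := reduced_position rs; have := value_side x; rewrite E.
case xs : (side x) => vx; last by move=> /(A_out (subgroup1 A)).
move=> _; move: rs E; rewrite lift_word_cons; case: s => [|y s] [xN [rs xy]].
  by rewrite lift_word_nil mulg1; apply: value_neq1.
move=> E; have := reduced_position rs; rewrite xs in xy; case: (side y) xy => // _.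
have -> : lift (word (y :: s)) = (value x)^-1 by apply/esym/mulg1_eq.
by apply: A_out; have := subgroup_div (subgroup1 A) vx; rewrite div1g.
Qed.

Theorem pingpong : canonically_free_product A B.
Proof.
suff K z : lift z = 1 -> z = 1.
  move=> x y xy; apply: divg1_eq; apply: K.
  by rewrite gmulfM multiplicativeV -[lift x]/(freeprod2_lift _ _ x) xy mulgV.
have [[|x s] rs ->] := reduced_exists z; first by rewrite /word big_nil.
by move=> /(reduced_lift_neq1 rs).
Qed.

End PingPong.

(** * A loxodromic element in free position with a finite set *)

Section Naive.
Variables (G : groupType) (len : G -> nat) (L : length_function len) (delta : nat).
Hypothesis hyp : hyperbolic len delta.
Hypothesis acyl : acylindrical len.
Hypothesis unbounded : forall n, exists g, (n <= len g)%N.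
Hypothesis non_elementary : ~ elementary G.
Hypothesis no_finite_normal : forall N : subgroup G,
  normal_subgroup N -> finite_set N -> N `<=` [set 1].
Local Notation D := (dist len).
Implicit Types (f g h x y z : G) (s : seq G).

Let tri := dist_tri L.
Let sC := distC L.

Lemma seq_len_bound s : exists d, forall f, f \in s -> (len f <= d)%N.
Proof.
elim: s => [|a s [d dP]]; first by exists 0%N.
exists (len a + d)%N => f; rewrite inE => /orP[/eqP->|/dP]; lia.
Qed.

(** Induction on a list [t] containing the elements of [s] that still commensurate [g]. The bound
    [d] on the lengths of all of [s] lets [bent_word_commensurator] remove one of them without
    creating new ones. *)
Lemma loxodromic_avoiding s : (forall f, f \in s -> f <> 1) ->
  exists g, loxodromic len g /\ forall f, f \in s -> ~ commensurates g f.
Proof.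
move=> s1; have [g lox] := loxodromic_exists L hyp unbounded.
have [d dP] := seq_len_bound s.
have : forall f, f \in s -> commensurates g f -> f \in s by [].
move: {2}s => t; move: {2}(size t) (leqnn (size t)) => n.
elim: n t g lox => [|n IH] t g lox tn bad.
  exists g; split=> // f fs gf; have := bad f fs gf.
  by case: t tn {bad}.
have [[f0 [f0s gf0]]|N] := pselect (exists f, f \in s /\ commensurates g f); last first.
  by exists g; split=> // f fs gf; apply: N; exists f.
have [c Nc] := commensurator_core L hyp acyl non_elementary no_finite_normal lox (s1 _ f0s).
have [w [loxw wg wf0]] := bent_word_commensurator L hyp acyl lox gf0 Nc (dP _ f0s).
apply: (IH [seq x <- t | x != f0] w loxw).
  rewrite size_filter (_ : count _ t = size t - count (pred1 f0) t)%N.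
    have : (0 < count (pred1 f0) t)%N by rewrite -has_count has_pred1; apply: bad gf0.
    by lia.
  by rewrite -(count_predC (pred1 f0)) addKn; apply: eq_count.
move=> f fs wf; rewrite mem_filter (bad _ fs (wg f (dP _ fs) wf)) andbT.
by apply/eqP => E; apply: wf0; rewrite -E.
Qed.

Lemma zpow_mod f (p : nat) k : (0 < p)%N -> f ^+ p = 1 ->
  exists2 j, (j < p)%N & zpow f k = f ^+ j.
Proof.
move=> p0 fp; have p0' : Posz p != 0%R by lia.
exists `|(k %% Posz p)%Z|%N.
  by have := ltz_mod k p0'; have := modz_ge0 k p0'; lia.
rewrite {1}(divz_eq k p) zpowD GRing.mulrC zpowM zpow_nat fp.
have -> : zpow 1 (k %/ p)%Z = 1 :> G by case: (k %/ p)%Z => n /=; rewrite expg1n ?invg1.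
by rewrite mul1g -zpow_nat; congr zpow; have := modz_ge0 k p0'; lia.
Qed.

(** Enlarging the finite set by the powers of its torsion elements controls all
    nontrivial powers of all its elements. *)
Lemma loxodromic_avoiding_powers s : (forall f, f \in s -> f <> 1) ->
  exists g, loxodromic len g /\
    forall f k, f \in s -> zpow f k <> 1 -> ~ commensurates g (zpow f k).
Proof.
move=> s1.
have /choice[p pP] : forall f, exists p : nat,
    ((0 < p)%N /\ f ^+ p = 1) \/ infinite_order f.
  move=> f; have [[p [p0 fp]]|N] := pselect (exists p, (0 < p)%N /\ f ^+ p = 1).
    by exists p; left.
  by exists 0%N; right=> n n0 fn; apply: N; exists n.
(* The exponents below [p f + 2] include all residues modulo [p f] in the torsion case, and the
   exponent 1 whatever [p f] is. *)
pose t := [seq x <- [seq f ^+ k | f <- s, k <- iota 0 (p f + 2)] | x != 1].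
have tP f j : f \in s -> (j < p f + 2)%N -> f ^+ j <> 1 -> f ^+ j \in t.
  move=> fs jp fj; rewrite mem_filter; apply/andP; split; first exact/eqP.
  by apply/allpairsPdep; exists f, j; rewrite mem_iota.
have [|g [lox gt]] := @loxodromic_avoiding t.
  by move=> f; rewrite mem_filter => /andP[/eqP].
exists g; split=> // f k fs fk gfk.
have [[p0 fp]|inf] := pP f.
  have [j jp E] := zpow_mod k p0 fp; rewrite E in fk gfk.
  by apply: (gt _ (tP f j fs _ fk)) => //; lia.
(* For [f] of infinite order, some power of [zpow f k] is a nontrivial power of [g]; it commutes
   with [f], so [f] itself would commensurate [g]. *)
have k0 : k != 0%R by apply/eqP => k0; apply: fk; rewrite k0.
have [q [j [q0 E]]] := commensurates_power L hyp acyl lox gfk.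
have ft : f \in t by rewrite -[f]expg1; apply: tP; rewrite ?expg1 //; [lia | exact: s1].
apply: (gt f ft); apply: (@commensurates_int _ g f j j).
  apply/eqP => j0; move: E; rewrite j0 -zpow_nat -zpowM => E.
  apply: (inf `|(k * Posz q)%R|%N); first by lia.
  move: E; case: (k * Posz q)%R => r //= /(congr1 (fun x => x^-1)).
  by rewrite invgK invg1.
by rewrite -E -zpow_nat -zpowM zpowJ mulgK.
Qed.

(** If [zpow f k] followed [z = zpow g i] for long, its translate by [f] would follow [f * z]; but
    this translate is within [len f] of [zpow f k], so [f * z] would follow [z] and [f] would
    commensurate [g]. *)
Lemma overlap_powers g f : loxodromic len g -> ~ commensurates g f ->
  exists c1, forall i k,
    (len (zpow g i) + len (zpow f k) <= D (zpow g i) (zpow f k) + c1)%N.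
Proof.
move=> lox Nf; have [c2 O] := overlap_bound L hyp acyl lox (len f).
exists (2 * len f + delta + c2)%N => i k; set z := zpow g i; set y := zpow f k.
have o : (len z + len (f * z)%g <= D z (f * z) + c2)%N := O f i i Nf (leqnn _).
have fy : f * y = y * f by rewrite /y -{1 4}(zpow1 f) -!zpowD GRing.addrC.
have E1 : D (f * z) (f * y) = D z y by rewrite dist_mul.
have E2 : D y (f * y) = len f by rewrite fy /dist mulKg.
have h := hyp 1 y z (f * z); have t1 := tri y (f * y) (f * z).
rewrite E2 (sC (f * y)) E1 in t1; rewrite !dist1 (sC y z) in h.
have [b1 b2] := moved_len L z (leqnn (len f)).
move: o h t1 b1 b2; move: (D z y) (D z (f * z)) (D y (f * z)) => d1 d2 d3.
by move: (len (f * z)) (len z) (len y) (len f) => l1 l2 l3 l4; lia.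
Qed.

Theorem acylindrical_Pnai : property_Pnai G.
Proof.
move=> F finF F1; have [s sE] := (finite_seqP F).1 finF.
have sF f : F f <-> f \in s by rewrite sE.
have [|g [lox gP]] := @loxodromic_avoiding_powers s.
  by move=> f /sF Ff f1; apply: F1; rewrite -f1.
have gf f : f \in s -> ~ commensurates g f.
  move=> fs; have := gP f 1%R fs; rewrite zpow1; apply.
  by move=> f1; apply: F1; rewrite -f1; apply/sF.
have [c1 c1P] : exists c1, forall f, f \in s -> forall i k,
    (len (zpow g i) + len (zpow f k) <= D (zpow g i) (zpow f k) + c1)%N.
  have [|f m n|c cP] := @finite_set_bound _ nat 0%N addn [set` s]
      (fun f c => forall i k,
        (len (zpow g i) + len (zpow f k) <= D (zpow g i) (zpow f k) + c)%N)
      (finite_seq s).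
  - by move=> f /= fs; apply: overlap_powers lox (gf f fs).
  - by case=> P i k; apply: leq_trans (P i k) _; lia.
  - by exists c => f fs; apply: cP.
have [c2 O] := overlap_bound L hyp acyl lox (c1 + delta).
pose t := (c1 + c2 + 2 * (c1 + delta) + 2 * delta + 1)%N.
have [[cg qa] gr] := lox; have [N0 N0P] := gr t; pose N := N0.+1.
pose g0 := g ^+ N.
have zg0 j : zpow g0 j = zpow g (Posz N * j)%R by rewrite zpowM.
have g0_len j : j != 0%R -> (t <= len (zpow g0 j))%N.
  move=> j0; rewrite zg0 (len_zpow L); apply: N0P; rewrite abszM absz_nat /N.
  by apply: leq_trans (leqnSn N0) _; apply: leq_pmulr; lia.
have t0 : (0 < t)%N by rewrite /t; lia.
have len1 : len 1 = 0%N by apply/(len_eq1 L).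
exists g0; split.
  move=> n n0 gn; have n0' : Posz n != 0%R by lia.
  by have := g0_len _ n0'; rewrite zpow_nat gn len1; lia.
move=> f /sF fs.
(* In terms of Gromov products based at 1: the product of [x] with some power of [g0] is at least
   half of [t]. *)
pose U := [set x | exists b, (D x (zpow g0 b) + t <= len x + len (zpow g0 b))%N].
have fU k : ~ U (zpow f k).
  move=> [b]; have := c1P f fs (Posz N * b)%R k; rewrite -zg0 sC.
  by rewrite /t; lia.
apply: (@pingpong G _ _ U).
- by move=> a /gen1P[k ->]; apply: fU.
- move=> a x /gen1P[k ->] fk1 [b xb] [b' yb']; set h := zpow f k in fk1 xb yb' *.
  have Nh : ~ commensurates g h := gP f k fs fk1.
  set zb := zpow g0 b in xb; set zb' := zpow g0 b' in yb'; set y := h * x in yb'.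
  have q1 : (len zb + len (h^-1) <= D zb (h^-1)%g + c1)%N.
    by have := c1P f fs (Posz N * b)%R (- k)%R; rewrite -zg0 zpowN.
  have q2 : (len zb' + len h <= D zb' h + c1)%N.
    by have := c1P f fs (Posz N * b')%R k; rewrite -zg0.
  have h1 := hyp 1 x zb h^-1; have h2 := hyp 1 y zb' h.
  have E1 : D x h^-1 = len y by rewrite sC /dist invgK.
  have E2 : D y h = len x by rewrite sC /dist mulKg.
  rewrite !dist1 E1 (lenV L) in h1; rewrite !dist1 E2 in h2.
  rewrite (lenV L) in q1.
  (* Since [x] follows [g0] and [h^-1] does not, [len (h * x)] is at least [len h + len x] up to
     [c1 + delta]; symmetrically with [x] and [h * x] exchanged. Adding the two bounds [len h], so
     that [c2] applies to [h]. *)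
  have hB : (len h <= c1 + delta)%N.
    by move: xb yb'; rewrite /t; lia.
  have o := O h (Posz N * b')%R (Posz N * b)%R Nh hB; rewrite -!zg0 -/zb -/zb' in o.
  have E3 : D y (h * zb) = D x zb by rewrite dist_mul.
  have [b1 b2] := moved_len L zb hB; have [b3 b4] := moved_len L x hB.
  have h3 := hyp 1 y zb' (h * zb); rewrite !dist1 E3 in h3.
  move: b1 b2 b3 b4 h3 o xb yb'; rewrite -/y; move: (len (h * zb)) (D zb' (h * zb)) => l1 l2.
  by rewrite /t; lia.
- move=> a x /gen1P[j ->] gj1 Ux.
  have j0 : j != 0%R by apply/eqP => j0; apply: gj1; rewrite j0.
  (* As [x] does not follow [zpow g0 (- j)], little cancels in [zpow g0 j * x], which therefore
     follows [zpow g0 j]; the length of that power is at least [t], which absorbs the loss. *)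
  exists j; have lj := g0_len j j0.
  have E1 : D (zpow g0 j * x) (zpow g0 j) = len x by rewrite dist_mulr.
  have E2 : len (zpow g0 j * x) = D x (zpow g0 (- j)%R) by rewrite sC /dist zpowN invgK.
  have E3 : len (zpow g0 (- j)%R) = len (zpow g0 j) by rewrite zpowN (lenV L).
  rewrite E1 E2.
  have : ~ (D x (zpow g0 (- j)%R) + t <= len x + len (zpow g0 (- j)%R))%N.
    by move=> le; apply: Ux; exists (- j)%R.
  by rewrite E3; lia.
Qed.

End Naive.

Lemma finite_elementary (G : groupType) : finite_set [set: G] -> elementary G.
Proof.
move=> finG; exists (gen [set 1]); split; first by exists 1.
by apply: sub_finite_set (finite_image (fun x : G => [set x * h | h in gen [set 1]]) finG) => _ [x _ <-]; exists x.
Qed.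

Theorem theorem1 (G : groupType) (Lambda : Type) (H : Lambda -> subgroup G)
    (hne : ~ elementary G)
    (hrel : relatively_hyperbolic H)
    (hproper : forall l : Lambda, (H l : set G) <> setT)
    (E : subgroup G) (hE : max_finite_normal_subgroup E)
    (hE1 : (E : set G) = [set 1%g]%classic) :
  property_Pnai G.
Proof.
have infG : ~ finite_set [set: G] by move=> /finite_elementary.
have [len [delta [L hyp acyl unb]]] := relatively_hyperbolic_acylindrical hrel hproper infG.
apply: (acylindrical_Pnai L hyp acyl unb hne) => N nN fN; rewrite -hE1.
by have [_ _] := hE; apply.
Qed.
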